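(* Let $\Sigma_g$ be a closed Riemann surface of genus $g$. Let $G$ be a finite subgroup of the automorphism group of $\Sigma_g$. If $|G|\geq 5$, then $d_g(G)\leq |G|$.
   Context: Closed Riemann surfaces are connected. $\mathrm{O}(n)$ is the orthogonal group acting on $\mathbb{R}^n$. An embedding $e:\Sigma_g\rightarrow\mathbb{R}^n$ is $G$-equivariant if there exists an injective homomorphism $\rho:G\rightarrow\mathrm{O}(n)$ such that $e(h(x))=\rho(h)(e(x))$ for all $h\in G$ and $x\in\Sigma_g$. The minimal embedding dimension $d_g(G)$ of the pair $(\Sigma_g,G)$ is the minimal $n$ such that there exists a smooth $G$-equivariant embedding $\Sigma_g\rightarrow\mathbb{R}^n$. *)

(* Defs.v *)
From mathcomp Require Import all_boot all_order all_algebra.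
From mathcomp Require Import finmap complex.
From mathcomp Require Import all_classical all_reals all_analysis.

Set Implicit Arguments.
Unset Strict Implicit.
Unset Printing Implicit Defensive.

Import Order.TTheory GRing.Theory Num.Theory numFieldNormedType.Exports.

Local Open Scope classical_set_scope.
Local Open Scope ring_scope.

(* Complex differentiability at every point of [V]; the scalar field of the
   normed module [R[i]^o] is [R[i]] itself, so [derivable f z 1] asserts the
   existence of the limit of (f (h + z) - f z) / h for complex h -> 0. *)
Definition holomorphic_on (R : realType) (V : set R[i]^o)
    (f : R[i]^o -> R[i]^o) : Prop :=
  forall z, V z -> derivable f z 1.

(* C^k and C^oo on an open set, between real normed modules.  The source is
   finite dimensional in all uses. *)
Fixpoint Ck_on (R : realType) (U W : normedModType R) (k : nat) (V : set U)
    (f : U -> W) : Prop :=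
  if k is k'.+1 then
    (forall p, V p -> differentiable f p) /\
    (forall v : U, Ck_on k' V ('D_v f))
  else forall p, V p -> {for p, continuous f}.

Definition smooth_on (R : realType) (U W : normedModType R) (V : set U)
    (f : U -> W) : Prop :=
  forall k, Ck_on k V f.

(* A homeomorphism from the open set [dom] of [M] onto the open set [img] of
   the complex plane, with inverse [param].  Both maps are total functions whose
   values outside [dom] and [img] are irrelevant. *)
Record chart (R : realType) (M : topologicalType) := Chart {
  dom : set M;
  img : set R[i]^o;
  coord : M -> R[i]^o;
  param : R[i]^o -> M;
  open_dom : open dom;
  open_img : open img;
  coord_img : forall x, dom x -> img (coord x);
  param_dom : forall z, img z -> dom (param z);
  coordK : forall x, dom x -> param (coord x) = x;
  paramK : forall z, img z -> coord (param z) = z;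
  coord_continuous : forall x, dom x -> {for x, continuous coord};
  param_continuous : forall z, img z -> {for z, continuous param} }.

Record riemannSurface (R : realType) := RiemannSurface {
  points :> topologicalType;
  atlas : set (chart R points);
  surface_nonempty : [set: points] !=set0;
  surface_connected : connected [set: points];
  surface_hausdorff : hausdorff_space points;
  atlas_cover : forall x, exists2 c, atlas c & dom c x;
  atlas_compatible : forall c d, atlas c -> atlas d ->
    holomorphic_on (img c `&` param c @^-1` dom d) (coord d \o param c) }.

(* Surfaces have no boundary here, so "closed" means compact. *)
Definition closed_surface (R : realType) (S : riemannSurface R) : Prop :=
  compact [set: S].

Definition simple_closed_curve (R : realType) (M : topologicalType)
    (gamma : R -> M) : Prop :=
  [/\ {within `[0, 1], continuous gamma},
      gamma 0 = gamma 1
    & {in `[0, 1[ &, injective gamma}].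

(* [k] pairwise disjoint simple closed curves that do not disconnect [M]. *)
Definition nonseparating_curves (R : realType) (M : topologicalType) (k : nat)
    (gamma : 'I_k -> R -> M) : Prop :=
  [/\ forall i, simple_closed_curve (gamma i),
      forall i j, i != j ->
        (gamma i @` `[0, 1]) `&` (gamma j @` `[0, 1]) = set0
    & connected (~` \bigcup_i (gamma i @` `[0, 1]))].

(* The topological genus: the maximal number of disjoint simple closed curves
   that can be removed together without disconnecting the surface. *)
Definition has_genus (R : realType) (S : riemannSurface R) (g : nat) : Prop :=
  (exists gamma : 'I_g -> R -> S, nonseparating_curves gamma) /\
  (forall k, (exists gamma : 'I_k -> R -> S, nonseparating_curves gamma) ->
    (k <= g)%N).

Definition holomorphic_map (R : realType) (S : riemannSurface R)
    (f : S -> S) : Prop :=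
  continuous f /\
  forall c d, atlas c -> atlas d ->
    holomorphic_on (img c `&` (f \o param c) @^-1` dom d)
      (coord d \o f \o param c).

Definition automorphism (R : realType) (S : riemannSurface R)
    (f : S -> S) : Prop :=
  holomorphic_map f /\
  exists f' : S -> S, [/\ holomorphic_map f', cancel f f' & cancel f' f].

Definition finite_automorphism_group (R : realType) (S : riemannSurface R)
    (G : set (S -> S)) : Prop :=
  [/\ finite_set G,
      forall h, G h -> automorphism h,
      G id,
      forall h k, G h -> G k -> G (h \o k)
    & forall h, G h -> exists h', [/\ G h', cancel h h' & cancel h' h]].

Definition orthogonal_mx (R : realType) (n : nat) (A : 'M[R]_n) : Prop :=
  A^T *m A = 1%:M.

(* The expression of [e] in the real coordinates (x, y) of a chart. *)
Definition chart_expr (R : realType) (S : riemannSurface R) (n : nat)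
    (e : S -> 'cV[R]_n) (c : chart R S) : R * R -> 'cV[R]_n :=
  fun p => e (param c (p.1 +i* p.2)%C).

Definition real_img (R : realType) (S : riemannSurface R) (c : chart R S) :
    set (R * R) :=
  [set p | img c (p.1 +i* p.2)%C].

(* An injective immersion that is a homeomorphism onto its image. *)
Definition smooth_embedding (R : realType) (S : riemannSurface R) (n : nat)
    (e : S -> 'cV[R]_n) : Prop :=
  [/\ forall c, atlas c -> smooth_on (real_img c) (chart_expr e c),
      forall c, atlas c -> forall p, real_img c p ->
        injective ('d (chart_expr e c) p),
      injective e,
      continuous e
    & forall U : set S, open U -> exists2 W, open W & e @^-1` W = U].

Definition equivariant (R : realType) (S : riemannSurface R)
    (G : set (S -> S)) (n : nat) (e : S -> 'cV[R]_n) : Prop :=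
  exists rho : (S -> S) -> 'M[R]_n,
    [/\ forall h, G h -> orthogonal_mx (rho h),
        forall h k, G h -> G k -> rho (h \o k) = rho h *m rho k,
        forall h k, G h -> G k -> rho h = rho k -> h = k
      & forall h x, G h -> e (h x) = rho h *m e x].

Definition equivariantly_embeds (R : realType) (S : riemannSurface R)
    (G : set (S -> S)) (n : nat) : Prop :=
  exists e : S -> 'cV[R]_n, smooth_embedding e /\ equivariant G e.

(* [d] is the minimal embedding dimension of the pair (S, G). *)
Definition min_embedding_dim (R : realType) (S : riemannSurface R)
    (G : set (S -> S)) (d : nat) : Prop :=
  equivariantly_embeds G d /\
  forall n, equivariantly_embeds G n -> (d <= n)%N.

(* Main.v *)
(** Embed S by x |-> (f(g x))_{g in G}, which is equivariant for the regular
    representation, for a suitable smooth f : S -> R.  By compactness S has finitely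
    many smooth real functions separating points and tangent directions; f is sought
    among the polynomials of degree 2|G| in them, a finite-dimensional family rich
    enough to interpolate on orbits.  The coefficient vectors a for which the map
    identifies a pair x <> y, or kills a tangent direction at x, are those killed by
    one of the matrices of a Lipschitz family with r independent rows depending on
    d < r real parameters, hence locally form a nowhere dense set: r = |G| and d = 4
    for pairs in different orbits, r = 3 and d = 2 for pairs in one orbit, r = |G| and
    d = 3 for directions.  Independence fails at points with nontrivial stabilizer,
    but these are finitely many because a nontrivial automorphism of finite order has
    isolated fixed points, and there r = 2 and d = 1 is enough for directions since
    the stabilizer acts on the tangent line by roots of unity.  By compactness
    countably many nowhere dense sets suffice, and Baire's theorem provides f. *)

(* The nowhere density of the exceptional sets is obtained without Sard's theorem and without a
   theory of dimension: a pigeonhole argument on a grid of parameters replaces both, and it asks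
   only for Lipschitz dependence of the equations. For directions the equations contain first
   derivatives, so their Lipschitz dependence takes two derivatives of the chart changes, which are
   given as complex differentiable at each point and no more. This is why the proof starts at
   Goursat's lemma. The degree 2|G| comes from prescribing a derivative at one point of an orbit:
   squared factors kill values and derivatives at the other |G| - 1 points, and one further factor
   vanishes to first order at the point itself. Pairs in one orbit form a separate case because for
   y = g x the differences f(k x) - f(k g x) add up to zero as k runs through a coset of the cyclic
   group of g. Countably many sets occur, and not finitely many, because the points with trivial
   stabilizer form an open set that need not be compact; it is exhausted by compact pieces. *)
Require Import Defs.
From HB Require Import structures.
From mathcomp Require Import all_boot all_order all_algebra.
From mathcomp Require Import finmap complex.
From mathcomp Require Import all_classical all_reals all_analysis.
From mathcomp Require Import ring lra.

Set Implicit Arguments.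
Unset Strict Implicit.
Unset Printing Implicit Defensive.

Import Order.TTheory GRing.Theory Num.Theory numFieldNormedType.Exports.
Import Normc.

Local Open Scope classical_set_scope.
Local Open Scope ring_scope.

(** * Complex derivatives *)

Section ComplexBasics.
Variable R : realType.
Local Notation C := (R[i]).
Local Notation Co := (R[i]^o).
Local Notation Re := (@complex.Re R).
Local Notation Im := (@complex.Im R).
Implicit Types (z w : C) (f : Co -> Co).

Lemma normc_ge0 z : 0 <= normc z.
Proof. by case: z => a b; exact: sqrtr_ge0. Qed.

Lemma normc_gt0 z : z != 0 -> 0 < normc z.
Proof.
move=> z0; rewrite lt_neqAle normc_ge0 andbT eq_sym.
by apply: contra z0 => /eqP/eq0_normc ->.
Qed.

Lemma ReD z w : Re (z + w) = Re z + Re w. Proof. by case: z; case: w. Qed.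
Lemma ImD z w : Im (z + w) = Im z + Im w. Proof. by case: z; case: w. Qed.
Lemma ReN z : Re (- z) = - Re z. Proof. by case: z. Qed.
Lemma ImN z : Im (- z) = - Im z. Proof. by case: z. Qed.
Lemma ReM z w : Re (z * w) = Re z * Re w - Im z * Im w.
Proof. by case: z => a b; case: w. Qed.
Lemma ImM z w : Im (z * w) = Re z * Im w + Im z * Re w.
Proof. by case: z => a b; case: w. Qed.
Lemma ReB z w : Re (z - w) = Re z - Re w. Proof. by rewrite ReD ReN. Qed.
Lemma ImB z w : Im (z - w) = Im z - Im w. Proof. by rewrite ImD ImN. Qed.

Lemma Re_le_normc z : `|Re z| <= normc z.
Proof.
by case: z => a b /=; rewrite -sqrtr_sqr; apply: ler_wsqrtr; rewrite lerDl sqr_ge0.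
Qed.

Lemma Im_le_normc z : `|Im z| <= normc z.
Proof.
by case: z => a b /=; rewrite -sqrtr_sqr; apply: ler_wsqrtr; rewrite lerDr sqr_ge0.
Qed.

Lemma normcR (x : R) : normc (x%:C)%C = `|x|.
Proof. by rewrite /= expr0n /= addr0 sqrtr_sqr. Qed.

Lemma normc_i : normc ('i : C)%C = 1.
Proof. by rewrite /= expr0n /= add0r expr1n sqrtr1. Qed.

Lemma normc_le_ReIm z : normc z <= `|Re z| + `|Im z|.
Proof.
rewrite [z in normc z]complexE; apply: (le_trans (le_normcD _ _)).
by rewrite normcM normc_i mul1r !normcR.
Qed.

Lemma normc_eq0 z : (normc z == 0) = (z == 0).
Proof. by apply/eqP/eqP => [/eq0_normc|->]; rewrite ?normc0. Qed.

Lemma normc_distC z w : normc (z - w) = normc (w - z).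
Proof. by rewrite -normcN opprB. Qed.

Lemma normcX z n : normc (z ^+ n) = normc z ^+ n.
Proof. by elim: n => [|n IH]; rewrite ?expr0 ?normc1 // !exprS normcM IH. Qed.

Lemma posC (e : C) : 0 < e -> exists2 r : R, 0 < r & e = (r%:C)%C.
Proof.
case: e => a b; rewrite ltcE /= => /andP[/eqP -> a0]; by exists a.
Qed.

Lemma nbhsC (z : Co) (A : set Co) :
  nbhs z A <-> exists2 d : R, 0 < d & forall w, normc (w - z) < d -> A w.
Proof.
split.
  move=> /nbhs_ballP[e /= /posC[r r0 ->] H]; exists r => // w wz.
  by apply: H; rewrite /ball/= ltcR normc_distC.
move=> [d d0 H]; apply/nbhs_ballP; exists (d%:C)%C => /=; first by rewrite ltcR.
by move=> w; rewrite /ball/= ltcR normc_distC; exact: H.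
Qed.

Lemma nbhsR (x : R) (A : set R) :
  nbhs x A <-> exists2 d : R, 0 < d & forall y, `|y - x| < d -> A y.
Proof.
split.
  by move=> /nbhs_ballP[e /= e0 H]; exists e => // y yx; apply: H; rewrite /ball/= distrC.
move=> [d d0 H]; apply/nbhs_ballP; exists d => //= y; rewrite /ball/= distrC; exact: H.
Qed.

Lemma continuous_Re : continuous (Re : Co -> R).
Proof.
move=> z A /nbhsR[d d0 H]; apply/nbhsC; exists d => // w wz; apply: H.
by rewrite -ReB; exact: le_lt_trans (Re_le_normc _) wz.
Qed.

Lemma continuous_Im : continuous (Im : Co -> R).
Proof.
move=> z A /nbhsR[d d0 H]; apply/nbhsC; exists d => // w wz; apply: H.
by rewrite -ImB; exact: le_lt_trans (Im_le_normc _) wz.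
Qed.

Lemma continuous_mkC (T : topologicalType) (a b : T -> R) (t : T) :
  {for t, continuous a} -> {for t, continuous b} ->
  {for t, continuous (fun t => (a t +i* b t)%C : Co)}.
Proof.
move=> ca cb A /nbhsC[d d0 H].
have d2 : 0 < d / 2 by rewrite divr_gt0.
have na : \forall s \near t, `|a s - a t| < d / 2.
  by apply: (ca [set y | `|y - a t| < d / 2]); apply/nbhsR; exists (d / 2).
have nb : \forall s \near t, `|b s - b t| < d / 2.
  by apply: (cb [set y | `|y - b t| < d / 2]); apply/nbhsR; exists (d / 2).
near=> s; apply: H; apply: le_lt_trans (normc_le_ReIm _) _ => /=.
by rewrite (splitr d) ltrD //; near: s.
Unshelve. all: by end_near. Qed.

(** The derivative as an estimate without a quotient: w = z needs no exclusion, and remainders can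
    be added and integrated. [cderP] identifies it with the derivative of the library. *)
Definition cder f z (l : C) := forall e : R, 0 < e -> exists2 d : R, 0 < d &
  forall w, normc (w - z) < d -> normc (f w - f z - l * (w - z)) <= e * normc (w - z).

Lemma cderP f z l : cder f z l <-> is_derive (z : Co) (1 : Co) f l.
Proof.
split => [H|[df dl]].
  have cv : (fun h : Co => h^-1 *: (f (h *: 1 + z) - f z)) @ 0^' --> (l : Co).
    apply/cvgrPdist_le => e /posC[r r0 ->].
    have [d d0 {}H] := H r r0.
    rewrite near_withinE; apply/nbhsC; exists d => // h; rewrite subr0 => hd h0.
    have := H (h + z); rewrite addrK => /(_ hd) {}H.
    have -> : l - h^-1 *: (f (h *: 1 + z) - f z) = - h^-1 * (f (h + z) - f z - l * h).
      have -> : h *: (1 : Co) = h by exact: mulr1.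
      rewrite [_ *: _]/(h^-1 * _) mulrBr !mulNr mulrCA opprK mulVf //.
      by rewrite mulr1 addrC.
    rewrite lecR normcM normcN normcV ler_pdivrMl ?normc_gt0 //.
    by rewrite [leRHS]mulrC.
  split; first exact: cvgP cv.
  exact: cvg_lim cv.
have cv : (fun h : Co => h^-1 *: (f (h *: 1 + z) - f z)) @ 0^' --> (l : Co).
  by rewrite -dl; exact: df.
move=> e e0; move/cvgrPdist_le : cv => /(_ (e%:C)%C).
rewrite ltcR => /(_ e0); rewrite near_withinE => /nbhsC[d d0 H].
exists d => // w wz; have [->|nz] := eqVneq w z.
  by rewrite !subrr mulr0 subr0 normc0 mulr0.
have hz : w - z != 0 by rewrite subr_eq0.
have := H (w - z); rewrite subr0 => /(_ wz hz).
have -> : (w - z) *: (1 : Co) = w - z by exact: mulr1.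
rewrite subrK [_ *: _]/((w - z)^-1 * _) lecR => {}H.
have -> : f w - f z - l * (w - z) = - (w - z) * (l - (w - z)^-1 * (f w - f z)).
  by field.
by rewrite normcM normcN mulrC ler_pM2r ?normc_gt0.
Qed.

Lemma cder_derivable f z l : cder f z l -> derivable (f : Co -> Co) (z : Co) 1.
Proof. by move/cderP => []. Qed.

Lemma derivable_cder f z : derivable (f : Co -> Co) (z : Co) 1 ->
  cder f z ('D_1 f z).
Proof. by move=> d; apply/cderP; split. Qed.

Lemma cder_unique f z l l' : cder f z l -> cder f z l' -> l = l'.
Proof. by move=> /cderP[_ <-] /cderP[_ <-]. Qed.

Lemma cder_near f g z l : (\forall w \near (z : Co), f w = g w) -> cder f z l -> cder g z l.
Proof.
move=> fg /cderP H; apply/cderP.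
by apply: near_eq_is_derive H => //; exact: oner_neq0.
Qed.

Lemma cder_continuous f z l : cder f z l -> {for z, continuous f}.
Proof.
move=> /cderP[/derivable1_diffP/differentiable_continuous df _]; exact: df.
Qed.

Lemma cder_cst (a : C) z : cder (fun=> a) z 0.
Proof. by apply/cderP; exact: is_derive_cst. Qed.

Lemma cder_id z : cder id z 1.
Proof. by apply/cderP; exact: is_derive_id. Qed.

Lemma cderD f g z a b : cder f z a -> cder g z b -> cder (fun w => f w + g w) z (a + b).
Proof. by move=> /cderP H /cderP K; apply/cderP; exact: is_deriveD. Qed.

Lemma cderN f z a : cder f z a -> cder (fun w => - f w) z (- a).
Proof. by move=> /cderP H; apply/cderP; exact: is_deriveN. Qed.

Lemma cderB f g z a b : cder f z a -> cder g z b -> cder (fun w => f w - g w) z (a - b).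
Proof. by move=> Hf Hg; apply: cderD => //; exact: cderN. Qed.

Lemma cderM f g z a b : cder f z a -> cder g z b ->
  cder (fun w => f w * g w) z (f z * b + g z * a).
Proof. by move=> /cderP H /cderP K; apply/cderP; exact: is_deriveM. Qed.

Lemma cderMl f z a k : cder f z a -> cder (fun w => k * f w) z (k * a).
Proof.
by move=> H; have := cderM (cder_cst k z) H; rewrite mulr0 addr0.
Qed.

Lemma cderV f z a : f z != 0 -> cder f z a -> cder (fun w => (f w)^-1) z (- (f z) ^- 2 * a).
Proof. move=> f0 /cderP[H <-]; apply/cderP.
split; first exact: derivableV.
by rewrite deriveV.
Qed.

Lemma cder_comp f g z a b : cder f z a -> cder g (f z) b -> cder (g \o f) z (b * a).
Proof.
move=> Hf Hg e e0.
(* As e' <= 1, |f w - f z| <= (|a| + 1) |w - z|, and the two errors add up to at most e' (|a| + 1 +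
   |b|) |w - z|. *)
pose N := normc b + normc a + 2.
have N0 : 0 < N by rewrite ltr_wpDl ?addr_ge0 ?normc_ge0.
pose e' := Num.min 1 (e / N).
have e'0 : 0 < e' by rewrite lt_min ltr01 divr_gt0.
have [d1 d10 H1] := Hf _ e'0.
have [d2 d20 H2] := Hg _ e'0.
have [d3 d30 H3] := (@nbhsC z [set w | normc (f w - f z) < d2]).1
  (cder_continuous Hf ((@nbhsC (f z) [set y | normc (y - f z) < d2]).2
    (ex_intro2 _ _ d2 d20 (fun _ h => h)))).
exists (Num.min d1 d3); first by rewrite lt_min d10.
move=> w; rewrite lt_min => /andP[w1 w3] /=.
have k1 := H1 _ w1; have k2 := H2 _ (H3 _ w3).
have -> : g (f w) - g (f z) - b * a * (w - z) =
  (g (f w) - g (f z) - b * (f w - f z)) + b * (f w - f z - a * (w - z)) by ring.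
apply: le_trans (le_normcD _ _) _; rewrite normcM.
have fb : normc (f w - f z) <= (normc a + 1) * normc (w - z).
  have -> : f w - f z = (f w - f z - a * (w - z)) + a * (w - z) by ring.
  apply: le_trans (le_normcD _ _) _; rewrite normcM mulrDl addrC lerD2l.
  by apply: le_trans k1 _; rewrite ler_wpM2r ?normc_ge0 // ge_min lexx.
have := ler_wpM2l (ltW e'0) fb => /(le_trans k2) {}k2.
have := ler_wpM2l (normc_ge0 b) k1 => {}k1.
apply: le_trans (lerD k2 k1) _.
have eN : e' * N <= e by rewrite -ler_pdivlMr // ge_min lexx orbT.
have := ler_wpM2r (normc_ge0 (w - z)) eN; apply: le_trans.
rewrite [leRHS](_ : _ = e' * ((normc a + 1) * normc (w - z)) +
  normc b * (e' * normc (w - z)) + e' * normc (w - z)); last by rewrite /N; ring.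
by rewrite lerDl mulr_ge0 ?normc_ge0 // ltW.
Qed.

End ComplexBasics.

(** * Goursat's lemma and Cauchy's integral formula *)

Section SegmentIntegral.
Variable R : realType.
Local Notation C := (R[i]).
Local Notation Co := (R[i]^o).
Local Notation Re := (@complex.Re R).
Local Notation Im := (@complex.Im R).
Local Notation mu := (@lebesgue_measure R).
Implicit Types (z w : C) (a b : R) (g h : R -> Co).

Definition cint a b (g : R -> Co) : C :=
  ((\int[mu]_(t in `[a, b]) Re (g t)) +i* (\int[mu]_(t in `[a, b]) Im (g t)))%C.

(** Two-sided continuity at every point, the endpoints included. This is stronger than continuity
    within the segment and passes to sums, products and inverses pointwise. *)
Definition ccont a b (g : R -> Co) := forall t, a <= t <= b -> {for t, continuous g}.

Lemma ccont_Re a b g : ccont a b g -> {within `[a, b], continuous (Re \o g)}.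
Proof.
move=> cg; apply: continuous_in_subspaceT => t; rewrite inE /= in_itv /= => /cg ct.
exact: (@continuous_comp _ _ _ g Re t ct (@continuous_Re R (g t))).
Qed.

Lemma ccont_Im a b g : ccont a b g -> {within `[a, b], continuous (Im \o g)}.
Proof.
move=> cg; apply: continuous_in_subspaceT => t; rewrite inE /= in_itv /= => /cg ct.
exact: (@continuous_comp _ _ _ g Im t ct (@continuous_Im R (g t))).
Qed.

Lemma integrable_Re a b g : ccont a b g -> mu.-integrable `[a, b] (EFin \o (Re \o g)).
Proof.
by move=> /ccont_Re; apply: continuous_compact_integrable; exact: segment_compact.
Qed.

Lemma integrable_Im a b g : ccont a b g -> mu.-integrable `[a, b] (EFin \o (Im \o g)).
Proof.
by move=> /ccont_Im; apply: continuous_compact_integrable; exact: segment_compact.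
Qed.

Lemma eq_cint a b g h : (forall t, a <= t <= b -> g t = h t) -> cint a b g = cint a b h.
Proof.
by move=> gh; congr (_ +i* _)%C; apply: eq_Rintegral => t;
  rewrite inE /= in_itv /= => /gh ->.
Qed.

Lemma cintD a b g h : ccont a b g -> ccont a b h ->
  cint a b (fun t => g t + h t) = cint a b g + cint a b h.
Proof.
move=> cg ch; rewrite /cint; congr (_ +i* _)%C.
  rewrite -RintegralD //; [|exact: integrable_Re..].
  by apply: eq_Rintegral => t _; rewrite ReD.
rewrite -RintegralD //; [|exact: integrable_Im..].
by apply: eq_Rintegral => t _; rewrite ImD.
Qed.

Lemma cintZ a b g k : ccont a b g -> cint a b (fun t => k * g t) = k * cint a b g.
Proof.
move=> cg.
have iR r : mu.-integrable `[a, b] (EFin \o (fun t => r * Re (g t))).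
  have -> : EFin \o (fun t => r * Re (g t)) = (fun t => r%:E * (Re (g t))%:E)%E.
    by apply/funext => t /=; rewrite EFinM.
  apply: integrableZl => //; exact: integrable_Re.
have iI r : mu.-integrable `[a, b] (EFin \o (fun t => r * Im (g t))).
  have -> : EFin \o (fun t => r * Im (g t)) = (fun t => r%:E * (Im (g t))%:E)%E.
    by apply/funext => t /=; rewrite EFinM.
  apply: integrableZl => //; exact: integrable_Im.
apply/eqP; rewrite eq_complex ReM ImM /=; apply/andP; split; apply/eqP.
  rewrite -!RintegralZl //; [|exact: integrable_Im|exact: integrable_Re].
  rewrite -RintegralB //.
  by apply: eq_Rintegral => t _; rewrite ReM.
rewrite -!RintegralZl //; [|exact: integrable_Re|exact: integrable_Im].
rewrite -RintegralD //.
by apply: eq_Rintegral => t _; rewrite ImM.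
Qed.

Lemma ccontD a b g h : ccont a b g -> ccont a b h -> ccont a b (fun t => g t + h t).
Proof. by move=> cg ch t tab; apply: cvgD; [exact: cg|exact: ch]. Qed.

Lemma ccontM a b g h : ccont a b g -> ccont a b h -> ccont a b (fun t => g t * h t).
Proof. by move=> cg ch t tab; apply: cvgM; [exact: cg|exact: ch]. Qed.

Lemma ccontN a b g : ccont a b g -> ccont a b (fun t => - g t).
Proof. by move=> cg t tab; apply: cvgN; exact: cg. Qed.

Lemma ccont_cst a b k : ccont a b (fun=> k).
Proof. by move=> t tab; exact: cvg_cst. Qed.

Lemma ccontV a b g : (forall t, a <= t <= b -> g t != 0) -> ccont a b g ->
  ccont a b (fun t => (g t)^-1).
Proof. by move=> g0 cg t tab; apply: cvgV; [exact: g0|exact: cg]. Qed.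

Lemma cintB a b g h : ccont a b g -> ccont a b h ->
  cint a b (fun t => g t - h t) = cint a b g - cint a b h.
Proof.
move=> cg ch; rewrite (cintD cg (@ccontN a b h ch)).
by rewrite -[- cint a b h]mulN1r -cintZ //; congr (_ + cint _ _ _); apply/funext => t; rewrite mulN1r.
Qed.

Lemma cint_cst a b k : a <= b -> cint a b (fun=> k) = k * ((b - a)%:C)%C.
Proof.
move=> ab; have e r : \int[mu]_(t in `[a, b]) r = r * (b - a).
  rewrite Rintegral_cst //= lebesgue_measure_itv /= lte_fin.
  by case: ltP => // ba; rewrite (@le_anti _ _ a b) ?ab // subrr.
apply/eqP; rewrite /cint !e eq_complex ReM ImM /=.
by rewrite !mulr0 subr0 add0r !eqxx.
Qed.

Lemma cint_split a b c g : a <= c -> c <= b -> ccont a b g ->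
  cint a b g = cint a c g + cint c b g.
Proof.
have H (u : R -> R) : a <= c -> c <= b -> mu.-integrable `[a, b] (EFin \o u) ->
    \int[mu]_(t in `[a, b]) u t = \int[mu]_(t in `[a, c]) u t + \int[mu]_(t in `[c, b]) u t.
  move=> ac cb iu; have := @Rintegral_itvB _ u (BLeft a) (BRight b) c iu.
  rewrite !bnd_simp => /(_ ac cb) E.
  rewrite -(Rintegral_itv_obnd_cbnd (r := c)) -?E; first by rewrite addrCA subrr addr0.
  apply: integrableS iu => // x /=; rewrite !in_itv /= => /andP[/ltW cx ->].
  by rewrite (le_trans ac cx).
move=> ac cb cg; rewrite /cint (H (Re \o g)) ?(H (Im \o g)) //.
- exact: integrable_Im.
- exact: integrable_Re.
Qed.

(* Real and imaginary parts are bounded separately, which costs the factor 2. *)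
Lemma normc_cint a b g M : a <= b -> ccont a b g ->
  (forall t, a <= t <= b -> normc (g t) <= M) -> normc (cint a b g) <= 2 * M * (b - a).
Proof.
move=> ab cg gM.
have H (u : R -> R) : mu.-integrable `[a, b] (EFin \o u) ->
    (forall t, a <= t <= b -> `|u t| <= M) -> `|\int[mu]_(t in `[a, b]) u t| <= M * (b - a).
  move=> iu uM; apply: (@le_trans _ _ (\int[mu]_(t in `[a, b]) `|u t|)).
    by apply: le_normr_Rintegral.
  have <- : \int[mu]_(t in `[a, b]) M = M * (b - a).
    rewrite Rintegral_cst //= lebesgue_measure_itv /= lte_fin.
    by case: ltP => // ba; rewrite (@le_anti _ _ a b) ?ab // subrr.
  apply: le_Rintegral => //.
  - exact: integrable_norm iu.
  - by apply: continuous_compact_integrable; [exact: segment_compact|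
      apply: continuous_subspaceT => x; exact: cvg_cst].
apply: le_trans (normc_le_ReIm _) _ => /=.
rewrite -mulrA mulr_natl mulr2n; apply: lerD; apply: H.
- exact: integrable_Re.
- by move=> t /gM; apply: le_trans; exact: Re_le_normc.
- exact: integrable_Im.
- by move=> t /gM; apply: le_trans; exact: Im_le_normc.
Qed.

Lemma cint_id a b : a <= b ->
  cint a b (fun t => (t%:C)%C) = (((b ^+ 2 - a ^+ 2) / 2)%:C)%C.
Proof.
rewrite le_eqVlt => /orP[/eqP<-|ab].
  by rewrite /cint set_itv1 !Rintegral_set1 subrr mul0r.
rewrite /cint; congr (_ +i* _)%C; last first.
  by rewrite Rintegral_cst // mul0r.
have dF (x : R) : is_derive x (1 : R) (fun t : R => t ^+ 2 / 2) x.
  have -> : (fun t : R => t ^+ 2 / 2) = 2^-1 \*: (@id R ^+ 2).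
    by apply/funext => t /=; rewrite [in RHS]/GRing.scale/= mulrC; congr (_ * _).
  apply: is_derive_eq; rewrite /GRing.scale /=.
  by lra.
have cF : continuous (fun t : R => t ^+ 2 / 2).
  move=> x; apply: differentiable_continuous; apply/derivable1_diffP; by case: (dF x).
rewrite /Rintegral (@continuous_FTC2 _ (fun t => t) (fun t => t ^+ 2 / 2)) //=.
- by rewrite mulrBl.
- by apply: continuous_subspaceT => x; exact: cvg_id.
- split.
  + by move=> x _; case: (dF x).
  + by apply: cvg_at_right_filter; exact: cF.
  + by apply: cvg_at_left_filter; exact: cF.
- by move=> x _; rewrite derive1E derive_val.
Qed.

Lemma cint_Im_ge a b g m : a < b -> ccont a b g ->
  (forall t, a <= t <= b -> m <= Im (g t)) -> m * (b - a) <= Im (cint a b g).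
Proof.
move=> ab cg gm; rewrite /=.
have <- : \int[mu]_(t in `[a, b]) m = m * (b - a).
  by rewrite Rintegral_cst //= lebesgue_measure_itv /= lte_fin ab.
apply: le_Rintegral => //.
- by apply: continuous_compact_integrable; [exact: segment_compact|
      apply: continuous_subspaceT => x; exact: cvg_cst].
- exact: integrable_Im.
Qed.

End SegmentIntegral.

(** * Integrals around rectangles and nested bisection *)

Section Goursat.
Variable R : realType.
Local Notation C := (R[i]).
Local Notation Co := (R[i]^o).
Local Notation Re := (@complex.Re R).
Local Notation Im := (@complex.Im R).
Implicit Types (z w : C) (f g : Co -> Co).

(** The integral of f dz counterclockwise around the rectangle: dz is dt on horizontal sides and i
    dt on vertical ones. *)
Definition rect_int f (x0 x1 y0 y1 : R) : C :=
  cint x0 x1 (fun t => f (t +i* y0)%C) - cint x0 x1 (fun t => f (t +i* y1)%C)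
  + 'i%C * (cint y0 y1 (fun t => f (x1 +i* t)%C) - cint y0 y1 (fun t => f (x0 +i* t)%C)).

Definition hcont f x0 x1 y := ccont x0 x1 (fun t => f (t +i* y)%C).
Definition vcont f x y0 y1 := ccont y0 y1 (fun t => f (x +i* t)%C).
Definition bcont f x0 x1 y0 y1 :=
  [/\ hcont f x0 x1 y0, hcont f x0 x1 y1, vcont f x0 y0 y1 & vcont f x1 y0 y1].

Lemma hcontP f x0 x1 y : (forall t, x0 <= t <= x1 -> {for (t +i* y)%C, continuous f}) ->
  hcont f x0 x1 y.
Proof.
move=> cf t /cf ct; have c1 : {for t, continuous (fun t => (t +i* y)%C : Co)}.
  by apply: continuous_mkC; [exact: cvg_id|exact: cvg_cst].
exact: (@continuous_comp _ _ _ (fun t => (t +i* y)%C : Co) f t c1 ct).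
Qed.

Lemma vcontP f x y0 y1 : (forall t, y0 <= t <= y1 -> {for (x +i* t)%C, continuous f}) ->
  vcont f x y0 y1.
Proof.
move=> cf t /cf ct; have c1 : {for t, continuous (fun t => (x +i* t)%C : Co)}.
  by apply: continuous_mkC; [exact: cvg_cst|exact: cvg_id].
exact: (@continuous_comp _ _ _ (fun t => (x +i* t)%C : Co) f t c1 ct).
Qed.

Lemma rect_int_splitx f x0 m x1 y0 y1 : x0 <= m -> m <= x1 ->
  hcont f x0 x1 y0 -> hcont f x0 x1 y1 ->
  rect_int f x0 x1 y0 y1 = rect_int f x0 m y0 y1 + rect_int f m x1 y0 y1.
Proof.
by move=> xm mx c0 c1; rewrite /rect_int (cint_split xm mx c0) (cint_split xm mx c1); ring.
Qed.

Lemma rect_int_splity f x0 x1 y0 m y1 : y0 <= m -> m <= y1 ->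
  vcont f x0 y0 y1 -> vcont f x1 y0 y1 ->
  rect_int f x0 x1 y0 y1 = rect_int f x0 x1 y0 m + rect_int f x0 x1 m y1.
Proof.
by move=> ym my c0 c1; rewrite /rect_int (cint_split ym my c0) (cint_split ym my c1); ring.
Qed.

Lemma normc_rect_int f x0 x1 y0 y1 M : x0 <= x1 -> y0 <= y1 -> bcont f x0 x1 y0 y1 ->
  (forall t, x0 <= t <= x1 -> normc (f (t +i* y0)%C) <= M) ->
  (forall t, x0 <= t <= x1 -> normc (f (t +i* y1)%C) <= M) ->
  (forall t, y0 <= t <= y1 -> normc (f (x0 +i* t)%C) <= M) ->
  (forall t, y0 <= t <= y1 -> normc (f (x1 +i* t)%C) <= M) ->
  normc (rect_int f x0 x1 y0 y1) <= 4 * M * ((x1 - x0) + (y1 - y0)).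
Proof.
move=> xx yy [c1 c2 c3 c4] b1 b2 b3 b4.
have := normc_cint xx c1 b1; have := normc_cint xx c2 b2.
have := normc_cint yy c3 b3; have := normc_cint yy c4 b4.
rewrite /rect_int => h4 h3 h2 h1.
apply: le_trans (le_normcD _ _) _; rewrite normcM normc_i mul1r.
have := le_normcD (cint x0 x1 (fun t => f (t +i* y0)%C)) (- cint x0 x1 (fun t => f (t +i* y1)%C)).
have := le_normcD (cint y0 y1 (fun t => f (x1 +i* t)%C)) (- cint y0 y1 (fun t => f (x0 +i* t)%C)).
rewrite !normcN; lra.
Qed.

Lemma rect_intD f g x0 x1 y0 y1 : bcont f x0 x1 y0 y1 -> bcont g x0 x1 y0 y1 ->
  rect_int (fun w => f w + g w) x0 x1 y0 y1 = rect_int f x0 x1 y0 y1 + rect_int g x0 x1 y0 y1.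
Proof.
by move=> [c1 c2 c3 c4] [d1 d2 d3 d4]; rewrite /rect_int (cintD c1 d1) (cintD c2 d2) (cintD c3 d3) (cintD c4 d4); ring.
Qed.

Lemma rect_intZ f k x0 x1 y0 y1 : bcont f x0 x1 y0 y1 ->
  rect_int (fun w => k * f w) x0 x1 y0 y1 = k * rect_int f x0 x1 y0 y1.
Proof. by move=> [c1 c2 c3 c4]; rewrite /rect_int (cintZ k c1) (cintZ k c2) (cintZ k c3) (cintZ k c4); ring. Qed.

Lemma bcontP f x0 x1 y0 y1 :
  x0 <= x1 -> y0 <= y1 ->
  (forall x y, x0 <= x <= x1 -> y0 <= y <= y1 ->
   [|| x == x0, x == x1, y == y0 | y == y1] -> {for (x +i* y)%C, continuous f}) ->
  bcont f x0 x1 y0 y1.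
Proof.
move=> xx yy cf; split.
- by apply: hcontP => t tx; apply: cf => //; rewrite ?eqxx ?lexx ?yy ?orbT.
- by apply: hcontP => t tx; apply: cf => //; rewrite ?eqxx ?lexx ?yy ?orbT.
- by apply: vcontP => t tx; apply: cf => //; rewrite ?eqxx ?lexx ?xx ?orbT.
- by apply: vcontP => t tx; apply: cf => //; rewrite ?eqxx ?lexx ?xx ?orbT.
Qed.

Lemma rect_int_cst k x0 x1 y0 y1 : x0 <= x1 -> y0 <= y1 ->
  rect_int (fun=> k) x0 x1 y0 y1 = 0.
Proof. by move=> xx yy; rewrite /rect_int; ring. Qed.

Lemma rect_int_id x0 x1 y0 y1 : x0 <= x1 -> y0 <= y1 -> rect_int id x0 x1 y0 y1 = 0.
Proof.
move=> xx yy.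
have hE y : cint x0 x1 (fun t => (t +i* y)%C) =
    (((x1 ^+ 2 - x0 ^+ 2) / 2)%:C)%C + 'i%C * (y%:C)%C * ((x1 - x0)%:C)%C.
  rewrite -cint_id // -cint_cst // -cintD.
  - by apply: eq_cint => t _; rewrite [LHS]complexE.
  - by move=> t _; apply: continuous_mkC; [exact: cvg_id|exact: cvg_cst].
  - exact: ccont_cst.
have vE x : cint y0 y1 (fun t => (x +i* t)%C) =
    (x%:C)%C * ((y1 - y0)%:C)%C + 'i%C * (((y1 ^+ 2 - y0 ^+ 2) / 2)%:C)%C.
  rewrite -cint_id // -cint_cst // -cintZ; last first.
    by move=> t _; apply: continuous_mkC; [exact: cvg_id|exact: cvg_cst].
  rewrite -cintD.
  - by apply: eq_cint => t _; rewrite [LHS]complexE.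
  - exact: ccont_cst.
  - apply: ccontM; first exact: ccont_cst.
    by move=> t _; apply: continuous_mkC; [exact: cvg_id|exact: cvg_cst].
rewrite /rect_int !hE !vE; apply/eqP; rewrite eq_complex.
by rewrite !(ReD, ImD, ReN, ImN, ReM, ImM) /=; apply/andP; split; apply/eqP; ring.
Qed.

Definition rect_pt (x0 x1 y0 y1 : R) z := (x0 <= Re z <= x1) && (y0 <= Im z <= y1).

Section Bisection.
Variables (P : R -> R -> R -> Prop) (w h x0 y0 : R).
Hypothesis (w0 : 0 <= w) (h0 : 0 <= h) (P0 : P x0 y0 1).
Hypothesis step : forall x y s, 0 < s -> P x y s ->
  exists a b : bool, P (x + a%:R * (w * (s / 2))) (y + b%:R * (h * (s / 2))) (s / 2).

(** [P x y s] is meant for the rectangle with lower left corner (x, y) and sides w s, h s. Of the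
    choice among four quarters only the displacement of the corner, at most half a side, is
    recorded; this suffices for nesting. *)
Let next (p : R * R) (n : nat) : R * R :=
  let s := (2^-1) ^+ n in
  get [set q | [/\ P q.1 q.2 (s / 2), p.1 <= q.1 <= p.1 + w * (s / 2) &
    p.2 <= q.2 <= p.2 + h * (s / 2)]].

Let Fixpoint sq n : R * R := if n is n'.+1 then next (sq n') n' else (x0, y0).

Let sqP n : P (sq n).1 (sq n).2 ((2^-1) ^+ n).
Proof.
elim: n => [|n IH] /=; first by rewrite expr0.
rewrite /next; set A := (X in get X).
suff /getPex [H _ _] : A !=set0 by rewrite exprSr.
have s0 : 0 < (2^-1 : R) ^+ n by rewrite exprn_gt0.
have [a [b H]] := step s0 IH.
exists ((sq n).1 + a%:R * (w * ((2^-1) ^+ n / 2)), (sq n).2 + b%:R * (h * ((2^-1) ^+ n / 2))).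
have W0 : 0 <= w * ((2^-1) ^+ n / 2) by rewrite mulr_ge0 // divr_ge0 // ltW.
have H0 : 0 <= h * ((2^-1) ^+ n / 2) by rewrite mulr_ge0 // divr_ge0 // ltW.
split => //=; first by case: a {H}; rewrite ?mul1r ?mul0r ?addr0 !lerDl ?lexx ?W0.
by case: b {H}; rewrite ?mul1r ?mul0r ?addr0 !lerDl ?lexx ?H0.
Qed.

Let sq_step n :
  ((sq n).1 <= (sq n.+1).1 <= (sq n).1 + w * ((2^-1) ^+ n / 2)) /\
  ((sq n).2 <= (sq n.+1).2 <= (sq n).2 + h * ((2^-1) ^+ n / 2)).
Proof.
rewrite /= /next; set A := (X in get X).
suff /getPex [_ H1 H2] : A !=set0 by [].
have s0 : 0 < (2^-1 : R) ^+ n by rewrite exprn_gt0.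
have [a [b H]] := step s0 (sqP n).
exists ((sq n).1 + a%:R * (w * ((2^-1) ^+ n / 2)), (sq n).2 + b%:R * (h * ((2^-1) ^+ n / 2))).
have W0 : 0 <= w * ((2^-1) ^+ n / 2) by rewrite mulr_ge0 // divr_ge0 // ltW.
have H0 : 0 <= h * ((2^-1) ^+ n / 2) by rewrite mulr_ge0 // divr_ge0 // ltW.
split => //=; first by case: a {H}; rewrite ?mul1r ?mul0r ?addr0 !lerDl ?lexx ?W0.
by case: b {H}; rewrite ?mul1r ?mul0r ?addr0 !lerDl ?lexx ?H0.
Qed.

(** The left ends u n increase and the right ends u n + c 2^-n decrease, so the supremum of the left
    ends lies in every interval. *)
Let nested (u : nat -> R) (c : R) : 0 <= c ->
  (forall n, u n <= u n.+1 <= u n + c * ((2^-1) ^+ n / 2)) ->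
  exists p, forall n, u n <= p <= u n + c * (2^-1) ^+ n.
Proof.
move=> c0 H.
have mono n k : u n <= u (n + k)%N.
  elim: k => [|k IH]; first by rewrite addn0.
  by apply: le_trans IH _; rewrite addnS; case/andP: (H (n + k)%N).
have ub n k : u (n + k)%N + c * (2^-1) ^+ (n + k) <= u n + c * (2^-1) ^+ n.
  elim: k => [|k IH]; first by rewrite addn0.
  apply: le_trans IH; rewrite addnS; case/andP: (H (n + k)%N) => _ H2.
  rewrite exprSr; apply: le_trans (lerD H2 (lexx _)) _.
  by rewrite -addrA -mulrDr -splitr.
have pos n : 0 <= c * (2^-1) ^+ n by rewrite mulr_ge0 // exprn_ge0.
have bd n m : u m <= u n + c * (2^-1) ^+ n.
  have [le|lt] := leqP n m.
    by rewrite -(subnKC le); apply: (le_trans _ (ub n (m - n)%N)); rewrite lerDl.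
  by rewrite -(subnKC (ltnW lt)); apply: (le_trans (mono m (n - m)%N)); rewrite lerDl.
have hs : has_sup (range u).
  split; first by exists (u 0%N), 0%N.
  by exists (u 0%N + c * (2^-1) ^+ 0) => _ [m _ <-]; exact: bd.
exists (sup (range u)) => n; apply/andP; split.
  by apply: ub_le_sup; [case: hs|exists n].
apply: ge_sup; first by case: hs.
by move=> _ [m _ <-]; exact: bd.
Qed.

Lemma bisection : exists p q, forall n, exists x y,
  [/\ P x y ((2^-1) ^+ n), x <= p <= x + w * (2^-1) ^+ n & y <= q <= y + h * (2^-1) ^+ n].
Proof.
have [p Hp] := nested w0 (fun n => (sq_step n).1).
have [q Hq] := nested h0 (fun n => (sq_step n).2).
by exists p, q => n; exists (sq n).1, (sq n).2; split => //; exact: sqP.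
Qed.

End Bisection.

End Goursat.

Section Cauchy.
Variable R : realType.
Local Notation C := (R[i]).
Local Notation Co := (R[i]^o).
Implicit Types (z w : C) (f g : Co -> Co).

Lemma normc_ReIm_lt (x y x' y' e : R) : `|x - x'| <= e -> `|y - y'| <= e ->
  normc ((x +i* y)%C - (x' +i* y')%C) <= 2 * e.
Proof.
move=> hx hy; apply: le_trans (normc_le_ReIm _) _.
by rewrite ReB ImB /= mulr_natl mulr2n lerD.
Qed.

Lemma goursat f x0 x1 y0 y1 : x0 <= x1 -> y0 <= y1 ->
  (forall x y, x0 <= x <= x1 -> y0 <= y <= y1 -> exists l, cder f (x +i* y)%C l) ->
  rect_int f x0 x1 y0 y1 = 0.
Proof.
move=> xx yy df; apply/eqP; apply: contraT => RI0.
have cf x y : x0 <= x <= x1 -> y0 <= y <= y1 -> {for (x +i* y)%C, continuous f}.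
  by move=> hx hy; have [l /cder_continuous] := df x y hx hy.
pose w := x1 - x0; pose h := y1 - y0.
have w0 : 0 <= w by rewrite subr_ge0.
have h0 : 0 <= h by rewrite subr_ge0.
(* Half the norm makes the inequality in [P] strict at scale 1. It is inherited by some quarter,
   since s^2 and a fourth part of the integral scale alike. *)
pose eps := normc (rect_int f x0 x1 y0 y1) / 2.
have N0 : 0 < normc (rect_int f x0 x1 y0 y1) by rewrite normc_gt0.
have e0 : 0 < eps by rewrite divr_gt0.
pose P x y s := [/\ x0 <= x, x + w * s <= x1, y0 <= y, y + h * s <= y1 &
  eps * s ^+ 2 < normc (rect_int f x (x + w * s) y (y + h * s))].
have P0 : P x0 y0 1.
  have E1 : x0 + w * 1 = x1 by rewrite /w; ring.
  have E2 : y0 + h * 1 = y1 by rewrite /h; ring.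
  rewrite /P E1 E2; split; rewrite ?lexx //.
  by rewrite expr1n mulr1 /eps ltr_pdivrMr // ltr_pMr // ltr1n.
have step x y s : 0 < s -> P x y s ->
    exists a b : bool, P (x + a%:R * (w * (s / 2))) (y + b%:R * (h * (s / 2))) (s / 2).
  move=> s0 [p1 p2 p3 p4 p5].
  have ws : 0 <= w * (s / 2) by rewrite mulr_ge0 // divr_ge0 // ltW.
  have hs : 0 <= h * (s / 2) by rewrite mulr_ge0 // divr_ge0 // ltW.
  have wsE : w * s = w * (s / 2) + w * (s / 2) by rewrite -mulrDr -splitr.
  have hsE : h * s = h * (s / 2) + h * (s / 2) by rewrite -mulrDr -splitr.
  rewrite wsE hsE in p2 p4 p5.
  set W := w * (s / 2) in ws p2 p5 *; set H := h * (s / 2) in hs p4 p5 *.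
  apply: contrapT => nP.
  have small (a b : bool) : normc (rect_int f (x + a%:R * W) (x + a%:R * W + W)
      (y + b%:R * H) (y + b%:R * H + H)) <= eps * (s / 2) ^+ 2.
    rewrite leNgt; apply/negP => big; apply: nP; exists a, b.
    have Ba : 0 <= a%:R * W <= W by case: (a); rewrite ?mul1r ?mul0r ?lexx ?ws.
    have Bb : 0 <= b%:R * H <= H by case: (b); rewrite ?mul1r ?mul0r ?lexx ?hs.
    rewrite /P -/W -/H; split; last exact: big.
    - lra.
    - lra.
    - lra.
    - lra.
  have hc y' : y0 <= y' <= y1 -> hcont f x (x + (W + W)) y'.
    by move=> hy'; apply: hcontP => t ht; apply: cf => //; lra.
  have vc x' : x0 <= x' <= x1 -> vcont f x' y (y + (H + H)).
    by move=> hx'; apply: vcontP => t ht; apply: cf => //; lra.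
  have := p5.
  rewrite (@rect_int_splitx _ f x (x + W)); [|lra|lra|by apply: hc; lra|by apply: hc; lra].
  rewrite (@rect_int_splity _ f x (x + W) y (y + H)); [|lra|lra|by apply: vc; lra|by apply: vc; lra].
  rewrite (@rect_int_splity _ f (x + W) _ y (y + H)); [|lra|lra|by apply: vc; lra|by apply: vc; lra].
  have := small false false; have := small false true; have := small true false; have := small true true.
  rewrite !mul1r !mul0r !addr0 (addrA x W W) (addrA y H H) => s1 s2 s3 s4.
  apply/negP; rewrite -leNgt.
  have n4 (a b c d : C) : normc (a + b + (c + d)) <= normc a + normc b + (normc c + normc d).
    apply: le_trans (le_normcD _ _) _.
    exact: lerD (le_normcD _ _) (le_normcD _ _).
  apply: le_trans (n4 _ _ _ _) _.
 apply: le_trans (lerD (lerD s4 s3) (lerD s2 s1)) _.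
  by rewrite expr_div_n le_eqVlt; apply/orP; left; apply/eqP; field.
have [p [q pq]] := bisection w0 h0 P0 step.
have [l dl] : exists l, cder f (p +i* q)%C l.
  have [x [y [[q1 q2 q3 q4 _] /andP[q6 q7] /andP[q8 q9]]]] := pq 0%N.
  rewrite expr0 in q2 q4 q7 q9; apply: df; lra.
(* The final estimate is 8 (w + h + 1) (w + h) / K times eps s^2, and this factor has to be at most
   1. The summand 1 keeps K positive when the rectangle is degenerate. *)
pose K := 16 * (w + h + 1) * (w + h + 1).
have K0 : 0 < K by rewrite /K !mulr_gt0 // ltr_wpDl // addr_ge0.
have [d d0 Hd] := dl (eps / K) (divr_gt0 e0 K0).
have dK : 0 < d / (2 * (w + h + 1)) by rewrite divr_gt0 // mulr_gt0 // ltr_wpDl // addr_ge0.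
have [n Hn] : exists n, (2^-1 : R) ^+ n < d / (2 * (w + h + 1)).
  have /cvgrPdist_lt/(_ _ dK) [n _ Hn] := @cvg_expr R 2^-1 ltac:(by rewrite ger0_norm //; lra).
  exists n; have := Hn n (leqnn n); rewrite sub0r normrN ger0_norm //.
have [x [y [[q1 q2 q3 q4 big] /andP[q6 q7] /andP[q8 q9]]]] := pq n.
have s0 : 0 < (2^-1 : R) ^+ n by rewrite exprn_gt0.
move: s0 Hn q2 q4 q7 q9 big; set s := _ ^+ n => s0 Hn q2 q4 q7 q9 big.
have ws : 0 <= w * s by rewrite mulr_ge0 // ltW.
have hs : 0 <= h * s by rewrite mulr_ge0 // ltW.
pose z := (p +i* q)%C.
have xws : x <= x + w * s by rewrite lerDl.
have yhs : y <= y + h * s by rewrite lerDl.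
(* f minus its first order expansion at z: the affine part integrates to 0, and what remains is
   small compared with the distance to z. *)
pose g v := f v + ((- l) * v + (l * z - f z)).
have bc : bcont f x (x + w * s) y (y + h * s).
  by apply: bcontP => // a b ha hb _; apply: cf; lra.
have bid : bcont id x (x + w * s) y (y + h * s).
  by apply: bcontP => // a b ha hb _ A.
have bcst (k : C) : bcont (fun=> k : Co) x (x + w * s) y (y + h * s).
  by apply: bcontP => // a b ha hb _; exact: cst_continuous.
have blin : bcont (fun v => (- l) * v : Co) x (x + w * s) y (y + h * s).
  by apply: bcontP => // a b ha hb _; exact: cder_continuous (cderMl (- l) (cder_id _)).
have baff : bcont (fun v => (- l) * v + (l * z - f z) : Co) x (x + w * s) y (y + h * s).
  apply: bcontP => // a b ha hb _.
  exact: cder_continuous (cderD (cderMl (- l) (cder_id _)) (cder_cst (l * z - f z) _)).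
have RIg : rect_int g x (x + w * s) y (y + h * s) = rect_int f x (x + w * s) y (y + h * s).
  rewrite (rect_intD bc baff) (rect_intD blin (bcst _)) (rect_intZ _ bid).
  by rewrite (rect_int_id xws yhs) (rect_int_cst _ xws yhs) mulr0 !addr0.
have bg : bcont g x (x + w * s) y (y + h * s).
  apply: bcontP => // a b ha hb _.
  have [m dm] : exists m, cder f (a +i* b)%C m by apply: df; lra.
  exact: cder_continuous (cderD dm (cderD (cderMl (- l) (cder_id _)) (cder_cst (l * z - f z) _))).
have whs : (w + h + 1) * s < d / 2.
  move: Hn; rewrite ltr_pdivlMr; last by rewrite mulr_gt0 // ltr_wpDl // addr_ge0.
  by move=> Hn; rewrite ltr_pdivlMr //; apply: le_lt_trans Hn; rewrite le_eqVlt; apply/orP; left; apply/eqP; ring.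
have gb a b : x <= a <= x + w * s -> y <= b <= y + h * s ->
    normc (g (a +i* b)%C) <= eps / K * (2 * ((w + h + 1) * s)).
  move=> ha hb.
  have nz : normc ((a +i* b)%C - z) <= 2 * ((w + h + 1) * s).
    by apply: normc_ReIm_lt; rewrite ler_norml; lra.
  have -> : g (a +i* b)%C = f (a +i* b)%C - f z - l * ((a +i* b)%C - z) by rewrite /g; ring.
  apply: le_trans (Hd _ _) _; first by apply: le_lt_trans nz _; lra.
  by apply: ler_wpM2l nz; rewrite ltW // divr_gt0.
have H : normc (rect_int f x (x + w * s) y (y + h * s)) <=
    4 * (eps / K * (2 * ((w + h + 1) * s))) * (x + w * s - x + (y + h * s - y)).
  by rewrite -RIg; apply: normc_rect_int => // t ht; apply: gb; rewrite // lexx ?xws ?yhs.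
have := lt_le_trans big H; rewrite ltNge => /negP[].
have -> : 4 * (eps / K * (2 * ((w + h + 1) * s))) * (x + w * s - x + (y + h * s - y)) =
  (8 * (w + h + 1) * (w + h) / K) * (eps * s ^+ 2).
  by rewrite expr2; field; rewrite gt_eqF.
rewrite ger_pMl; last by rewrite mulr_gt0 // exprn_gt0.
rewrite ler_pdivrMr // mul1r /K.
rewrite -subr_ge0 (_ : _ - _ = 8 * ((w + h + 1) * (w + h + 2))); last by ring.
by apply: mulr_ge0 => //; apply: mulr_ge0; lra.
Qed.

End Cauchy.

(** * The integral of a difference quotient and Cauchy type kernels *)

Section CauchyFormula.
Variable R : realType.
Local Notation C := (R[i]).
Local Notation Co := (R[i]^o).
Local Notation Re := (@complex.Re R).
Local Notation Im := (@complex.Im R).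
Implicit Types (z w : C) (f g : Co -> Co).

(** Away from z the quotient is holomorphic, so the integral equals the one around any small square
    about z; near z the quotient is bounded, so the latter tends to 0 with the perimeter. *)
Lemma cauchy_quotient f (x0 x1 y0 y1 : R) z :
  x0 < Re z < x1 -> y0 < Im z < y1 ->
  (forall w, rect_pt x0 x1 y0 y1 w -> exists l, cder f w l) ->
  rect_int (fun w => (f w - f z) * (w - z)^-1) x0 x1 y0 y1 = 0.
Proof.
case: z => p q /= /andP[xp px] /andP[yq qy] df.
set z : C := (p +i* q)%C; set g := fun w : Co => (f w - f z) * (w - z)^-1.
have dg w : rect_pt x0 x1 y0 y1 w -> w != z -> exists m, cder g w m.
  move=> /df [l dl] wz; have nz : w - z != 0 by rewrite subr_eq0.
  have h := @cderV _ (fun v => v - z) w _ nz (cderB (cder_id w) (cder_cst z w)).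
  by have := cderM (cderB dl (cder_cst (f z) w)) h; eexists; eassumption.
have cg a b : x0 <= a <= x1 -> y0 <= b <= y1 -> (a != p) || (b != q) ->
    {for (a +i* b)%C, continuous g}.
  move=> ha hb ab; have [||m /cder_continuous //] := dg (a +i* b)%C.
    by rewrite /rect_pt /= ha.
  by rewrite eq_complex /= negb_and.
have [l dl] : exists l, cder f z l by apply: df; rewrite /rect_pt /= !ltW.
have [d d0 Hd] := dl 1 ltr01.
pose M := normc l + 1.
have M0 : 0 < M by rewrite ltr_wpDl ?normc_ge0.
have gM w : w != z -> normc (w - z) < d -> normc (g w) <= M.
  move=> wz /Hd; rewrite mul1r => H.
  have n0 : 0 < normc (w - z) by rewrite normc_gt0 // subr_eq0.
  rewrite /g normcM normcV ler_pdivrMr //.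
  have -> : f w - f z = (f w - f z - l * (w - z)) + l * (w - z) by rewrite subrK.
  apply: le_trans (le_normcD _ _) _; rewrite normcM /M mulrDl mul1r addrC lerD2l //.
apply/eqP; apply: contraT => RI0.
have N0 : 0 < normc (rect_int g x0 x1 y0 y1) by rewrite normc_gt0.
(* The square of half side e lies inside the rectangle and within d of z, and its integral is at
   most 4 M (2 e + 2 e) = 16 M e. The final halving makes all these bounds strict. *)
pose e := Num.min (Num.min (Num.min (p - x0) (x1 - p)) (Num.min (q - y0) (y1 - q)))
  (Num.min (d / 2) (normc (rect_int g x0 x1 y0 y1) / (16 * M))) / 2.
have [e0 ep] : 0 < e /\ [/\ e < p - x0, e < x1 - p, e < q - y0, e < y1 - q & e < d / 2] /\
    e < normc (rect_int g x0 x1 y0 y1) / (16 * M).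
  rewrite /e; set m := Num.min _ _.
  have m0 : 0 < m by rewrite /m !lt_min !subr_gt0 xp px yq qy !divr_gt0 // mulr_gt0.
  have mm : m / 2 < m by rewrite ltr_pdivrMr // ltr_pMr // ltr1n.
  split; first by rewrite divr_gt0.
  have := lexx m; rewrite {2}/m !le_min => /andP[/andP[/andP[m1 m2] /andP[m3 m4]] /andP[m5 m6]].
  by split; [split|]; exact: lt_le_trans mm _.
case: ep => -[e1 e2 e3 e4 e5] e6; clearbody e.
have x01 : x0 <= p - e by lra.
have x02 : p + e <= x1 by lra.
have y01 : y0 <= q - e by lra.
have y02 : q + e <= y1 by lra.
have pe : p - e <= p + e by lra.
have qe : q - e <= q + e by lra.
have hne b : b != q -> y0 <= b <= y1 -> forall a a', x0 <= a -> a' <= x1 -> hcont g a a' b.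
  move=> bq hb a a' ha ha'; apply: hcontP => t /andP[t1 t2]; apply: cg => //; last by rewrite bq orbT.
  by rewrite (le_trans ha t1) (le_trans t2 ha').
have vne a : a != p -> x0 <= a <= x1 -> forall b b', y0 <= b -> b' <= y1 -> vcont g a b b'.
  move=> ap ha b b' hb hb'; apply: vcontP => t /andP[t1 t2]; apply: cg => //; last by rewrite ap.
  by rewrite (le_trans hb t1) (le_trans t2 hb').
have zero a a' b b' : a <= a' -> b <= b' -> x0 <= a -> a' <= x1 -> y0 <= b -> b' <= y1 ->
    [|| a' < p, p < a, b' < q | q < b] -> rect_int g a a' b b' = 0.
  move=> aa bb ha ha' hb hb' out; apply: goursat => // u v /andP[u1 u2] /andP[v1 v2].
  apply: dg; first by rewrite /rect_pt /= (le_trans ha u1) (le_trans u2 ha') (le_trans hb v1) (le_trans v2 hb').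
  rewrite eq_complex /=; apply/negP => /andP[/eqP up /eqP vq].
  clear RI0 N0 e6 e5 Hd gM d0 M0 M dl l; by case/or4P: out; lra.
(* The left, right, lower and upper strips are cut off in turn; each of them misses z and
   contributes 0 by [goursat]. *)
have E : rect_int g x0 x1 y0 y1 = rect_int g (p - e) (p + e) (q - e) (q + e).
  clear RI0 N0 e6 e5 Hd gM d0 M0 M dl l.
  have x0e : x0 <= p + e by lra.
  have y0e : y0 <= q + e by lra.
  rewrite (rect_int_splitx x01 _ (hne y0 _ _ _ _ _ _) (hne y1 _ _ _ _ _ _)); [|lra..].
  rewrite (@zero x0 (p - e)); [|lra..]; rewrite add0r.
  rewrite (rect_int_splitx pe x02 (hne y0 _ _ _ _ _ _) (hne y1 _ _ _ _ _ _)); [|lra..].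
  rewrite (@zero (p + e) x1); [|lra..]; rewrite addr0.
  rewrite (rect_int_splity y01 _ (vne (p - e) _ _ _ _ _ _) (vne (p + e) _ _ _ _ _ _)); [|lra..].
  rewrite (@zero (p - e) (p + e)); [|lra..]; rewrite add0r.
  rewrite (rect_int_splity qe y02 (vne (p - e) _ _ _ _ _ _) (vne (p + e) _ _ _ _ _ _)); [|lra..].
  by rewrite (@zero (p - e) (p + e) (q + e) y1); [rewrite addr0|lra..].
have bnd a b : `|a - p| <= e -> `|b - q| <= e -> (a != p) || (b != q) ->
    normc (g (a +i* b)%C) <= M.
  move=> ha hb ab; apply: gM; first by rewrite eq_complex /= negb_and.
  by apply: le_lt_trans (normc_ReIm_lt ha hb) _; lra.
have n1 : p - e != p by lra.
have n2 : p + e != p by lra.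
have n3 : q - e != q by lra.
have n4 : q + e != q by lra.
have abs1 : `|p - e - p| <= e by rewrite ler_norml; lra.
have abs2 : `|p + e - p| <= e by rewrite ler_norml; lra.
have abs3 : `|q - e - q| <= e by rewrite ler_norml; lra.
have abs4 : `|q + e - q| <= e by rewrite ler_norml; lra.
have bc : bcont g (p - e) (p + e) (q - e) (q + e).
  clear RI0 N0 e6 e5 Hd gM bnd M0 d0 abs1 abs2 abs3 abs4 E zero.
  by split; [apply: hne|apply: hne|apply: vne|apply: vne] => //; lra.
have K t : p - e <= t <= p + e -> `|t - p| <= e by rewrite ler_norml; lra.
have K' t : q - e <= t <= q + e -> `|t - q| <= e by rewrite ler_norml; lra.
have := normc_rect_int pe qe bc (fun t ht => bnd _ _ (K t ht) abs3 (introT orP (or_intror n3)))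
  (fun t ht => bnd _ _ (K t ht) abs4 (introT orP (or_intror n4)))
  (fun t ht => bnd _ _ abs1 (K' t ht) (introT orP (or_introl n1)))
  (fun t ht => bnd _ _ abs2 (K' t ht) (introT orP (or_introl n2))).
rewrite -E leNgt => /negP[].
have -> : 4 * M * (p + e - (p - e) + (q + e - (q - e))) = e * (16 * M) by ring.
have M16 : 0 < 16 * M by rewrite mulr_gt0.
by rewrite -(ltr_pdivlMr _ _ M16).
Qed.

Lemma normc_nat n : normc (n%:R : C) = n%:R.
Proof. by rewrite -(rmorph_nat (real_complex R)) normcR ger0_norm. Qed.

Lemma cder_quad (F : Co -> Co) z l (A d : R) : 0 <= A -> 0 < d ->
  (forall w, normc (w - z) < d -> normc (F w - F z - l * (w - z)) <= A * normc (w - z) ^+ 2) ->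
  cder F z l.
Proof.
move=> A0 d0 H e e0; have A1 : 0 < A + 1 by rewrite ltr_wpDl.
exists (Num.min d (e / (A + 1))); first by rewrite lt_min d0 divr_gt0.
move=> w; rewrite lt_min => /andP[wd we]; apply: le_trans (H w wd) _.
rewrite expr2 mulrA ler_wpM2r ?normc_ge0 //.
move: we; rewrite ltr_pdivlMr // => we; apply: le_trans (ltW we).
by rewrite mulrDr mulr1 [leLHS]mulrC lerDl normc_ge0.
Qed.

Section Kernel.
Variables (a b rho M B : R) (g gam : R -> Co).
Hypotheses (ab : a <= b) (cg : ccont a b g) (cgam : ccont a b gam).
Hypotheses (gM : forall t, a <= t <= b -> normc (g t) <= M).
Hypotheses (gB : forall t, a <= t <= b -> normc (gam t) <= B).

Definition kern n z := cint a b (fun t => g t * (gam t - z) ^- n).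

Lemma kern_cont n z : (forall t, a <= t <= b -> gam t != z) ->
  ccont a b (fun t => g t * (gam t - z) ^- n).
Proof.
move=> nz.
have c1 : ccont a b (fun t => gam t - z) by exact: ccontD cgam (@ccont_cst R a b (- z)).
have cn : ccont a b (fun t => (gam t - z) ^+ n).
  elim: n => [|n IH]; first exact: ccont_cst.
  have -> : (fun t => (gam t - z) ^+ n.+1) = (fun t => (gam t - z) * (gam t - z) ^+ n).
    by apply/funext => t; rewrite exprS.
  exact: ccontM c1 IH.
apply: (ccontM cg (ccontV _ cn)) => t /nz gz.
by rewrite expf_neq0 // subr_eq0.
Qed.

(** Differentiation under the integral: a quadratic remainder of the kernel that is uniform in t
    integrates to a quadratic remainder of the integral. *)
Lemma kern_der n z (A : R) : 0 < rho -> 0 <= A ->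
  (forall t, a <= t <= b -> rho <= normc (gam t - z)) ->
  (forall t w, a <= t <= b -> normc (w - z) < rho / 2 ->
     normc ((gam t - w) ^- n - (gam t - z) ^- n - n%:R * (gam t - z) ^- n.+1 * (w - z))
     <= A * normc (w - z) ^+ 2) ->
  cder (kern n) z (n%:R * kern n.+1 z).
Proof.
move=> r0 A0 hz H.
have nz w : normc (w - z) < rho / 2 -> forall t, a <= t <= b -> gam t != w.
  move=> wz t ht; apply/eqP => E; have := hz t ht; rewrite E leNgt => /negP; apply.
  by apply: lt_trans wz _; lra.
have z0 : normc (z - z) < rho / 2 by rewrite subrr normc0 divr_gt0.
have M0 : 0 <= M by apply: le_trans (normc_ge0 (g a)) (gM _); rewrite lexx.
apply: (@cder_quad _ _ _ (2 * (M * A) * (b - a)) (rho / 2)).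
- by rewrite !mulr_ge0 // subr_ge0.
- by rewrite divr_gt0.
move=> w wz; rewrite /kern.
have E : cint a b (fun t => g t * (gam t - w) ^- n) - cint a b (fun t => g t * (gam t - z) ^- n) -
    n%:R * cint a b (fun t => g t * (gam t - z) ^- n.+1) * (w - z) =
    cint a b (fun t => g t * ((gam t - w) ^- n - (gam t - z) ^- n - n%:R * (gam t - z) ^- n.+1 * (w - z))).
  have c1 := @kern_cont n w (nz w wz); have c2 := @kern_cont n z (nz z z0).
  have c3 := @kern_cont n.+1 z (nz z z0).
  have c12 := ccontD c1 (ccontN c2).
  have c3' := ccontM (@ccont_cst R a b (n%:R * (w - z))) c3.
  rewrite -(cintB c1 c2) mulrAC -(cintZ _ c3) -(cintB c12 c3').
  by apply: eq_cint => t _; ring.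
rewrite E; apply: le_trans (normc_cint (M := M * (A * normc (w - z) ^+ 2)) ab _ _) _.
- have -> : (fun t => g t * ((gam t - w) ^- n - (gam t - z) ^- n - n%:R * (gam t - z) ^- n.+1 * (w - z))) =
    (fun t => (g t * (gam t - w) ^- n - g t * (gam t - z) ^- n) - (n%:R * (w - z)) * (g t * (gam t - z) ^- n.+1)).
    by apply/funext => t; ring.
  apply: ccontD; last apply: ccontN.
    by apply: ccontD; [exact: kern_cont (nz w wz)|apply: ccontN; exact: kern_cont (nz z z0)].
  by apply: ccontM; [exact: ccont_cst|exact: kern_cont (nz z z0)].
- move=> t ht; rewrite normcM; apply: ler_pM; rewrite ?normc_ge0 ?gM //; exact: H.
- by rewrite le_eqVlt; apply/orP; left; apply/eqP; ring.
Qed.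

Lemma kern_far z w t : 0 < rho -> a <= t <= b -> rho <= normc (gam t - z) ->
  normc (w - z) < rho / 2 -> rho / 2 <= normc (gam t - w).
Proof.
move=> r0 ht hz wz; have := le_normcD (gam t - w) (w - z).
rewrite addrA subrK; lra.
Qed.

Lemma kern_der1 z : 0 < rho -> (forall t, a <= t <= b -> rho <= normc (gam t - z)) ->
  cder (kern 1) z (kern 2 z).
Proof.
move=> r0 hz; rewrite -[kern 2 z]mul1r.
(* The remainder is (w - z)^2 / ((gam - z)^2 (gam - w)), where |gam - z| >= rho and |gam - w| >= rho
   / 2. *)
apply: (@kern_der 1 z (2 / rho ^+ 3)) => //; first by rewrite divr_ge0 // exprn_ge0 // ltW.
move=> t w ht wz.
have h1 := hz t ht; have h2 := kern_far r0 ht h1 wz.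
have n1 : gam t - z != 0 by rewrite -normc_eq0 gt_eqF //; lra.
have n2 : gam t - w != 0 by rewrite -normc_eq0 gt_eqF //; lra.
have -> : (gam t - w) ^- 1 - (gam t - z) ^- 1 - 1%:R * (gam t - z) ^- 2 * (w - z) =
    (w - z) ^+ 2 * ((gam t - z) ^- 2 * (gam t - w)^-1).
  by rewrite expr1; field; apply/andP.
rewrite normcM normcX mulrC ler_wpM2r ?exprn_ge0 ?normc_ge0 //.
rewrite normcM normcV normcX normcV.
have -> : 2 / rho ^+ 3 = rho ^- 2 * (rho / 2)^-1 by field; rewrite gt_eqF.
apply: ler_pM; rewrite ?invr_ge0 ?exprn_ge0 ?normc_ge0 //.
  by rewrite lef_pV2 ?posrE ?exprn_gt0 //; [apply: lerXn2r; rewrite ?nnegrE //; lra|lra].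
by rewrite lef_pV2 ?posrE //; lra.
Qed.

Lemma kern_der2 z : 0 < rho -> (forall t, a <= t <= b -> rho <= normc (gam t - z)) ->
  cder (kern 2) z (2%:R * kern 3 z).
Proof.
move=> r0 hz; pose D := (B + normc z).
have D0 : 0 <= D.
  apply: addr_ge0 (normc_ge0 _); apply: le_trans (normc_ge0 (gam a)) (gB _).
  by rewrite lexx.
(* The remainder is (w - z)^2 (3 (gam - z) - 2 (w - z)) / ((gam - z)^3 (gam - w)^2). The middle
   factor is at most 3 D + rho, and rho^-3 (rho / 2)^-2 = 4 / rho^5. *)
apply: (@kern_der 2 z ((3 * D + rho) * (4 / rho ^+ 5))) => //.
  by rewrite mulr_ge0 ?divr_ge0 ?exprn_ge0 ?addr_ge0 ?mulr_ge0 // ltW.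
move=> t w ht wz.
have h1 := hz t ht; have h2 := kern_far r0 ht h1 wz.
have n1 : gam t - z != 0 by rewrite -normc_eq0 gt_eqF //; lra.
have n2 : gam t - w != 0 by rewrite -normc_eq0 gt_eqF //; lra.
have -> : (gam t - w) ^- 2 - (gam t - z) ^- 2 - 2%:R * (gam t - z) ^- 3 * (w - z) =
    (w - z) ^+ 2 * ((3 * (gam t - z) - 2 * (w - z)) * ((gam t - z) ^- 3 * (gam t - w) ^- 2)).
  by field; apply/andP.
rewrite normcM normcX mulrC ler_wpM2r ?exprn_ge0 ?normc_ge0 //.
rewrite normcM normcM !normcV !normcX.
apply: ler_pM; rewrite ?mulr_ge0 ?invr_ge0 ?exprn_ge0 ?normc_ge0 //.
  apply: le_trans (le_normcD _ _) _; rewrite normcN !normcM.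
  have -> : normc (3 : C) = 3 by exact: normc_nat.
  have -> : normc (2 : C) = 2 by exact: normc_nat.
  have := le_normcD (gam t) (- z); rewrite normcN; have := gB ht; rewrite /D; lra.
have -> : 4 / rho ^+ 5 = rho ^- 3 * (rho / 2) ^- 2 by field; rewrite gt_eqF.
apply: ler_pM; rewrite ?invr_ge0 ?exprn_ge0 ?normc_ge0 //.
  by rewrite lef_pV2 ?posrE ?exprn_gt0 //; [apply: lerXn2r; rewrite ?nnegrE //; lra|lra].
rewrite lef_pV2 ?posrE ?exprn_gt0 //; [apply: lerXn2r; rewrite ?nnegrE //; lra|lra|lra].
Qed.

End Kernel.

End CauchyFormula.

(** * The derivative of a holomorphic function is holomorphic *)

Section Regularity.
Variable R : realType.
Local Notation C := (R[i]).
Local Notation Co := (R[i]^o).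
Local Notation Re := (@complex.Re R).
Local Notation Im := (@complex.Im R).
Implicit Types (z w : C) (f g F G : Co -> Co).

(** Two derivatives are all that Cauchy's formula has to yield: derivatives of higher order come
    from applying the result to the derivative. *)
Definition cder2 F z := exists F', (\forall w \near (z : Co), cder F w (F' w)) /\
  exists l, cder F' z l.

Lemma cder2_ext f F z : (\forall w \near (z : Co), f w = F w) -> cder2 F z -> cder2 f z.
Proof.
move=> fF [F' [dF dF']]; exists F'; split=> //.
have fF2 : \forall w \near (z : Co), \forall v \near (w : Co), f v = F v by exact: near_join.
near=> w; apply: (@cder_near _ F); last by near: w.
have : \forall v \near (w : Co), f v = F v by near: w.
by apply: filterS => v ->.
Unshelve. all: by end_near. Qed.

Lemma cder2D F G z : cder2 F z -> cder2 G z -> cder2 (fun w => F w + G w) z.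
Proof.
move=> [F' [dF [a dF']]] [G' [dG [b dG']]]; exists (fun w => F' w + G' w); split.
  by near=> w; apply: cderD; near: w.
by exists (a + b); exact: cderD.
Unshelve. all: by end_near. Qed.

Lemma cder2Ml k F z : cder2 F z -> cder2 (fun w => k * F w) z.
Proof.
move=> [F' [dF [a dF']]]; exists (fun w => k * F' w); split.
  by near=> w; apply: cderMl; near: w.
by exists (k * a); exact: cderMl.
Unshelve. all: by end_near. Qed.

Lemma near_neq0 G z : {for z, continuous G} -> G z != 0 ->
  \forall w \near (z : Co), G w != 0.
Proof.
move=> cG G0; apply: (cG [set y | y != 0]); apply/nbhsC.
exists (normc (G z)); first by rewrite normc_gt0.
by move=> y; apply: contraTneq => /= ->; rewrite sub0r normcN ltxx.
Qed.

Lemma cder2_div F G z : G z != 0 -> cder2 F z -> cder2 G z ->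
  cder2 (fun w => F w * (G w)^-1) z.
Proof.
move=> G0 [F' [dF [a dF']]] [G' [dG [b dG']]].
have dFz : cder F z (F' z) by exact: nbhs_singleton dF.
have dGz : cder G z (G' z) by exact: nbhs_singleton dG.
exists (fun w => F w * (- (G w) ^- 2 * G' w) + (G w)^-1 * F' w); split.
  have Gn0 : \forall w \near (z : Co), G w != 0.
    exact: near_neq0 (cder_continuous dGz) G0.
  near=> w; apply: cderM; first by near: w.
  by apply: cderV; near: w.
have h1 := cderV G0 dGz.
have h2 := cderN (cderM h1 h1).
have h3 := cderD (cderM dFz (cderM h2 dG')) (cderM h1 dF').
eexists; apply: cder_near h3; near=> w.
by rewrite /= expr2 invfM.
Unshelve. all: by end_near. Qed.

Lemma kern_cder2 a b rho M B (g gam : R -> Co) z : a <= b -> 0 < rho ->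
  ccont a b g -> ccont a b gam ->
  (forall t, a <= t <= b -> normc (g t) <= M) ->
  (forall t, a <= t <= b -> normc (gam t) <= B) ->
  (forall t, a <= t <= b -> rho <= normc (gam t - z)) ->
  cder2 (kern a b g gam 1) z.
Proof.
move=> ab r0 cg cgam gM gB far; exists (kern a b g gam 2); split; last first.
  by exists (2%:R * kern a b g gam 3 z); apply: (kern_der2 ab cg cgam gM gB r0).
apply/nbhsC; exists (rho / 2); first by rewrite divr_gt0.
move=> w wz; apply: (@kern_der1 _ a b (rho / 2) M) => //; first by rewrite divr_gt0.
by move=> t ht; exact: (kern_far r0 ht (far t ht) wz).
Qed.

Lemma ccont_bounded a b (g : R -> Co) : a <= b -> ccont a b g ->
  exists M, forall t, a <= t <= b -> normc (g t) <= M.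
Proof.
move=> ab cg.
have bd (u : R -> R) : {within `[a, b], continuous u} ->
    exists M, forall t, a <= t <= b -> `|u t| <= M.
  move=> cu; have [c _ Hc] := EVT_max ab cu; have [d _ Hd] := EVT_min ab cu.
  exists (`|u c| + `|u d|) => t ht.
  have := Hc t; have := Hd t; rewrite in_itv /= ht => /(_ isT) h1 /(_ isT) h2.
  have := ler_norm (u c); have := ler_norm (- u d); rewrite normrN.
  have := normr_ge0 (u c); have := normr_ge0 (u d); rewrite ler_norml; lra.
have [M1 H1] := bd _ (ccont_Re cg); have [M2 H2] := bd _ (ccont_Im cg).
exists (M1 + M2) => t ht; apply: le_trans (normc_le_ReIm _) _.
by apply: lerD; [exact: H1|exact: H2].
Qed.

Lemma ReV z : Re z^-1 = Re z / (Re z ^+ 2 + Im z ^+ 2). Proof. by case: z. Qed.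
Lemma ImV z : Im z^-1 = - Im z / (Re z ^+ 2 + Im z ^+ 2).
Proof. by case: z => a b /=; rewrite mulNr. Qed.

(* Cauchy's formula in the form f(z) = (oint f(w)/(w - z) dw) / (oint dw/(w - z)):
   only the nonvanishing of the denominator is needed, not its value 2 pi i. *)
Lemma cder_cder2 f z0 : (\forall z \near (z0 : Co), exists l, cder f z l) -> cder2 f z0.
Proof.
move=> /nbhsC[d d0 df].
(* Every point of the square of half side r is within 2 r < d of the centre. *)
pose r := d / 4; have r0 : 0 < r by rewrite divr_gt0.
case: z0 df => p q; set z0 : C := (p +i* q)%C => df.
set x0 := p - r; set x1 := p + r; set y0 := q - r; set y1 := q + r.
have xx : x0 <= x1 by rewrite /x0 /x1; lra.
have yy : y0 <= y1 by rewrite /y0 /y1; lra.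
have dr w : rect_pt x0 x1 y0 y1 w -> exists l, cder f w l.
  case: w => a b; rewrite /rect_pt /= => /andP[ha hb]; apply: df.
  have hp : `|a - p| <= r by rewrite ler_norml; rewrite /x0 /x1 in ha; clear -ha; lra.
  have hq : `|b - q| <= r by rewrite ler_norml; rewrite /y0 /y1 in hb; clear -hb; lra.
  by apply: le_lt_trans (normc_ReIm_lt hp hq) _; rewrite /r; lra.
have cgH y t : {for t, continuous (fun t => (t +i* y)%C : Co)}.
  by apply: continuous_mkC; [exact: cvg_id|exact: cvg_cst].
have cgV x t : {for t, continuous (fun t => (x +i* t)%C : Co)}.
  by apply: continuous_mkC; [exact: cvg_cst|exact: cvg_id].
have bcf : bcont f x0 x1 y0 y1.
  apply: bcontP => // a b ha hb _.
  by have [|l /cder_continuous] := dr (a +i* b)%C; rewrite /rect_pt /= ?ha.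
have farh y t : `|y - q| = r -> r <= normc ((t +i* y)%C - z0).
  by move=> <-; have := Im_le_normc ((t +i* y)%C - z0); rewrite ImB.
have farv x t : `|x - p| = r -> r <= normc ((x +i* t)%C - z0).
  by move=> <-; have := Re_le_normc ((x +i* t)%C - z0); rewrite ReB.
have nx0 : `|x0 - p| = r by rewrite /x0 addrAC subrr add0r normrN gtr0_norm.
have nx1 : `|x1 - p| = r by rewrite /x1 addrAC subrr add0r gtr0_norm.
have ny0 : `|y0 - q| = r by rewrite /y0 addrAC subrr add0r normrN gtr0_norm.
have ny1 : `|y1 - q| = r by rewrite /y1 addrAC subrr add0r gtr0_norm.
pose I g z := rect_int (fun w => g w * (w - z)^-1) x0 x1 y0 y1.
have I2 g : bcont g x0 x1 y0 y1 -> cder2 (I g) z0.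
  move=> [c1 c2 c3 c4].
  have [M1 b1] := ccont_bounded xx c1; have [M2 b2] := ccont_bounded xx c2.
  have [M3 b3] := ccont_bounded yy c3; have [M4 b4] := ccont_bounded yy c4.
  have H y M : ccont x0 x1 (fun t => g (t +i* y)%C) ->
      (forall t, x0 <= t <= x1 -> normc (g (t +i* y)%C) <= M) -> `|y - q| = r ->
      cder2 (kern x0 x1 (fun t => g (t +i* y)%C) (fun t => (t +i* y)%C) 1) z0.
    move=> cg gM yq; have cgam : ccont x0 x1 (fun t => (t +i* y)%C : Co) by move=> t _.
    have [B gB] := ccont_bounded xx cgam.
    by apply: (kern_cder2 xx r0 cg cgam gM gB) => t _; exact: farh.
  have V x M : ccont y0 y1 (fun t => g (x +i* t)%C) ->
      (forall t, y0 <= t <= y1 -> normc (g (x +i* t)%C) <= M) -> `|x - p| = r ->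
      cder2 (kern y0 y1 (fun t => g (x +i* t)%C) (fun t => (x +i* t)%C) 1) z0.
    move=> cg gM yq; have cgam : ccont y0 y1 (fun t => (x +i* t)%C : Co) by move=> t _.
    have [B gB] := ccont_bounded yy cgam.
    by apply: (kern_cder2 yy r0 cg cgam gM gB) => t _; exact: farv.
  have hB := H _ _ c1 b1 ny0; have hT := H _ _ c2 b2 ny1.
  have hL := V _ _ c3 b3 nx0; have hR := V _ _ c4 b4 nx1.
  have := cder2D (cder2D hB (cder2Ml (-1) hT)) (cder2Ml 'i%C (cder2D hR (cder2Ml (-1) hL))).
  apply: cder2_ext; near=> w.
  by rewrite !mulN1r.
have bc1 : bcont (fun=> 1 : Co) x0 x1 y0 y1.
  by split=> t _; exact: cvg_cst.
have W0 : I (fun=> 1) z0 != 0.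
  (* Each of the four sides, of length 2 r, contributes at least 1 to the imaginary part, because
     there the integrand has imaginary part r / (u^2 + v^2) >= 1 / (2 r), with |u| = r and |v| <=
     r. *)
  suff : 0 < Im (I (fun=> 1) z0) by apply: contraTneq => ->; rewrite ltxx.
  have cK c : bcont (fun w => c * (1 * (w - z0)^-1)) x0 x1 y0 y1.
    apply: bcontP => // a b ha hb ab.
    have nz : (a +i* b)%C - z0 != 0.
      rewrite -normc_eq0 gt_eqF //; apply: (lt_le_trans r0).
      by case/or4P: ab => /eqP ->; [exact: farv|exact: farv|exact: farh|exact: farh].
    have h := @cderV _ (fun v => v - z0) (a +i* b)%C _ nz (cderB (cder_id _) (cder_cst z0 _)).
    exact: cder_continuous (cderMl c (cderMl 1 h)).
  have xr : x1 - x0 = 2 * r by rewrite /x1 /x0; ring.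
  have yr : y1 - y0 = 2 * r by rewrite /y1 /y0; ring.
  have m0 (u v : R) : `|u| = r -> `|v| <= r -> (2 * r)^-1 <= r / (u ^+ 2 + v ^+ 2).
    move=> ur vr; have u2 : u ^+ 2 = r ^+ 2 by rewrite -ur real_normK ?num_real.
    have v2 : v ^+ 2 <= r ^+ 2.
      by rewrite -[v ^+ 2]real_normK ?num_real //; apply: lerXn2r; rewrite ?nnegrE // ltW.
    have p2 : 0 < r ^+ 2 + v ^+ 2 by rewrite ltr_wpDr ?sqr_ge0 ?exprn_gt0.
    rewrite u2 ler_pdivlMr // mulrC ler_pdivrMr ?mulr_gt0 //.
    by rewrite mulrCA -expr2 mulr_natl mulr2n lerD2l.
  have r2 : 0 < 2 * r by rewrite mulr_gt0.
  have one : (2 * r)^-1 * (2 * r) = 1 by rewrite mulVf // gt_eqF.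
  have x01 : x0 < x1 by rewrite -subr_gt0 xr.
  have y01 : y0 < y1 by rewrite -subr_gt0 yr.
  have kx t : x0 <= t <= x1 -> `|t - p| <= r by rewrite ler_norml /x0 /x1; clear; lra.
  have ky t : y0 <= t <= y1 -> `|t - q| <= r by rewrite ler_norml /y0 /y1; clear; lra.
  have [c1 _ _ _] := cK 1; have [_ c2 _ _] := cK (-1).
  have [_ _ c3 _] := cK (- 'i%C); have [_ _ _ c4] := cK 'i%C.
  have [d1 d2 d3 d4] := cK 1.
  have i1 : 1 <= Im (cint x0 x1 (fun t => 1 * (1 * ((t +i* y0)%C - z0)^-1))).
    apply: (@le_trans _ _ ((2 * r)^-1 * (x1 - x0))); first by rewrite xr one.
    apply: (cint_Im_ge x01 c1) => t ht; rewrite !mul1r ImV ReB ImB /=.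
    rewrite [X in _ / X]addrC (_ : - (y0 - q) = r); last by rewrite /y0; ring.
    exact: m0 ny0 (kx t ht).
  have i2 : 1 <= Im (cint x0 x1 (fun t => -1 * (1 * ((t +i* y1)%C - z0)^-1))).
    apply: (@le_trans _ _ ((2 * r)^-1 * (x1 - x0))); first by rewrite xr one.
    apply: (cint_Im_ge x01 c2) => t ht; rewrite mul1r mulN1r ImN ImV ReB ImB /=.
    have E : y1 - q = r by rewrite /y1; ring.
    by rewrite -mulNr opprK [X in _ / X]addrC; have := m0 _ _ ny1 (kx t ht); rewrite E.
  have i3 : 1 <= Im (cint y0 y1 (fun t => - 'i%C * (1 * ((x0 +i* t)%C - z0)^-1))).
    apply: (@le_trans _ _ ((2 * r)^-1 * (y1 - y0))); first by rewrite yr one.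
    apply: (cint_Im_ge y01 c3) => t ht.
    rewrite mul1r mulNr ImN ImM ReV ReB ImB /= mul0r add0r mul1r.
    rewrite -mulNr (_ : - (x0 - p) = r); last by rewrite /x0; ring.
    exact: m0 nx0 (ky t ht).
  have i4 : 1 <= Im (cint y0 y1 (fun t => 'i%C * (1 * ((x1 +i* t)%C - z0)^-1))).
    apply: (@le_trans _ _ ((2 * r)^-1 * (y1 - y0))); first by rewrite yr one.
    apply: (cint_Im_ge y01 c4) => t ht.
    rewrite mul1r ImM ReV ReB ImB /= mul0r add0r mul1r.
    have E : x1 - p = r by rewrite /x1; ring.
    by have := m0 _ _ nx1 (ky t ht); rewrite E.
  have e1 c : c * (1 * 1) = c :> C by rewrite !mulr1.
  have dd y (cc : hcont (fun w => 1 * (1 * (w - z0)^-1)) x0 x1 y) :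
    ccont x0 x1 (fun t => 1 * ((t +i* y)%C - z0)^-1).
    by move=> t ht; have := cc t ht; rewrite (_ : (fun t => 1 * (1 * _)) = (fun t => 1 * ((t +i* y)%C - z0)^-1)) //;
      apply/funext => s; rewrite mul1r.
  have ddv x (cc : vcont (fun w => 1 * (1 * (w - z0)^-1)) x y0 y1) :
    ccont y0 y1 (fun t => 1 * ((x +i* t)%C - z0)^-1).
    by move=> t ht; have := cc t ht; rewrite (_ : (fun t => 1 * (1 * _)) = (fun t => 1 * ((x +i* t)%C - z0)^-1)) //;
      apply/funext => s; rewrite mul1r.
  move: i1 i2 i3 i4; rewrite (cintZ 1 (dd _ d1)) (cintZ (-1) (dd _ d2)).
  rewrite (cintZ (- 'i%C) (ddv _ d3)) (cintZ 'i%C (ddv _ d4)).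
  rewrite /I /rect_int mul1r mulN1r mulNr mulrBr !ImD !ImN => i1 i2 i3 i4.
  by clear -i1 i2 i3 i4; lra.
(* [cauchy_quotient] says that f(z) times the integral of 1 / (w - z) is the integral of f(w) / (w -
   z). The former integral stays nonzero near z0 by continuity. *)
have fI : \forall z \near (z0 : Co), f z = I f z * (I (fun=> 1) z)^-1.
  have [W' [dW _]] := I2 _ bc1.
  have W0n : \forall w \near (z0 : Co), I (fun=> 1) w != 0.
    exact: near_neq0 (cder_continuous (nbhs_singleton dW)) W0.
  have inn : \forall z \near (z0 : Co), normc (z - z0) < r by apply/nbhsC; exists r.
  near=> z.
  have zr : normc (z - z0) < r by near: z.
  have Wz : I (fun=> 1) z != 0 by near: z.
  have hx : x0 < Re z < x1.
    have := le_lt_trans (Re_le_normc _) zr; rewrite ReB /= ltr_norml /x0 /x1.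
    by clear; lra.
  have hy : y0 < Im z < y1.
    have := le_lt_trans (Im_le_normc _) zr; rewrite ImB /= ltr_norml /y0 /y1.
    by clear; lra.
  have := cauchy_quotient hx hy dr.
  have bK g : bcont g x0 x1 y0 y1 -> bcont (fun w => g w * (w - z)^-1) x0 x1 y0 y1.
    have bV : bcont (fun w => (w - z)^-1 : Co) x0 x1 y0 y1.
      apply: bcontP => // a b ha hb ab.
      have nz : (a +i* b)%C - z != 0.
        rewrite subr_eq0; apply: contraTneq ab => E; rewrite -E /= in hx hy.
        rewrite !negb_or; move: hx hy => /andP[h1 h2] /andP[h3 h4].
        by rewrite (gt_eqF h1) (lt_eqF h2) (gt_eqF h3) (lt_eqF h4).
      have h := @cderV _ (fun v => v - z) (a +i* b)%C _ nz (cderB (cder_id _) (cder_cst z _)).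
      exact: cder_continuous h.
    move=> [c1 c2 c3 c4]; case: bV => e1 e2 e3 e4.
    by split; [exact: ccontM c1 e1|exact: ccontM c2 e2|exact: ccontM c3 e3|exact: ccontM c4 e4].
  have b1 := bK _ bcf; have b2 := bK _ bc1.
  have b3 : bcont (fun w => - f z * (1 * (w - z)^-1)) x0 x1 y0 y1.
    case: b2 => e1 e2 e3 e4.
    by split; [exact: ccontM (@ccont_cst R _ _ (- f z)) e1|exact: ccontM (@ccont_cst R _ _ (- f z)) e2|
      exact: ccontM (@ccont_cst R _ _ (- f z)) e3|exact: ccontM (@ccont_cst R _ _ (- f z)) e4].
  have -> : (fun w => (f w - f z) * (w - z)^-1) =
     (fun w => f w * (w - z)^-1 + - f z * (1 * (w - z)^-1)).
    by apply/funext => w; rewrite mul1r mulrDl.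
  rewrite (rect_intD b1 b3) (rect_intZ _ b2) mulNr => /eqP; rewrite subr_eq0 => /eqP E.
  by rewrite {1}/I E mulfK.
apply: cder2_ext fI _; apply: cder2_div => //; exact: I2.
Unshelve. all: by end_near. Qed.

Lemma holomorphic_derive (V : set Co) f : open V -> holomorphic_on V f ->
  holomorphic_on V ('D_1 f).
Proof.
move=> oV hf z Vz.
have [F' [dF [l dl]]] : cder2 f z.
  apply: cder_cder2; have nV : nbhs z V by exact: open_nbhs_nbhs.
  near=> w; exists ('D_1 f w); apply: derivable_cder; apply: hf; near: w; exact: nV.
have E : \forall w \near (z : Co), F' w = 'D_1 f w.
  by apply: filterS dF => w dw; have /cderP[_ ->] := dw.
by apply: cder_derivable; exact: cder_near E dl.
Unshelve. all: by end_near. Qed.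

End Regularity.

(** * Calculus of smooth functions *)

Section DiffCriterion.
Variables (R : realType) (U W : normedModType R).
Implicit Types (f g : U -> W) (df : {linear U -> W}).

Lemma diffE_eps f df x : continuous df ->
  (forall e : R, 0 < e -> \forall h \near (0 : U), `|f (h + x) - f x - df h| <= e * `|h|) ->
  differentiable f x /\ 'd f x = df :> (U -> W).
Proof.
move=> cdf H.
have E : f \o shift x = cst (f x) + df +o_ (0 : U) id.
  apply/eqaddoP => e e0; have := H e e0; apply: filterS => h; rewrite /= => {}H.
  by rewrite [X in `|X|](_ : _ = f (h + x) - f x - df h) // !fctE /= opprD addrA.
have dE := diff_unique cdf E.
split=> //; apply/diff_locallyP; split; first by rewrite dE.
by rewrite dE.
Qed.

Lemma near_eq_differentiable f g x : (\forall y \near x, f y = g y) ->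
  differentiable f x -> differentiable g x.
Proof.
move=> fg dfx.
suff [] : differentiable g x /\ 'd g x = 'd f x :> (U -> W) by [].
apply: diffE_eps; first exact: diff_continuous.
move=> e e0.
have /diff_locally/eqaddoE/eqaddoP/(_ e e0) := dfx.
have fgx : f x = g x := nbhs_singleton fg.
have fg0 : \forall h \near (0 : U), f (h + x) = g (h + x).
  have := (@near_shift _ _ 0 x (fun y => f y = g y)).
  by rewrite subr0 => <-.
move=> H; near=> h.
have -> : g (h + x) = f (h + x) by apply/esym; near: h.
rewrite -fgx.
have : `|(f \o shift x - (cst (f x) + 'd f x)) h| <= e * `|h| by near: h.
by rewrite !fctE /= opprD addrA.
Unshelve. all: by end_near. Qed.

End DiffCriterion.

Section CkCalculus.
Variables (R : realType) (U : normedModType R).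

(** [Ck_on] speaks of total functions and their total derivatives. The induction works because
    functions that agree near a point have the same directional derivatives near it. *)
Lemma Ck_local (W : normedModType R) k (V : set U) (g : U -> W) :
  (forall p, V p -> exists V' (f : U -> W), [/\ open V', V' p, Ck_on k V' f &
     forall q, V' q -> f q = g q]) -> Ck_on k V g.
Proof.
elim: k V g => [|k IH] V g H /=.
  move=> p /H [V' [f [oV' V'p cf fg]]]; have nV : nbhs p V' by exact: open_nbhs_nbhs.
  have := cf p V'p; rewrite /prop_for /continuous_at (fg _ V'p) => c.
  apply: cvg_trans c; apply: near_eq_cvg; near=> q; apply: fg; near: q; exact: nV.
have loc p V' (f : U -> W) : open V' -> V' p -> (forall q, V' q -> f q = g q) ->
    \forall q \near p, f q = g q.
  move=> oV' V'p fg; have nV : nbhs p V' by exact: open_nbhs_nbhs.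
  near=> q; apply: fg; near: q; exact: nV.
split=> [p /H [V' [f [oV' V'p [df _] fg]]]|v].
  exact: near_eq_differentiable (loc _ _ _ oV' V'p fg) (df _ V'p).
apply: IH => p /H [V' [f [oV' V'p [_ cf] fg]]]; exists V', ('D_v f); split => // [|q V'q].
  exact: cf.
by apply: near_eq_derive; exact: loc fg.
Unshelve. all: by end_near. Qed.

Lemma Ck_ext (W : normedModType R) k (V : set U) (f g : U -> W) : open V ->
  (forall q, V q -> f q = g q) -> Ck_on k V f -> Ck_on k V g.
Proof. by move=> oV fg cf; apply: Ck_local => p Vp; exists V, f. Qed.

Lemma CkS (W : normedModType R) k (V : set U) (f : U -> W) :
  Ck_on k.+1 V f -> Ck_on k V f.
Proof.
elim: k f => [|k IH] f [df cf].
  by move=> p Vp; apply: differentiable_continuous; exact: df.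
by split=> // v; exact: IH.
Qed.

Lemma Ck_cst (W : normedModType R) k (V : set U) (c : W) : Ck_on k V (cst c : U -> W).
Proof.
elim: k c => [|k IH] c /=; first by move=> p _; exact: cst_continuous.
split=> [p _|v]; first exact: differentiable_cst.
have -> : 'D_v (cst c : U -> W) = cst 0 by apply/funext => p; rewrite derive_cst.
exact: IH.
Qed.

Lemma CkD (W : normedModType R) k (V : set U) (f g : U -> W) : open V ->
  Ck_on k V f -> Ck_on k V g -> Ck_on k V (f + g).
Proof.
move=> oV; elim: k f g => [|k IH] f g /=.
  by move=> cf cg p Vp; apply: continuousD; [exact: cf|exact: cg].
move=> [df cf] [dg cg]; split=> [p Vp|v].
  by apply: differentiableD; [exact: df|exact: dg].
apply: (Ck_ext oV _ (IH _ _ (cf v) (cg v))) => q Vq.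
by rewrite deriveD //; apply: diff_derivable; [exact: df|exact: dg].
Qed.

Lemma CkM k (V : set U) (f g : U -> R) : open V ->
  Ck_on k V f -> Ck_on k V g -> Ck_on k V (f * g).
Proof.
move=> oV; elim: k f g => [|k IH] f g.
  by move=> /= cf cg p Vp; apply: continuousM; [exact: cf|exact: cg].
move=> cf cg; have cf' := CkS cf; have cg' := CkS cg.
case: cf => df cf; case: cg => dg cg; split=> [p Vp|v].
  by apply: differentiableM; [exact: df|exact: dg].
apply: (Ck_ext oV _ (CkD oV (IH _ _ cf' (cg v)) (IH _ _ cg' (cf v)))) => q Vq.
by rewrite deriveM //; apply: diff_derivable; [exact: df|exact: dg].
Qed.

Lemma CkZr (W : normedModType R) k (V : set U) (f : U -> R) (w : W) : open V ->
  Ck_on k V f -> Ck_on k V (fun x => f x *: w).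
Proof.
move=> oV; elim: k f => [|k IH] f /=.
  by move=> cf p Vp; apply: continuousZr_tmp; exact: cf.
move=> [df cf]; split=> [p Vp|v].
  by apply: differentiableZl; exact: df.
apply: (Ck_ext oV _ (IH _ (cf v))) => q Vq.
rewrite [RHS]deriveE; last by apply: differentiableZl; exact: df.
rewrite diffZl; last exact: df.
by rewrite deriveE //; exact: df.
Qed.

Lemma Ck_sum (W : normedModType R) k (V : set U) n (f : 'I_n -> U -> W) : open V ->
  (forall i, Ck_on k V (f i)) -> Ck_on k V (fun x => \sum_i f i x).
Proof.
move=> oV cf; have -> : (fun x => \sum_i f i x) = \sum_i f i.
  by apply/funext => x; rewrite fct_sumE.
by elim/big_ind: _ => // [|g h]; [exact: (Ck_cst k V 0)|exact: CkD].
Qed.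

End CkCalculus.

(** * The flat function exp(-1/t) *)

Section Flat.
Variable R : realType.

(* The functions t^-n exp(-1/t) are closed under differentiation up to linear combinations. *)
Definition flat n (t : R) : R := if 0 < t then t ^- n * expR (- t^-1) else 0.

Lemma flat_pos (t : R) : 0 < t -> 0 < flat 0 t.
Proof. by move=> t0; rewrite /flat t0 expr0 invr1 mul1r expR_gt0. Qed.

Lemma flat_npos n (t : R) : t <= 0 -> flat n t = 0.
Proof. by rewrite /flat leNgt => /negbTE ->. Qed.

Lemma flat_ge0 n (t : R) : 0 <= flat n t.
Proof.
rewrite /flat; case: ifP => // t0.
by rewrite mulr_ge0 ?expR_ge0 // invr_ge0 exprn_ge0 // ltW.
Qed.

(** expR s is the m-th power of expR (s / m), which is at least s / m by 1 + x <= expR x. *)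
Lemma exprn_le_expR m (s : R) : (0 < m)%N -> 0 <= s -> s ^+ m <= m%:R ^+ m * expR s.
Proof.
move=> m0 s0; have mR : 0 < m%:R :> R by rewrite ltr0n.
have -> : expR s = expR (s / m%:R) ^+ m.
  by rewrite -expRM_natl mulrC mulfVK // gt_eqF.
rewrite -exprMn; apply: lerXn2r; rewrite ?nnegrE ?(mulr_ge0 (ltW mR)) ?expR_ge0 //.
rewrite [leRHS]mulrC -ler_pdivrMr //; apply: le_trans (expR_ge1Dx _).
by rewrite lerDr.
Qed.

(** Letting the exponential absorb t^-(n + 2) and not only t^-n leaves a factor t^2, which gives
    [flat n] the derivative 0 at 0. *)
Lemma flat_le n (t : R) : flat n t <= n.+2%:R ^+ n.+2 * t ^+ 2.
Proof.
rewrite /flat; case: ifP => t0; last by apply: mulr_ge0; [exact: exprn_ge0|exact: sqr_ge0].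
have ti : 0 <= t^-1 by rewrite invr_ge0 ltW.
have := @exprn_le_expR n.+2 t^-1 isT ti => H.
rewrite expRN -exprVn ler_pdivrMr ?expR_gt0 // mulrAC -ler_pdivrMr ?exprn_gt0 //.
by rewrite -exprVn -exprD addn2.
Qed.

Lemma is_derive_flat n (t : R) :
  is_derive t (1 : R) (flat n) (- n%:R * flat n.+1 t + flat n.+2 t).
Proof.
have [t0|t0|<-] := ltgtP 0 t.
- have E : \forall s \near t, (s^-1) ^+ n * expR (- s^-1) = flat n s.
    near=> s; rewrite /flat ifT ?exprVn //; near: s; exact: lt_nbhsr.
  apply: near_eq_is_derive E _.
  have t1 : t != 0 by rewrite gt_eqF.
  have dV : is_derive t (1 : R) (fun s : R => s^-1) (- t ^- 2).
    apply: DeriveDef; first exact: derivableV.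
    by rewrite deriveV // derive_id /GRing.scale /= mulr1.
  have de : is_derive t^-1 (1 : R) (fun s : R => s ^+ n * expR (- s))
      (n%:R * t^-1 ^+ n.-1 * expR (- t^-1) - t^-1 ^+ n * expR (- t^-1)).
    have h1 : is_derive t^-1 (1 : R) (fun s : R => expR (- s)) (- expR (- t^-1)).
      have := @is_derive1_comp R expR -%R t^-1 _ _ (is_derive_expR _) (is_deriveNid _ _).
      by move=> H; apply: is_derive_eq; rewrite mulrN1.
    have h2 := @is_deriveX R R id n t^-1 1 _ (is_derive_id _ _).
    have := is_deriveM h2 h1.
    have -> : (@id R ^+ n * (fun s : R => expR (- s))) = (fun s : R => s ^+ n * expR (- s)).
      by apply/funext => s; rewrite !fctE.
    by move=> H; apply: is_derive_eq; rewrite /GRing.scale /= fctE mulr1; ring.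
  have := @is_derive1_comp R (fun s : R => s ^+ n * expR (- s)) (fun s : R => s^-1) t _ _ de dV.
  move=> H; apply: is_derive_eq; rewrite /flat t0 -!exprVn.
  case: n {de H} => [|n] /=; rewrite ?exprS; ring.
- have E : \forall s \near t, (fun=> 0 : R) s = flat n s.
    near=> s; rewrite flat_npos // ltW //; near: s; exact: lt_nbhsl.
  apply: near_eq_is_derive E _.
  by rewrite !flat_npos ?ltW // mulr0 addr0; exact: is_derive_cst.
- rewrite !flat_npos // mulr0 addr0.
  pose A : R := n.+2%:R ^+ n.+2.
  have A0 : 0 < A by rewrite exprn_gt0 ?ltr0n.
  have [df dE] : differentiable (flat n) (0 : R) /\ 'd (flat n) (0 : R) = \0 :> (R -> R).
    apply: diffE_eps; first by move=> x; exact: cst_continuous.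
    move=> e e0; apply/nbhsR; exists (e / A); first by rewrite divr_gt0.
    move=> h; rewrite subr0 addr0 (flat_npos _ (lexx 0)) !subr0 => hA.
    rewrite ger0_norm ?flat_ge0 //; apply: le_trans (flat_le n h) _.
    rewrite -real_normK ?num_real // expr2 mulrA ler_wpM2r // mulrC -ler_pdivlMr //.
    exact: ltW.
  by apply: DeriveDef; [exact: diff_derivable|rewrite deriveE // dE].
Unshelve. all: by end_near. Qed.

End Flat.

Section CkFlat.
Variables (R : realType) (U : normedModType R).

(** The induction on k runs over all n at once, since differentiation raises n. *)
Lemma Ck_flat k (V : set U) (g : U -> R) n : open V ->
  Ck_on k V g -> Ck_on k V (flat n \o g).
Proof.
move=> oV; elim: k n => [|k IH] n.
  move=> cg p Vp; apply: continuous_comp; first exact: cg.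
  have [dn _] := is_derive_flat n (g p).
  exact/differentiable_continuous/derivable1_diffP.
move=> cg; have cg' := CkS cg; case: cg => dg cg.
have dn (x : R) : differentiable (flat n : R -> R) x.
  by apply/derivable1_diffP; case: (is_derive_flat n x).
split=> [p Vp|v]; first by apply: differentiable_comp; [exact: dg|exact: dn].
have h1 := CkM oV (Ck_cst k V (- n%:R : R)) (IH n.+1 cg').
have h2 := CkM oV (CkD oV h1 (IH n.+2 cg')) (cg v).
apply: Ck_ext oV _ h2 => q Vq.
rewrite [RHS]deriveE; last by apply: differentiable_comp; [exact: dg|exact: dn].
rewrite diff_comp ?dn //; last exact: dg.
rewrite /= deriv1E; last by case: (is_derive_flat n (g q)).
rewrite derive1E (@derive_val _ _ _ _ _ _ _ (is_derive_flat n (g q))).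
by rewrite -deriveE; [rewrite !fctE mulrC|exact: dg].
Qed.

End CkFlat.

(** * Real smoothness of holomorphic functions *)

Section HolomorphicCk.
Variable R : realType.
Local Notation C := (R[i]).
Local Notation Co := (R[i]^o).
Local Notation Re := (@complex.Re R).
Local Notation Im := (@complex.Im R).

Definition toC (p : R * R) : Co := (p.1 +i* p.2)%C.

Lemma continuous_toC : continuous toC.
Proof. by move=> p; apply: continuous_mkC; [exact: cvg_fst|exact: cvg_snd]. Qed.

Lemma toCD p q : toC (p + q) = toC p + toC q. Proof. by []. Qed.

Lemma normc_toC p : normc (toC p) <= 2 * `|p|.
Proof.
apply: le_trans (normc_le_ReIm _) _; rewrite /= mulr_natl mulr2n prod_normE.
by apply: lerD; rewrite le_max lexx ?orbT.
Qed.

Definition lin2 (a b : R) (v : R * R) : R := a * v.1 + b * v.2.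

Lemma lin2_is_linear a b : linear (lin2 a b).
Proof. by move=> c [x y] [z w]; rewrite /lin2 /= /GRing.scale /=; ring. Qed.

HB.instance Definition _ a b :=
  GRing.isLinear.Build R (R * R)%type R _ (lin2 a b) (lin2_is_linear a b).

Lemma continuous_lin2 a b : continuous (lin2 a b).
Proof.
move=> p; apply: cvgD; apply: cvgM; try exact: cvg_cst.
  exact: cvg_fst.
exact: cvg_snd.
Qed.

(** The real differential is multiplication by the complex derivative. Hence a directional
    derivative of Re h is again the real part of a holomorphic function, which drives the induction
    in [Ck_Re_hol]. *)
Lemma diff_Re_hol (h : Co -> Co) p l : cder h (toC p) l ->
  differentiable (fun q => Re (h (toC q))) p /\
  forall v, 'D_v (fun q => Re (h (toC q))) p = Re (l * toC v).
Proof.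
move=> dh; have E v : lin2 (Re l) (- Im l) v = Re (l * toC v).
  by rewrite ReM /lin2 mulNr.
have [df dE] : differentiable (fun q => Re (h (toC q))) p /\
    'd (fun q => Re (h (toC q))) p = lin2 (Re l) (- Im l) :> (R * R -> R).
  apply: diffE_eps; first exact: continuous_lin2.
  move=> e e0; have [d d0 Hd] := dh (e / 2) (divr_gt0 e0 (ltr0Sn R 1)).
  have nd : \forall v \near (0 : R * R), normc (toC v) < d.
    have c0 : toC (0 : R * R) = 0 by [].
    have := @continuous_toC (0 : R * R) [set z | normc z < d]; apply.
    rewrite c0; apply/nbhsC; exists d => // w; by rewrite subr0.
  near=> v; have vd : normc (toC v) < d by near: v.
  rewrite [X in _ - X](_ : _ = Re (l * toC v)); last exact: E.
  rewrite toCD -!ReB; apply: le_trans (Re_le_normc _) _.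
  have := Hd (toC v + toC p); rewrite addrK => /(_ vd) /le_trans; apply.
  by have := normc_toC v; have := normc_ge0 (toC v); nra.
by split=> // v; rewrite deriveE // dE E.
Unshelve. all: by end_near. Qed.

Lemma open_toC (V : set Co) : open V -> open [set p | V (toC p)].
Proof.
move=> oV; have := @open_comp _ _ toC V _ oV; apply => p _; exact: continuous_toC.
Qed.

Lemma Ck_Re_hol k (V : set Co) (h : Co -> Co) : open V -> holomorphic_on V h ->
  Ck_on k [set p | V (toC p)] (fun q => Re (h (toC q))).
Proof.
move=> oV; elim: k h => [|k IH] h hh.
  move=> p Vp; have [df _] := diff_Re_hol (derivable_cder (hh _ Vp)).
  exact: differentiable_continuous.
split=> [p Vp|v]; first by have [] := diff_Re_hol (derivable_cder (hh _ Vp)).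
have hh' : holomorphic_on V (fun z => toC v * 'D_1 h z).
  move=> z Vz; apply: cder_derivable; apply: cderMl; apply: derivable_cder.
  exact: (holomorphic_derive oV hh).
apply: (Ck_ext (open_toC oV) _ (IH _ hh')) => p Vp.
by have [_ ->] := diff_Re_hol (derivable_cder (hh _ Vp)); rewrite mulrC.
Qed.

(** Im h is the real part of -i h. *)
Lemma Ck_Im_hol k (V : set Co) (h : Co -> Co) : open V -> holomorphic_on V h ->
  Ck_on k [set p | V (toC p)] (fun q => Im (h (toC q))).
Proof.
move=> oV hh.
have hh' : holomorphic_on V (fun z => - 'i%C * h z).
  move=> z Vz; apply: cder_derivable; apply: cderMl; apply: derivable_cder; exact: hh.
apply: (Ck_ext (open_toC oV) _ (@Ck_Re_hol k V _ oV hh')) => p Vp.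
by rewrite mulNr ReN ReM /= mul0r mul1r sub0r opprK.
Qed.

Lemma mvt_bound (u du : R -> R) (a b M : R) :
  (forall t, (a <= t <= b) \/ (b <= t <= a) ->
    is_derive t (1 : R) u (du t) /\ `|du t| <= M) ->
  `|u b - u a| <= M * `|b - a|.
Proof.
have H (x y : R) : x <= y -> (forall t, x <= t <= y -> is_derive t (1 : R) u (du t) /\ `|du t| <= M) ->
    `|u y - u x| <= M * (y - x).
  move=> xy H; have [||c cxy ->] := @MVT_segment R u du x y xy.
  - move=> t; rewrite in_itv /= => /andP[t1 t2].
    by have [|] := H t; rewrite ?(ltW t1) ?(ltW t2).
  - apply: derivable_within_continuous => t; rewrite in_itv /= => ht.
    by have [[]] := H t ht.
  rewrite normrM (ger0_norm (_ : 0 <= y - x)) ?subr_ge0 // ler_wpM2r ?subr_ge0 //.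
  by move: cxy; rewrite in_itv /= => /H[].
move=> du_le; have [ab|/ltW ba] := leP a b.
  by rewrite (@ger0_norm _ (b - a)) ?subr_ge0 //; apply: H => // t ht; apply: du_le; left.
rewrite distrC (@ler0_norm _ (b - a)) ?subr_le0 // opprB.
by apply: H => // t ht; apply: du_le; right.
Qed.

Lemma is_derive_fst (f : R * R -> R) (t y : R) : derivable f (t, y) (1, 0) ->
  is_derive t (1 : R) (fun s => f (s, y)) ('D_(1, 0) f (t, y)).
Proof.
move=> df.
have E : (fun h : R => h^-1 *: (f (h *: 1 + t, y) - f (t, y))) =
    (fun h : R => h^-1 *: (f (h *: (1, 0) + (t, y)) - f (t, y))).
  apply/funext => h.
  have -> : h *: ((1, 0) : R * R) + (t, y) = (h *: 1 + t, h *: (0 : R) + y) by [].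
  by rewrite scaler0 add0r.
by split; rewrite /derivable /derive /= E.
Qed.

Lemma is_derive_snd (f : R * R -> R) (t y : R) : derivable f (t, y) (0, 1) ->
  is_derive y (1 : R) (fun s => f (t, s)) ('D_(0, 1) f (t, y)).
Proof.
move=> df.
have E : (fun h : R => h^-1 *: (f (t, h *: 1 + y) - f (t, y))) =
    (fun h : R => h^-1 *: (f (h *: (0, 1) + (t, y)) - f (t, y))).
  apply/funext => h.
  have -> : h *: ((0, 1) : R * R) + (t, y) = (h *: (0 : R) + t, h *: 1 + y) by [].
  by rewrite scaler0 add0r.
by split; rewrite /derivable /derive /= E.
Qed.

(** The balls of the product norm are squares, so the path from p to q that moves first horizontally
    and then vertically stays in one on which both partial derivatives are below M. The mean value
    inequality applies to each leg. *)
Lemma C1_lipschitz (V : set (R * R)) (f : R * R -> R) p0 M : open V -> V p0 ->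
  Ck_on 1 V f -> `|'D_(1, 0) f p0| < M -> `|'D_(0, 1) f p0| < M ->
  exists2 d : R, 0 < d & forall p q,
    `|p.1 - p0.1| < d -> `|p.2 - p0.2| < d -> `|q.1 - p0.1| < d -> `|q.2 - p0.2| < d ->
    `|f p - f q| <= M * (`|p.1 - q.1| + `|p.2 - q.2|).
Proof.
move=> oV Vp [df cf] l1 l2.
have n1 v : `|'D_v f p0| < M -> \forall p \near p0, `|'D_v f p| < M.
  move=> lv; have := cf v p0 Vp [set x | `|x| < M]; apply; apply/nbhsR.
  exists (M - `|'D_v f p0|); first by rewrite subr_gt0.
  move=> y; rewrite ltrBrDr => h /=; apply: le_lt_trans h.
  by have := ler_normD (y - 'D_v f p0) ('D_v f p0); rewrite subrK.
have nV : \forall p \near p0, V p by exact: open_nbhs_nbhs.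
have : nbhs p0 (V `&` ([set p | `|'D_(1, 0) f p| < M] `&` [set p | `|'D_(0, 1) f p| < M])).
  by apply: filterI => //; apply: filterI; exact: n1.
move=> /nbhs_ballP[d /= d0 Hd].
exists d => // -[p1 p2] [q1 q2] /= hp1 hp2 hq1 hq2.
have inV (t s : R) : `|t - p0.1| < d -> `|s - p0.2| < d ->
   [/\ V (t, s), `|'D_(1, 0) f (t, s)| < M & `|'D_(0, 1) f (t, s)| < M].
  move=> ht hs; have [|v1 [v2 v3]] := Hd (t, s); last by split.
  by split; rewrite /ball /= distrC.
have conv (a b c t : R) : `|a - c| < d -> `|b - c| < d ->
    (a <= t <= b) \/ (b <= t <= a) -> `|t - c| < d.
  by rewrite !ltr_norml; clear; move=> h1 h2 []; lra.
have -> : f (p1, p2) - f (q1, q2) = (f (p1, p2) - f (q1, p2)) + (f (q1, p2) - f (q1, q2)).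
  by rewrite addrA subrK.
apply: le_trans (ler_normD _ _) _; rewrite mulrDr; apply: lerD.
  apply: (@mvt_bound (fun s => f (s, p2)) (fun s => 'D_(1, 0) f (s, p2))) => t ht.
  have [Vt /ltW b1 _] := inV t p2 (conv _ _ _ _ hq1 hp1 ht) hp2.
  by split=> //; apply: is_derive_fst; apply: diff_derivable; exact: df.
apply: (@mvt_bound (fun s => f (q1, s)) (fun s => 'D_(0, 1) f (q1, s))) => t ht.
have [Vt _ /ltW b2] := inV q1 t hq1 (conv _ _ _ _ hq2 hp2 ht).
by split=> //; apply: is_derive_snd; apply: diff_derivable; exact: df.
Qed.

End HolomorphicCk.

(** * Rare parameter sets *)

(** Baire's theorem is applied in the space of coefficient vectors. *)
HB.instance Definition _ (R : realType) m n := Complete.on 'M[R^o]_(m, n).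

Section MatrixNorm.
Variable R : realType.

Lemma mx_entry_le m n (A : 'M[R]_(m, n)) i j : `|A i j| <= `|A|.
Proof.
rewrite [leRHS]mx_normrE; exact: (le_bigmax _ (fun ij : 'I_m * 'I_n => `|A ij.1 ij.2|) (i, j)).
Qed.

Lemma mx_norm_le m n (A : 'M[R]_(m, n)) e : 0 <= e -> (forall i j, `|A i j| <= e) -> `|A| <= e.
Proof.
move=> e0 H; rewrite [leLHS]mx_normrE; apply/bigmax_leP; split => // -[i j] _; exact: H.
Qed.

Lemma mulmx_entry_le m n p (A : 'M[R]_(m, n)) (B : 'M[R]_(n, p)) a b i k :
  0 <= a -> (forall j, `|A i j| <= a) -> (forall j, `|B j k| <= b) ->
  `|(A *m B) i k| <= n%:R * (a * b).
Proof.
move=> a0 Aa Bb; rewrite mxE; apply: le_trans (ler_norm_sum _ _ _) _.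
rewrite -[n in leRHS]card_ord mulr_natl -sumr_const; apply: ler_sum => j _.
by rewrite normrM; apply: ler_pM.
Qed.

End MatrixNorm.

(** * A pigeonhole estimate on grids *)

Section Counting.
Variable R : realType.

(* Pigeonhole: s maps the M^n points of a grid into dimension d < n, so it brings
   two of them much closer together than the mesh 1/M. *)
Lemma close_pair (d n : nat) (r K : R) : (d < n)%N -> 0 < r -> 0 <= K ->
  exists M : nat, (0 < M)%N /\ exists2 eta : R, 0 < eta &
  forall s : {ffun 'I_n -> 'I_M} -> 'I_d -> R, (forall k i, `|s k i| <= r) ->
  exists k k', k != k' /\ K * (\sum_i `|s k i - s k' i| + eta) < M%:R^-1.
Proof.
move=> dn r0 K0.
(* The cube of side 2 r is cut into cells of side 2 r / (q M). There are at most ((q + 1) M)^d of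
   them, fewer than M^n because M > (q + 1)^d and d < n. The size of q makes K times the d
   differences within a cell less than 1 / (2 M). *)
pose q := (Num.trunc (4 * K * r * d%:R)).+1.
have qP : 4 * K * r * d%:R < q%:R by exact: truncnS_gt.
pose M := ((q.+1 ^ d).+1)%N; have M0 : 0 < M%:R :> R by rewrite ltr0n.
(* The term K eta gets the other half of 1 / M. *)
exists M; split=> //; exists (2 * M%:R * (K + 1))^-1.
  by rewrite invr_gt0 !mulr_gt0 // ltr_wpDl.
move=> s sr.
have pos k i : 0 <= (s k i + r) / (2 * r) * (q * M)%:R.
  have := sr k i; rewrite ler_norml => /andP[h _].
  by rewrite mulr_ge0 // divr_ge0 ?mulr_ge0 ?(ltW r0) //; lra.
have lt k i : (Num.trunc ((s k i + r) / (2 * r) * (q * M)%:R) < (q * M).+1)%N.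
  have := sr k i; rewrite ler_norml => /andP[_ h].
  rewrite ltnS truncn_le_nat -(natr1 (q * M)%N); apply: le_lt_trans (_ : (q * M)%:R < _); last by rewrite ltrDl.
  by rewrite ler_piMl // ler_pdivrMr ?mulr_gt0 //; clear -h; lra.
pose cell (k : {ffun 'I_n -> 'I_M}) : {ffun 'I_d -> 'I_(q * M).+1} := [ffun i => Ordinal (lt k i)].
have ninj : ~ injective cell.
  move=> /leq_card; rewrite !card_ffun !card_ord leqNgt => /negP; apply.
  have h1 : ((q * M).+1 ^ d <= (q.+1 * M) ^ d)%N.
    by case: (d) => // d'; rewrite leq_exp2r // mulSn -addn1 addnC leq_add2r.
  apply: leq_ltn_trans h1 _; rewrite expnMn -(subnKC (ltnW dn)) expnD mulnC.
  rewrite ltn_pmul2l ?expn_gt0 //; apply: leq_trans (ltnSn _) _.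
  by rewrite -/M -{1}(expn1 M) leq_exp2l // ?subn_gt0 // ltnS expn_gt0.
have [k [k' [kk' E]]] : exists k k', k != k' /\ cell k = cell k'.
  apply: contrapT => H; apply: ninj => k k' E; apply: contrapT => /eqP kk'.
  by apply: H; exists k, k'.
exists k, k'; split => //.
have close i : `|s k i - s k' i| <= 2 * r / (q * M)%:R.
  have := congr1 (fun f : {ffun _ -> _} => val (f i)) E; rewrite !ffunE /= => Ei.
  have /andP[a1 a2] := truncn_itv (pos k i); have /andP[b1 b2] := truncn_itv (pos k' i).
  rewrite -Ei in b1 b2; set m := Num.trunc _ in a1 a2 b1 b2.
  have qM0 : 0 < (q * M)%:R :> R by rewrite ltr0n muln_gt0.
  have r2 : 0 < 2 * r by rewrite mulr_gt0.
  have e0 : (s k i - s k' i) = (((s k i + r) / (2 * r) * (q * M)%:R) -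
      ((s k' i + r) / (2 * r) * (q * M)%:R)) * (2 * r / (q * M)%:R).
    by field; rewrite !gt_eqF.
  rewrite e0 normrM (ger0_norm (_ : 0 <= 2 * r / _)); last by rewrite divr_ge0 // ltW.
  rewrite ler_piMl //; first by rewrite divr_ge0 // ltW.
  by rewrite ler_norml; rewrite -(natr1 m) in a2 b2; clear -a1 a2 b1 b2; lra.
have sum_le : \sum_i `|s k i - s k' i| <= d%:R * (2 * r / (q * M)%:R).
  apply: le_trans (ler_sum _ (fun i _ => close i)) _.
  by rewrite sumr_const card_ord [leRHS]mulr_natl.
have q0 : 0 < q%:R :> R by rewrite ltr0n.
have h1 : K * (d%:R * (2 * r / (q * M)%:R)) < (2 * M%:R)^-1.
  rewrite natrM; have -> : K * (d%:R * (2 * r / (q%:R * M%:R))) =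
    (4 * K * r * d%:R) / q%:R * (2^-1 * M%:R^-1) by field; rewrite !gt_eqF.
  by rewrite invfM gtr_pMl ?mulr_gt0 ?invr_gt0 // ltr_pdivrMr // mul1r.
have h2 : K * (2 * M%:R * (K + 1))^-1 <= (2 * M%:R)^-1.
  have K1 : 0 < K + 1 by rewrite ltr_wpDl.
  rewrite invfM mulrCA ger_pMr ?invr_gt0 ?mulr_gt0 //.
  by rewrite ler_pdivrMr // mul1r lerDl.
have -> : M%:R^-1 = (2 * M%:R)^-1 + (2 * M%:R)^-1 :> R by field; rewrite gt_eqF.
rewrite mulrDr; apply: ltr_leD h2; apply: le_lt_trans h1; exact: ler_wpM2l.
Qed.

End Counting.

(** * Nowhere dense sets of coefficient vectors *)

Section Rare.
Variable R : realType.

(* [rare A] means that A is nowhere dense. *)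
Definition rare N (A : set 'cV[R]_N) := forall (a0 : 'cV[R]_N) (e : R), 0 < e ->
  exists (a1 : 'cV[R]_N) (e1 : R), 0 < e1 /\ forall a, `|a - a1| < e1 -> `|a - a0| < e /\ ~ A a.

Lemma rareS N (A B : set 'cV[R]_N) : A `<=` B -> rare B -> rare A.
Proof.
move=> AB rB a0 e e0; have [a1 [e1 [e10 H]]] := rB a0 e e0.
by exists a1, e1; split=> // a /H [h1 h2]; split=> // /AB.
Qed.

Lemma rare0 N : rare (set0 : set 'cV[R]_N).
Proof. by move=> a0 e e0; exists a0, e; split=> // a ae; split=> // -[]. Qed.

Lemma rareU N (A B : set 'cV[R]_N) : rare A -> rare B -> rare (A `|` B).
Proof.
move=> rA rB a0 e e0; have [a1 [e1 [e10 H1]]] := rA a0 e e0.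
have [a2 [e2 [e20 H2]]] := rB a1 e1 e10.
exists a2, e2; split=> // a /H2 [/H1 [h1 h2] h3]; split=> //; by case.
Qed.

Lemma rare_bigcup_fin N (I : eqType) (r : seq I) (A : I -> set 'cV[R]_N) :
  (forall i, rare (A i)) -> rare [set a | exists2 i, i \in r & A i a].
Proof.
move=> rA; elim: r => [|i r IH]; first by apply: rareS (@rare0 N) => a [].
apply: rareS (rareU (rA i) IH) => a [j]; rewrite inE => /orP[/eqP -> ja|jr ja]; first by left.
by right; exists j.
Qed.

Lemma rare_baire N (A : nat -> set 'cV[R]_N) : (forall j, rare (A j)) ->
  exists a, forall j, ~ A j a.
Proof.
move=> rA.
pose F j := interior (~` A j).
have FP j : open (F j) /\ dense (F j).
  split; first exact: open_interior.
  move=> D [a0 Da0] oD.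
  have /nbhs_ballP[e /= e0 He] : nbhs a0 D by exact: open_nbhs_nbhs.
  have [a1 [e1 [e10 H]]] := rA j a0 e e0.
  exists a1; split.
    apply: He; rewrite -ball_normE /ball_ /=; have [|h _] := H a1.
      by rewrite subrr normr0.
    by rewrite distrC.
  apply/nbhs_ballP; exists e1 => // a; rewrite -ball_normE /ball_ /= distrC => /H [_].
  by [].
have [a [_ Ha]] := @Baire R 'cV[R]_N F FP setT (ex_intro _ 0 I) openT.
by exists a => j; have /interior_subset := Ha j I.
Qed.

(** Compactness as an induction principle: if P K failed, the sets A with P (K \ A) would form a
    proper filter containing K, and the neighbourhood with P of a cluster point would contradict
    clustering. *)
Lemma compact_ind (X : topologicalType) (K : set X) (P : set X -> Prop) : compact K ->
  P set0 -> (forall A B, P A -> P B -> P (A `|` B)) -> (forall A B, A `<=` B -> P B -> P A) ->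
  (forall x, K x -> exists2 U, nbhs x U & P U) -> P K.
Proof.
move=> cK P0 PU PS loc; apply: contrapT => nPK.
pose F := [set A : set X | P (K `\` A)].
have FF : ProperFilter F.
  split; first by rewrite /F /= setD0 => /nPK.
  split.
  - by rewrite /F /= setDT.
  - by move=> A B FA FB; rewrite /F /= setDIr; exact: PU.
  - by move=> A B AB; apply: PS => x [Kx nB]; split=> // /AB.
have FK : F K by rewrite /F /= setDv.
have [x [Kx clx]] := cK F FF FK.
have [U xU PUU] := loc x Kx.
have FU : F (~` U) by apply: PS PUU => y [_ /contrapT].
by have [y []] := clx _ _ FU xU.
Qed.

Lemma rare_compact N (X : topologicalType) (K : set X) (bad : X -> set 'cV[R]_N) :
  compact K ->
  (forall x, K x -> exists2 U, nbhs x U & rare [set a | exists2 y, U y & bad y a]) ->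
  rare [set a | exists2 y, K y & bad y a].
Proof.
move=> cK loc.
apply: (@compact_ind X K (fun A => rare [set a | exists2 y, A y & bad y a])) => //.
- by apply: rareS (@rare0 N) => a [].
- by move=> A B rA rB; apply: rareS (rareU rA rB) => a [y [Ay|By] ya]; [left|right]; exists y.
- by move=> A B AB; apply: rareS => a [y /AB]; exists y.
Qed.

(* W is an approximate right inverse of L on U.  If every point a0 + eps W t, with t
   on a grid of mesh 1/M in [0,1]^n, were almost killed by some L x_t, then
   [close_pair] would give t <> t' with L x_t and L x_t' almost equal, so that
   L x_t would almost kill W (t - t'), whose image has norm about |t - t'| >= 1/M. *)
Lemma rare_local N (X : Type) (U : set X) d n (L : X -> 'M[R]_(n, N)) (s : X -> 'I_d -> R)
    (W : 'M[R]_(N, n)) (c r : R) : (d < n)%N -> 0 < r -> 0 <= c ->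
  (forall x i, U x -> `|s x i| <= r) ->
  (forall x y i j, U x -> U y -> `|L x i j - L y i j| <= c * \sum_k `|s x k - s y k|) ->
  (forall x i j, U x -> `|(L x *m W - 1%:M) i j| <= (2 * n%:R)^-1) ->
  rare [set a : 'cV_N | exists2 x, U x & L x *m a = 0].
Proof.
move=> dn r0 c0 sr Lc LW a0 e e0.
have n0 : 0 < n%:R :> R by rewrite ltr0n (leq_ltn_trans _ dn).
have [[x0 Ux0]|U0] := pselect (exists x, U x); last first.
  by exists a0, e; split=> // a ae; split=> // -[x Ux _]; apply: U0; exists x.
pose B := `|L x0| + c * (d%:R * (2 * r)).
have B0 : 0 <= B by rewrite addr_ge0 // !mulr_ge0 // ltW.
have LB x i j : U x -> `|L x i j| <= B.
  move=> Ux; rewrite -[L x i j](subrK (L x0 i j)) addrC; apply: le_trans (ler_normD _ _) _.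
  apply: lerD; first exact: mx_entry_le.
  apply: le_trans (Lc _ _ _ _ Ux Ux0) _; apply: ler_wpM2l => //.
  rewrite mulr_natl -[d in leRHS]card_ord -sumr_const; apply: ler_sum => k _.
  by apply: le_trans (ler_normB _ _) _; rewrite mulr_natl mulr2n lerD ?sr.
pose w := `|W|; have w0 : 0 <= w by exact: normr_ge0.
(* The entries of T k are at most 1, so this scale keeps every grid point [ak k] within e / 2 of
   a0. *)
pose eps := e / (2 * (n%:R * w + 1)).
have nw0 : 0 < n%:R * w + 1 by rewrite ltr_wpDl // mulr_ge0 // ltW.
have eps0 : 0 < eps by rewrite divr_gt0 // mulr_gt0.
pose A := `|a0| + e; have A0 : 0 < A by rewrite ltr_wpDl.
(* Obtained by solving eps m / 2 <= 2 eta + N c sig A for m and bounding the right side by (N c A +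
   2) (sig + eta). *)
pose K := 2 / eps * (N%:R * (c * A) + 2).
have K0 : 0 <= K.
  by rewrite mulr_ge0 ?divr_ge0 ?addr_ge0 ?mulr_ge0 // ltW.
have [M [M0 [eta eta0 HM]]] := close_pair dn r0 K0.
have MR : 0 < M%:R :> R by rewrite ltr0n.
pose T (k : {ffun 'I_n -> 'I_M}) : 'cV[R]_n := \col_i ((k i)%:R / M%:R).
have T01 k i j : `|T k i j| <= 1.
  by rewrite mxE ger0_norm ?divr_ge0 // ler_pdivrMr // mul1r ler_nat ltnW.
pose ak k := a0 + eps *: (W *m T k).
have akd k : `|ak k - a0| <= e / 2.
  rewrite /ak addrC addKr; apply: mx_norm_le; first by rewrite divr_ge0 // ltW.
  move=> i j; rewrite mxE normrM (ger0_norm (ltW eps0)).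
  have := @mulmx_entry_le R _ _ _ W (T k) w 1 i j w0 (fun j => mx_entry_le _ _ _) (fun j' => T01 k j' j).
  rewrite mulr1 => h; apply: le_trans (ler_wpM2l (ltW eps0) h) _.
  rewrite /eps [leLHS](_ : _ = e / 2 * (n%:R * w / (n%:R * w + 1))); last by field; rewrite gt_eqF.
  by rewrite ler_piMr ?divr_ge0 ?(ltW e0) // ler_pdivrMr // mul1r lerDl.
have akA k i j : `|ak k i j| <= A.
  apply: le_trans (mx_entry_le _ _ _) _; rewrite -[ak k](subrK a0) addrC.
  apply: le_trans (ler_normD _ _) _; rewrite lerD2l; apply: le_trans (akd k) _.
  by rewrite ler_pdivrMr // ler_peMr ?(ltW e0) // ler1n.
have [k Hk] : exists k, forall x, U x -> exists i, eta < `|(L x *m ak k) i ord0|.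
  apply: contrapT => H.
  have ex k : exists x, U x /\ forall i, `|(L x *m ak k) i ord0| <= eta.
    apply: contrapT => H2; apply: H; exists k => x Ux; apply: contrapT => H3; apply: H2.
    exists x; split=> // i; rewrite leNgt; apply/negP => h; apply: H3; by exists i.
  have [xk xkP] := choice ex.
  have [k [k' [kk' close]]] := HM (fun k => s (xk k)) (fun k i => sr _ _ (xkP k).1).
  have [Ux hx] := xkP k; have [Uy hy] := xkP k'.
  set x := xk k in Ux hx close; set y := xk k' in Uy hy close.
  set sig := \sum_i _ in close.
  have sig0 : 0 <= sig by apply: sumr_ge0 => i _.
  pose tau := T k - T k'.
  have [i0 hi0] : exists i0, forall i, `|tau i ord0| <= `|tau i0 ord0|.
    have i1 : 'I_n by exists 0%N; exact: leq_ltn_trans dn.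
    by have [i _ Hi] := @arg_maxP _ _ _ i1 predT (fun i => `|tau i ord0|) isT; exists i => j; exact: Hi.
  set m := `|tau i0 ord0| in hi0.
  have Mm : M%:R^-1 <= m.
    have [i ki] : exists i, k i != k' i.
      by apply/existsP; apply: contraNT kk' => /existsPn H4; apply/eqP/ffunP => i; apply/eqP/negPn/H4.
    apply: le_trans (hi0 i); rewrite !mxE -mulrBl normrM (ger0_norm (_ : 0 <= M%:R^-1)) ?invr_ge0 //.
    rewrite ler_peMl ?invr_ge0 //.
    have : (k i : nat) != k' i by [].
    rewrite neq_ltn => /orP[] lt; [rewrite distrC|]; rewrite -natrB ?(ltnW lt) // normr_nat ler1n subn_gt0 //.
  (* The first two terms have entries of size at most eta by the choice of x and y; the third is
     controlled by the Lipschitz condition. *)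
  have E : eps *: (L x *m (W *m tau)) = L x *m ak k - L y *m ak k' + (L y - L x) *m ak k'.
    rewrite mulmxBl addrA subrK /ak !mulmxDr.
    rewrite opprD addrACA subrr add0r -!scalemxAr -scalerBr; congr (_ *: _).
    by rewrite !mulmxN.
  have up : eps * `|(L x *m (W *m tau)) i0 ord0| <= 2 * eta + N%:R * (c * sig * A).
    rewrite -(gtr0_norm eps0) -normrM.
    have -> : eps * (L x *m (W *m tau)) i0 ord0 = (eps *: (L x *m (W *m tau))) i0 ord0 by rewrite [RHS]mxE.
    rewrite E mxE; apply: le_trans (ler_normD _ _) _; apply: lerD.
      rewrite mxE [X in `|_ + X|]mxE; apply: le_trans (ler_normB _ _) _.
      by rewrite mulr_natl mulr2n lerD.
    apply: mulmx_entry_le; first by rewrite mulr_ge0.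
      by move=> j; rewrite mxE [X in _ + X]mxE distrC; exact: Lc.
    by move=> j; exact: akA.
  (* i0 is an entry where tau is largest, so the error (L x W - 1) tau is there at most n (2 n)^-1
     m. *)
  have lo : m / 2 <= `|(L x *m (W *m tau)) i0 ord0|.
    have -> : L x *m (W *m tau) = tau + (L x *m W - 1%:M) *m tau.
      by rewrite mulmxBl mul1mx mulmxA addrC subrK.
    rewrite mxE; have h : `|((L x *m W - 1%:M) *m tau) i0 ord0| <= m / 2.
      have := @mulmx_entry_le R _ _ _ (L x *m W - 1%:M) tau (2 * n%:R)^-1 m i0 ord0.
      rewrite invr_ge0 mulr_ge0 ?(ltW n0) // => /(_ isT (fun j => LW _ _ _ Ux) hi0) /le_trans; apply.
      by rewrite le_eqVlt; apply/orP; left; apply/eqP; field; rewrite gt_eqF.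
    have := lerB_normD (tau i0 ord0) (((L x *m W - 1%:M) *m tau) i0 ord0).
    by rewrite -/m; clear -h; lra.
  have fin : m <= K * (sig + eta).
    have h1 : eps * (m / 2) <= 2 * eta + N%:R * (c * sig * A).
      by apply: le_trans up; rewrite ler_pM2l.
    have -> : m = (2 / eps) * (eps * (m / 2)) by field; rewrite gt_eqF.
    have p2e : 0 < 2 / eps by apply: divr_gt0.
    rewrite /K -(mulrA (2 / eps)) (ler_pM2l p2e); apply: le_trans h1 _.
    have q1 : 0 <= N%:R * (c * A) * eta by rewrite !mulr_ge0 // ltW.
    have q2 : 0 <= 2 * sig by rewrite mulr_ge0.
    rewrite [leRHS](_ : _ = 2 * eta + N%:R * (c * sig * A) + (N%:R * (c * A) * eta + 2 * sig)); last by ring.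
    by rewrite lerDl addr_ge0.
  by have := lt_le_trans (le_lt_trans fin close) Mm; rewrite ltxx.
(* The entries of L x are bounded by B on U, so moving a by less than e1 changes L x a by at most
   eta and cannot make it vanish. *)
exists (ak k); pose e1 := Num.min (e / 2) (eta / (N%:R * B + 1)).
have NB : 0 < N%:R * B + 1 by rewrite ltr_wpDl // mulr_ge0.
exists e1; split; first by rewrite lt_min !divr_gt0.
move=> a; rewrite lt_min => /andP[h1 h2]; split.
  rewrite -[a](subrK (ak k)) -addrA; apply: le_lt_trans (ler_normD _ _) _.
  by rewrite (splitr e); apply: ltr_leD => //; exact: akd.
move=> [x Ux La]; case: (Hk x Ux) => i; apply/negP; rewrite -leNgt.
have -> : L x *m ak k = - (L x *m (a - ak k)) by rewrite mulmxBr La sub0r opprK.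
rewrite mxE normrN.
apply: le_trans (@mulmx_entry_le R _ _ _ (L x) (a - ak k) B `|a - ak k| i ord0 B0 (fun j => LB _ _ _ Ux) (fun j => mx_entry_le _ _ _)) _.
move: h2; rewrite ltr_pdivlMr // => /ltW; apply: le_trans.
by rewrite mulrDr mulr1 mulrA mulrC lerDl.
Qed.

(** A right inverse of L x0 remains an approximate right inverse of L x for x near x0, which is what
    [rare_local] asks for. *)
Lemma rare_near N (X : topologicalType) (x0 : X) d n (L : X -> 'M[R]_(n, N))
    (s : X -> 'I_d -> R) (c : R) (U0 : set X) : (d < n)%N -> nbhs x0 U0 ->
  (forall k, {for x0, continuous (fun x => s x k)}) ->
  (forall x y i j, U0 x -> U0 y -> `|L x i j - L y i j| <= c * \sum_k `|s x k - s y k|) ->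
  row_free (L x0) ->
  exists2 U, nbhs x0 U & rare [set a : 'cV_N | exists2 x, U x & L x *m a = 0].
Proof.
move=> dn nU0 cs Lc /row_freeP[W LW].
have n0 : 0 < n%:R :> R by rewrite ltr0n (leq_ltn_trans _ dn).
pose c' := Num.max c 0.
have c'0 : 0 <= c' by rewrite le_max lexx orbT.
have Lc' x y i j : U0 x -> U0 y -> `|L x i j - L y i j| <= c' * \sum_k `|s x k - s y k|.
  move=> Ux Uy; apply: le_trans (Lc _ _ _ _ Ux Uy) _.
  by apply: ler_wpM2r; [exact: sumr_ge0|rewrite le_max lexx].
(* With parameters within 1 / Q of those of x0, the error is (2 n)^-1 times (Q - 1) / Q. *)
pose Q := N%:R * (c' * d%:R * `|W|) * (2 * n%:R) + 1.
have Q0 : 0 < Q by rewrite ltr_wpDl // !mulr_ge0 // ltW.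
pose U := [set x | U0 x /\ forall k, `|s x k - s x0 k| <= Q^-1].
have nU : nbhs x0 U.
  have nk k : nbhs x0 [set x | `|s x k - s x0 k| <= Q^-1].
    apply: (cs k [set y | `|y - s x0 k| <= Q^-1]); apply/nbhsR; exists Q^-1.
      by rewrite invr_gt0.
    by move=> y /ltW.
  by apply: filterI => //; apply: filter_forall; exact: nk.
exists U => //.
pose r := \sum_k `|s x0 k| + Q^-1.
have r0 : 0 < r by rewrite ltr_wpDl ?invr_gt0 // sumr_ge0.
apply: (@rare_local N X U d n L s W c' r) => //.
- move=> x i [_ /(_ i) h]; rewrite -[s x i](subrK (s x0 i)) addrC.
  apply: le_trans (ler_normD _ _) _; apply: lerD h.
  by rewrite (bigD1 i) //= lerDl sumr_ge0.
- by move=> x y i j [Ux _] [Uy _]; exact: Lc'.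
move=> x i j [Ux sx]; rewrite -LW -mulmxBl.
have h : forall k, `|(L x - L x0) i k| <= c' * (d%:R * Q^-1).
  move=> k; rewrite mxE [X in _ + X]mxE; apply: le_trans (Lc' _ _ _ _ Ux (nbhs_singleton nU0)) _.
  apply: ler_wpM2l => //; rewrite mulr_natl -[d in leRHS]card_ord -sumr_const.
  by apply: ler_sum => l _; exact: sx.
have p0 : 0 <= c' * (d%:R * Q^-1) by rewrite !mulr_ge0 // invr_ge0 ltW.
apply: le_trans (@mulmx_entry_le R _ _ _ (L x - L x0) W _ `|W| i j p0 h (fun k => mx_entry_le _ _ _)) _.
rewrite -[leRHS]mul1r ler_pdivlMr ?mulr_gt0 //.
have -> : N%:R * (c' * (d%:R / Q) * `|W|) * (2 * n%:R) = (Q - 1) / Q.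
  by rewrite /Q addrK; field; rewrite gt_eqF.
by rewrite ler_pdivrMr // mul1r gerBl.
Qed.

End Rare.

(** * Smooth functions on a Riemann surface *)

Section CompHol.
Variable R : realType.
Local Notation C := (R[i]).
Local Notation Co := (R[i]^o).
Local Notation Re := (@complex.Re R).
Local Notation Im := (@complex.Im R).

Definition ofC (z : C) : R * R := (Re z, Im z).

Lemma ofCK z : toC (ofC z) = z. Proof. by case: z. Qed.
Lemma toCK p : ofC (toC p) = p. Proof. by case: p. Qed.

Lemma derive_comp_hol (F : R * R -> R) (tau : Co -> Co) p l v :
  cder tau (toC p) l -> differentiable F (ofC (tau (toC p))) ->
  differentiable (fun q => F (ofC (tau (toC q)))) p /\
  'D_v (fun q => F (ofC (tau (toC q)))) p = 'D_(ofC (l * toC v)) F (ofC (tau (toC p))).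
Proof.
move=> dt dF.
have [d1 D1] := diff_Re_hol dt.
have dti : cder (fun z => - 'i%C * tau z) (toC p) (- 'i%C * l) by exact: cderMl.
have [d2 D2] := diff_Re_hol dti.
have E2 : (fun q => Re (- 'i%C * tau (toC q))) = (fun q => Im (tau (toC q))).
  by apply/funext => q; rewrite mulNr ReN ReM /= mul0r mul1r sub0r opprK.
rewrite E2 in d2 D2.
have dp : differentiable (fun q => ofC (tau (toC q))) p by exact: differentiable_pair.
have dc : differentiable (F \o (fun q => ofC (tau (toC q)))) p by exact: differentiable_comp.
split; first exact: dc.
rewrite (deriveE _ dc) diff_comp // /= [RHS]deriveE //; congr ('d F _ _).
rewrite (@diff_pair _ _ _ _ (fun q => Re (tau (toC q))) (fun q => Im (tau (toC q)))) //=.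
rewrite -!deriveE // D1 D2 /ofC; congr (_, _).
by rewrite mulNr mulNr ReN -mulrA ReM /= mul0r mul1r sub0r opprK.
Qed.

(** The derivative along v combines the partial derivatives of F, composed with tau, with the
    coefficients Re (tau' v) and Im (tau' v). The former are C^k by induction, the latter because
    tau' is holomorphic. *)
Lemma Ck_comp_hol k (V W : set Co) (F : R * R -> R) (tau : Co -> Co) : open V ->
  holomorphic_on V tau -> (forall z, V z -> W (tau z)) ->
  Ck_on k [set p | W (toC p)] F -> Ck_on k [set p | V (toC p)] (fun q => F (ofC (tau (toC q)))).
Proof.
move=> oV ht VW; elim: k F => [|k IH] F cF.
  move=> p Vp.
  have [d1 _] := diff_Re_hol (derivable_cder (ht _ Vp)).
  have dti : cder (fun z => - 'i%C * tau z) (toC p) (- 'i%C * 'D_1 tau (toC p)).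
    by apply: cderMl; exact: derivable_cder (ht _ Vp).
  have [d2 _] := diff_Re_hol dti.
  have E2 : (fun q => Re (- 'i%C * tau (toC q))) = (fun q => Im (tau (toC q))).
    by apply/funext => q; rewrite mulNr ReN ReM /= mul0r mul1r sub0r opprK.
  rewrite E2 in d2.
  apply: (@continuous_comp _ _ _ (fun q => ofC (tau (toC q))) F).
    apply: differentiable_continuous; exact: differentiable_pair.
  by apply: cF; rewrite /= ofCK; exact: VW.
case: cF => dF cF; split=> [p Vp|v].
  have [] // := @derive_comp_hol F tau p _ 0 (derivable_cder (ht _ Vp)) _.
  by apply: dF; rewrite /= ofCK; exact: VW.
have hv : holomorphic_on V (fun z => 'D_1 tau z * toC v).
  move=> z Vz; apply: cder_derivable; apply: cderM; last exact: cder_cst.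
  exact: derivable_cder (holomorphic_derive oV ht Vz).
have oV' := open_toC oV.
have h1 := CkM oV' (@Ck_Re_hol R k V _ oV hv) (IH _ (cF (1, 0))).
have h2 := CkM oV' (@Ck_Im_hol R k V _ oV hv) (IH _ (cF (0, 1))).
apply: (Ck_ext oV' _ (CkD oV' h1 h2)) => q Vq.
have dFq : differentiable F (ofC (tau (toC q))) by apply: dF; rewrite /= ofCK; exact: VW.
have [_ ->] := @derive_comp_hol F tau q _ v (derivable_cder (ht _ Vq)) dFq.
rewrite !fctE !(deriveE _ dFq).
set w := 'D_1 tau (toC q) * toC v; set L := 'd F _.
have -> : ofC w = Re w *: ((1, 0) : R * R) + Im w *: ((0, 1) : R * R).
  by rewrite /ofC; congr (_, _); rewrite /= ?[_ *: (1 : R)]mulr1 ?scaler0 ?addr0 ?add0r //.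
by rewrite linearD !linearZ.
Qed.

End CompHol.

Section Surface.
Variables (R : realType) (S : riemannSurface R).
Local Notation C := (R[i]).
Local Notation Co := (R[i]^o).
Local Notation Re := (@complex.Re R).
Local Notation Im := (@complex.Im R).
Local Notation coord := Defs.coord.
Implicit Types (c d : chart R S) (f g : S -> R) (h : S -> S).

(* [f] read in the real coordinates of the chart [c]. *)
Definition loc f c : R * R -> R := fun p => f (param c (toC p)).

Definition Sm f := forall c, atlas c -> smooth_on (real_img c) (loc f c).

Lemma open_real_img c : open (real_img c).
Proof. exact: (open_toC (@open_img _ _ c)). Qed.
Arguments open_real_img c : clear implicits.

Lemma SmM f g : Sm f -> Sm g -> Sm (fun x => f x * g x).
Proof. by move=> sf sg c ac k; exact: CkM (open_real_img c) (sf c ac k) (sg c ac k). Qed.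

Lemma SmD f g : Sm f -> Sm g -> Sm (fun x => f x + g x).
Proof. by move=> sf sg c ac k; exact: CkD (open_real_img c) (sf c ac k) (sg c ac k). Qed.

Lemma Sm_cst (a : R) : Sm (fun=> a).
Proof. by move=> c ac k; exact: Ck_cst. Qed.

Lemma Sm_sum (I : Type) (r : seq I) (F : I -> S -> R) : (forall i, Sm (F i)) ->
  Sm (fun x => \sum_(i <- r) F i x).
Proof.
move=> sF; elim: r => [|i r IH].
  by have -> : (fun x => \sum_(i <- [::]) F i x) = fun=> 0;
    [apply/funext => x; rewrite big_nil|exact: Sm_cst].
have -> : (fun x => \sum_(j <- i :: r) F j x) = fun x => F i x + \sum_(j <- r) F j x.
  by apply/funext => x; rewrite big_cons.
exact: SmD.
Qed.

Lemma Sm_prod (I : Type) (r : seq I) (F : I -> S -> R) : (forall i, Sm (F i)) ->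
  Sm (fun x => \prod_(i <- r) F i x).
Proof.
move=> sF; elim: r => [|i r IH].
  by have -> : (fun x => \prod_(i <- [::]) F i x) = fun=> 1;
    [apply/funext => x; rewrite big_nil|exact: Sm_cst].
have -> : (fun x => \prod_(j <- i :: r) F j x) = fun x => F i x * \prod_(j <- r) F j x.
  by apply/funext => x; rewrite big_cons.
exact: SmM.
Qed.

Lemma holomorphic_id : holomorphic_map (@id S).
Proof. by split; [move=> x|exact: atlas_compatible]. Qed.

(** With h = id this is the change of charts, so the same chain rule serves for automorphisms and
    for coordinates. *)
Definition trans c d h : Co -> Co := coord d \o h \o param c.

Definition trans_dom c d h : set Co := img c `&` (h \o param c) @^-1` dom d.

Lemma open_preim c (h : S -> S) (A : set S) : continuous h -> open A ->
  open (img c `&` (h \o param c) @^-1` A).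
Proof.
move=> ch oA; rewrite openE => z [cz Az].
have cp : {for z, continuous (h \o param c)}.
  by apply: continuous_comp; [exact: param_continuous|exact: ch].
apply: filterI; first exact: open_nbhs_nbhs (conj (@open_img _ _ c) cz).
by apply: cp; exact: open_nbhs_nbhs (conj oA Az).
Qed.

Lemma open_trans_dom c d h : holomorphic_map h -> open (trans_dom c d h).
Proof. by move=> [ch _]; apply: open_preim => //; exact: open_dom. Qed.
Arguments open_trans_dom c d h : clear implicits.

Lemma holomorphic_trans c d h : atlas c -> atlas d -> holomorphic_map h ->
  holomorphic_on (trans_dom c d h) (trans c d h).
Proof. by move=> ac ad [_ hh]; exact: hh. Qed.

Lemma trans_img c d h z : trans_dom c d h z -> img d (trans c d h z).
Proof. by move=> [_ hz]; exact: coord_img. Qed.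

Lemma transK c d h z : trans_dom c d h z -> param d (trans c d h z) = h (param c z).
Proof. by move=> [_ hz]; exact: coordK. Qed.

Lemma Sm_comp f h : Sm f -> holomorphic_map h -> Sm (f \o h).
Proof.
move=> sf hh c ac k; apply: Ck_local => p cp.
have [d ad dd] := atlas_cover (h (param c (toC p))).
have oV := open_trans_dom c d h hh.
exists [set q | trans_dom c d h (toC q)], (fun q => loc f d (ofC (trans c d h (toC q)))).
split.
- exact: open_toC.
- by split.
- apply: (@Ck_comp_hol R k _ (img d)) => //.
  + exact: holomorphic_trans.
  + by move=> z; exact: trans_img.
  + exact: sf.
- by move=> q Vq; rewrite /loc ofCK transK.
Qed.

Lemma Sm_diff f c p : Sm f -> atlas c -> real_img c p -> differentiable (loc f c) p.
Proof. by move=> sf ac cp; have [df _] := sf c ac 1%N; exact: df. Qed.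

Lemma derive_trans f c d h p l v : Sm f -> atlas c -> atlas d -> holomorphic_map h ->
  trans_dom c d h (toC p) -> cder (trans c d h) (toC p) l ->
  'D_v (loc (f \o h) c) p = 'D_(ofC (l * toC v)) (loc f d) (ofC (trans c d h (toC p))).
Proof.
move=> sf ac ad hh Vp dl.
have df : differentiable (loc f d) (ofC (trans c d h (toC p))).
  by apply: Sm_diff => //; rewrite /real_img /= -[(_ +i* _)%C]/(toC (ofC _)) ofCK; exact: trans_img.
have [_ <-] := derive_comp_hol v dl df.
apply: near_eq_derive.
have nV : \forall q \near p, trans_dom c d h (toC q).
  exact: open_nbhs_nbhs (conj (open_toC (open_trans_dom c d h hh)) Vp).
by apply: filterS nV => q Vq; rewrite /loc ofCK transK.
Qed.

Lemma Sm_continuous f : Sm f -> continuous f.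
Proof.
move=> sf x; have [c ac cx] := atlas_cover x.
have E : \forall y \near x, f y = loc f c (ofC (coord c y)).
  have := open_nbhs_nbhs (conj (@open_dom _ _ c) cx).
  by apply: filterS => y cy; rewrite /loc ofCK coordK.
have c1 : {for x, continuous (fun y => loc f c (ofC (coord c y)))}.
  apply: (@continuous_comp _ _ _ (fun y => ofC (coord c y)) (loc f c)).
    have cc := @Defs.coord_continuous _ _ c x cx.
    have h1 : {for x, continuous (fun y => Re (coord c y))}.
      exact: (@continuous_comp _ _ _ (coord c) Re x cc (@continuous_Re R _)).
    have h2 : {for x, continuous (fun y => Im (coord c y))}.
      exact: (@continuous_comp _ _ _ (coord c) Im x cc (@continuous_Im R _)).
    exact: cvg_pair h1 h2.
  have := sf c ac 0%N; apply; rewrite /real_img /= -[(_ +i* _)%C]/(toC (ofC _)) ofCK.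
  exact: coord_img.
move: c1; rewrite /prop_for /continuous_at -(nbhs_singleton E) => c1.
apply: cvg_trans c1; apply: near_eq_cvg; by apply: filterS E => y ->.
Qed.

End Surface.
Arguments open_real_img {R S} c.
Arguments open_trans_dom {R S} c d h.

(** * Finitely many global coordinates on a compact surface *)

Section Coordinates.
Variables (R : realType) (S : riemannSurface R).
Local Notation C := (R[i]).
Local Notation Co := (R[i]^o).
Local Notation Re := (@complex.Re R).
Local Notation Im := (@complex.Im R).
Local Notation coord := Defs.coord.
Implicit Types (c d : chart R S) (f g : S -> R) (h : S -> S).

Definition square (a b r : R) : set (R * R) := `[a - r, a + r]%classic `*` `[b - r, b + r]%classic.

(** The extension by 0 is smooth because S is Hausdorff: the image of the compact square is closed,
    and on its open complement the function is identically 0. *)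
Lemma Sm_cutoff c (F : R * R -> R) (a b r : R) : atlas c -> smooth_on setT F ->
  square a b r `<=` real_img c -> (forall p, ~ square a b r p -> F p = 0) ->
  Sm (fun x => if `[< dom c x >] then F (ofC (coord c x)) else 0).
Proof.
move=> ac sF Qc F0.
pose K := (fun p => param c (toC p)) @` square a b r.
have cK : closed K.
  apply: compact_closed; first exact: surface_hausdorff.
  apply: continuous_compact; last by apply: compact_setX; exact: segment_compact.
  apply: continuous_in_subspaceT => p; rewrite inE => /Qc cp.
  exact: (@continuous_comp _ _ _ (@toC R) (param c) p (@continuous_toC R p) (param_continuous cp)).
have Kdom x : K x -> dom c x.
  by move=> [p /Qc cp <-]; exact: param_dom.
move=> d ad k; apply: Ck_local => p dp.
have [cx|ncx] := pselect (dom c (param d (toC p))).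
  have oV := open_trans_dom d c id (holomorphic_id S).
  exists [set q | trans_dom d c id (toC q)], (fun q => F (ofC (trans d c id (toC q)))); split.
  - exact: open_toC.
  - by split.
  - apply: (@Ck_comp_hol R k _ setT) => //.
    by apply: holomorphic_trans => //; exact: holomorphic_id.
  - by move=> q [_ Vq]; rewrite /loc asboolT.
have oV := @open_preim R S d id (~` K) (fun x A => id) (closed_openC cK).
exists [set q | (img d `&` (id \o param d) @^-1` (~` K)) (toC q)], (cst 0); split.
- exact: open_toC.
- by split => // /Kdom.
- exact: Ck_cst.
- move=> q [dq nK] /=; rewrite /loc; case: ifPn => // /asboolP cq.
  rewrite F0 // => Qq; apply: nK; exists (ofC (coord c (param d (toC q)))) => //.
  by rewrite ofCK coordK.
Qed.

Lemma smooth_fst : smooth_on setT (fun p : R * R => p.1).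
Proof.
move=> k; have hid : holomorphic_on setT (@id Co).
  by move=> z _; exact: cder_derivable (cder_id z).
exact: (@Ck_Re_hol R k setT id openT hid).
Qed.

Lemma smooth_snd : smooth_on setT (fun p : R * R => p.2).
Proof.
move=> k; have hid : holomorphic_on setT (@id Co).
  by move=> z _; exact: cder_derivable (cder_id z).
exact: (@Ck_Im_hol R k setT id openT hid).
Qed.

Definition bump (a b r : R) (p : R * R) : R :=
  flat 0 (r ^+ 2 - (p.1 - a) ^+ 2 - (p.2 - b) ^+ 2).

Lemma smooth_bump a b r : smooth_on setT (bump a b r).
Proof.
move=> k; have sq (u : R * R -> R) (m : R) : Ck_on k setT u ->
    Ck_on k setT (cst (-1) * ((u + cst (- m)) * (u + cst (- m)))).
  move=> cu; have h := CkD openT cu (Ck_cst k setT (- m)).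
  exact: CkM openT (Ck_cst k setT (-1 : R)) (CkM openT h h).
have h := CkD openT (CkD openT (Ck_cst k setT (r ^+ 2)) (sq _ a (smooth_fst k))) (sq _ b (smooth_snd k)).
apply: (Ck_ext openT _ (Ck_flat 0 openT h)) => p _.
by rewrite /bump /=; congr flat; rewrite !fctE /= !mulN1r !expr2.
Qed.

Lemma bump_out a b r p : 0 < r -> ~ square a b r p -> bump a b r p = 0.
Proof.
move=> r0 np; apply: flat_npos; rewrite leNgt; apply/negP => h; apply: np.
have h1 : (p.1 - a) ^+ 2 <= r ^+ 2 by have := sqr_ge0 (p.2 - b); lra.
have h2 : (p.2 - b) ^+ 2 <= r ^+ 2 by have := sqr_ge0 (p.1 - a); lra.
have sq (u : R) : u ^+ 2 <= r ^+ 2 -> - r <= u <= r.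
  by rewrite -ler_norml -[u ^+ 2]real_normK ?num_real // ler_pXn2r // ?nnegrE // ltW.
have := sq _ h1; have := sq _ h2; case: p {h h1 h2} => x y /= h1 h2.
by split; rewrite /= in_itv /=; [clear -h2|clear -h1]; lra.
Qed.

Lemma bump_center a b r : 0 < r -> 0 < bump a b r (a, b).
Proof.
by move=> r0; apply: flat_pos; rewrite /= !subrr expr0n /= !subr0 exprn_gt0.
Qed.

(* Multiplying by a bump function b makes a chart coordinate globally smooth, and the
   coordinate is recovered as a quotient by b where b <> 0. *)
Lemma local_coordinates (x0 : S) : exists (c : chart R S) (b u v : S -> R),
  [/\ atlas c, [/\ Sm b, Sm u & Sm v], b x0 != 0 &
  forall x, b x != 0 -> [/\ dom c x, u x = b x * Re (coord c x) & v x = b x * Im (coord c x)]].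
Proof.
have [c ac cx] := atlas_cover x0.
set z0 := coord c x0; pose a := Re z0; pose b := Im z0.
have nz : nbhs z0 (img c) by exact: open_nbhs_nbhs (conj (@open_img _ _ c) (coord_img cx)).
have /nbhsC[d d0 Hd] := nz.
pose r := d / 4; have r0 : 0 < r by rewrite divr_gt0.
have Qc : square a b r `<=` real_img c.
  move=> [x y] [/=]; rewrite !in_itv /= => hx hy; apply: Hd.
  have hp : `|x - a| <= r by rewrite ler_norml; clear -hx; lra.
  have hq : `|y - b| <= r by rewrite ler_norml; clear -hy; lra.
  have -> : z0 = (a +i* b)%C by rewrite /a /b; case: (z0).
  by apply: le_lt_trans (normc_ReIm_lt hp hq) _; rewrite /r; clear -d0; lra.
pose B := bump a b r.
have B0 p : ~ square a b r p -> B p = 0 by exact: bump_out.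
have s1 := Sm_cutoff ac (@smooth_bump a b r) Qc B0.
have s2 := @Sm_cutoff c (B * (fun p => p.1)) a b r ac
  (fun k => CkM openT (@smooth_bump a b r k) (smooth_fst k)) Qc
  (fun p np => etrans (congr1 ( *%R^~ p.1) (B0 p np)) (mul0r _)).
have s3 := @Sm_cutoff c (B * (fun p => p.2)) a b r ac
  (fun k => CkM openT (@smooth_bump a b r k) (smooth_snd k)) Qc
  (fun p np => etrans (congr1 ( *%R^~ p.2) (B0 p np)) (mul0r _)).
exists c; do 3 eexists; split; [exact: ac|split; [exact: s1|exact: s2|exact: s3]| |].
  by rewrite /= asboolT // gt_eqF //; exact: bump_center.
by move=> x /=; case: asboolP => [cxx|]; rewrite ?eqxx.
Qed.

(** Finitely many of the open sets b != 0 cover S. Over each of them b, b Re z and b Im z determine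
    the chart coordinate z as a quotient, and dz by the product rule. *)
Lemma finite_coordinates : closed_surface S -> exists (I : finType) (i0 : I) (u : I -> S -> R),
  [/\ forall i, Sm (u i), u i0 = (fun=> 1),
      forall x y, x <> y -> exists i, u i x != u i y
    & forall x c v, atlas c -> dom c x -> v != 0 ->
        exists i, 'D_v (loc (u i) c) (ofC (coord c x)) != 0].
Proof.
move=> cS.
have [c Hc] := choice local_coordinates.
have [b Hb] := choice Hc; have [u Hu] := choice Hb; have [v Hv] := choice Hu.
have [s Hs] : exists s : seq S, forall x, exists2 i, (i < size s)%N & b (nth x s i) x != 0.
  suff : exists s : seq S, forall x, [set: S] x -> exists2 i, (i < size s)%N & b (nth x s i) x != 0.
    by move=> [s Hs]; exists s => x; exact: Hs.
  apply: (compact_ind cS (P := fun A => exists s : seq S, forall x, A x ->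
    exists2 i, (i < size s)%N & b (nth x s i) x != 0)).
  - by exists [::].
  - move=> A B [s1 H1] [s2 H2]; exists (s1 ++ s2) => x [Ax|Bx].
      have [i is1 bi] := H1 x Ax; exists i; first by rewrite size_cat ltn_addr.
      by rewrite nth_cat is1.
    have [i is2 bi] := H2 x Bx; exists (size s1 + i)%N; first by rewrite size_cat ltn_add2l.
    by rewrite nth_cat ltnNge leq_addr /= addKn.
  - by move=> A B AB [s Hs]; exists s => x /AB; exact: Hs.
  move=> x _; exists [set y | b x y != 0]; last by exists [:: x] => y yx; exists 0%N.
  have [_ [sb _ _] bx _] := Hv x.
  have := @Sm_continuous _ _ _ sb x [set t : R | t != 0]; apply.
  apply/nbhsR; exists `|b x x|; rewrite ?normr_gt0 //.
  by move=> t; apply: contraTneq => /= ->; rewrite sub0r normrN ltxx.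
have [x0 _] := @surface_nonempty _ S.
(* [None] indexes the constant 1; the indices 0, 1, 2 stand for the bump function and its products
   with the two coordinates. *)
pose U (i : option ('I_(size s) * 'I_3)) : S -> R :=
  if i is Some (k, j) then
    (if j == 0 :> nat then b (nth x0 s k) else if j == 1 :> nat then u (nth x0 s k) else v (nth x0 s k))
  else fun=> 1.
have nthE x k : (k < size s)%N -> nth x s k = nth x0 s k by exact: set_nth_default.
exists (option ('I_(size s) * 'I_3)), None, U; split => //.
- move=> [[k j]|] /=; last exact: Sm_cst.
  by have [_ [h1 h2 h3] _ _] := Hv (nth x0 s k); case: ifP => // _; case: ifP.
- move=> x y xy; apply: contrapT => H; apply: xy.
  have E i : U i x = U i y by apply: contrapT => h; apply: H; exists i; apply/eqP.
  have [k ks] := Hs x; rewrite nthE // => bx.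
  have [_ _ _ Hk] := Hv (nth x0 s k).
  have := E (Some (Ordinal ks, Ordinal (isT : (0 < 3)%N))) => /= Eb.
  have := E (Some (Ordinal ks, Ordinal (isT : (1 < 3)%N))) => /= Eu.
  have := E (Some (Ordinal ks, Ordinal (isT : (2 < 3)%N))) => /= Ev.
  have [dx ux vx] := Hk x bx; have [dy uy vy] := Hk y ltac:(by rewrite -Eb).
  rewrite -(coordK dx) -(coordK dy); congr param.
  move: Eu Ev; rewrite ux uy vx vy -Eb => /(mulfI bx) e1 /(mulfI bx) e2.
  by apply/eqP; rewrite eq_complex e1 e2 !eqxx.
- move=> x d w ad dx w0; apply: contrapT => H.
  have E i : 'D_w (loc (U i) d) (ofC (coord d x)) = 0.
    by apply: contrapT => h; apply: H; exists i; apply/eqP.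
  have [k ks] := Hs x; rewrite nthE // => bx.
  have [ac [sb su sv] _ Hk] := Hv (nth x0 s k).
  have Eb := E (Some (Ordinal ks, Ordinal (isT : (0 < 3)%N))); rewrite /= in Eb.
  have Eu := E (Some (Ordinal ks, Ordinal (isT : (1 < 3)%N))); rewrite /= in Eu.
  have Ev := E (Some (Ordinal ks, Ordinal (isT : (2 < 3)%N))); rewrite /= in Ev.
  set y := nth x0 s k in ac sb su sv Hk Eb Eu Ev bx.
  have [cx _ _] := Hk x bx.
  have pxd : param d (toC (ofC (coord d x))) = x by rewrite ofCK coordK.
  have rd : real_img d (ofC (coord d x)).
    by rewrite /real_img /= -[(_ +i* _)%C]/(toC (ofC _)) ofCK; exact: coord_img.
  pose tau := trans d (c y) id.
  have hid := holomorphic_id S.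
  have V0 : trans_dom d (c y) id (toC (ofC (coord d x))).
    by split; rewrite /= ?pxd // ofCK; exact: coord_img.
  have [l dtau] : exists l, cder tau (toC (ofC (coord d x))) l.
    by eexists; exact: derivable_cder (holomorphic_trans ad ac hid V0).
  have V1 : trans_dom (c y) d id (coord (c y) x).
    by split; rewrite /= ?coordK //; exact: coord_img.
  have tx : tau (toC (ofC (coord d x))) = coord (c y) x by rewrite /tau /trans /= pxd.
  have dsig := derivable_cder (holomorphic_trans ac ad hid V1).
  rewrite -tx in dsig; have dcomp := cder_comp dtau dsig.
  (* The change of charts has an inverse, so by the chain rule its derivative has one too. *)
  have l0 : l != 0.
    have h1 : cder (trans (c y) d id \o tau) (toC (ofC (coord d x))) 1.
      apply: (@cder_near R id) (cder_id _).
      have := open_nbhs_nbhs (conj (open_trans_dom d (c y) id hid) V0).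
      apply: filterS => z [dz cz] /=; rewrite /tau /trans /= coordK // paramK //.
    have E1 := cder_unique dcomp h1.
    by apply/eqP => l00; move: E1; rewrite l00 mulr0 => /esym/eqP; rewrite oner_eq0.
  have nb : \forall q \near ofC (coord d x), loc (b y) d q != 0.
    have cb := Sm_continuous sb.
    have cl : {for ofC (coord d x), continuous (loc (b y) d)}.
      by have := sb d ad 0%N; apply.
    apply: (cl [set t | t != 0]); apply/nbhsR; exists `|b y x|; rewrite ?normr_gt0 //.
    move=> t; rewrite /loc pxd; apply: contraTneq => /= ->; by rewrite sub0r normrN ltxx.
  have nV : \forall q \near ofC (coord d x), real_img d q.
    exact: open_nbhs_nbhs (conj (open_real_img d) rd).
  have [dRe DRe] := diff_Re_hol dtau.
  have dtau' : cder (fun z => - 'i%C * tau z) (toC (ofC (coord d x))) (- 'i%C * l) by exact: cderMl.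
  have [dIm DIm] := diff_Re_hol dtau'.
  have ImE z : Re (- 'i%C * z) = Im z by rewrite mulNr ReN ReM /= mul0r mul1r sub0r opprK.
  have db : derivable (loc (b y) d) (ofC (coord d x)) w by apply: diff_derivable; exact: Sm_diff.
  (* The bump function is nonzero at x and its derivative along w is 0, so the derivative of a
     product b T along w is b(x) times that of T. *)
  have key (g : S -> R) (T : R * R -> R) : (forall x, b y x != 0 -> g x = b y x * T (ofC (coord (c y) x))) ->
      forall T', T' = (fun q => T (ofC (tau (toC q)))) -> derivable T' (ofC (coord d x)) w ->
      'D_w (loc g d) (ofC (coord d x)) = 0 -> 'D_w T' (ofC (coord d x)) = 0.
    move=> gE T' TE dT g0.
    have E1 : \forall q \near ofC (coord d x), loc g d q = (loc (b y) d * T') q.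
      by apply: filterS nb => q bq; rewrite TE /loc gE.
    move: g0; rewrite (near_eq_derive _ E1) deriveM // Eb scaler0 addr0 => /eqP.
    by rewrite [_ *: _]/(_ * _) mulf_eq0 /loc pxd (negbTE bx) /= => /eqP.
  have k1 := key (u y) (fun p => p.1) (fun x bx => let: And3 _ h _ := Hk x bx in h) _ erefl
    (diff_derivable dRe) Eu.
  have k2 := key (v y) (fun p => p.2) (fun x bx => let: And3 _ _ h := Hk x bx in h)
    (fun q => Re (- 'i%C * tau (toC q))) ltac:(by apply/funext => q; rewrite ImE) (diff_derivable dIm) Ev.
  move: k1 k2; rewrite /= DRe DIm -mulrA ImE => k1 k2.
  have : l * toC w = 0 by apply/eqP; rewrite eq_complex k1 k2 /= eqxx.
  move=> /eqP; rewrite mulf_eq0 (negbTE l0) /= => /eqP w00.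
  by move: w0; rewrite -(toCK w) w00 eqxx.
Qed.

End Coordinates.

(** * Fixed points of automorphisms *)

Section FixedPoints.
Variables (R : realType) (S : riemannSurface R).
Local Notation C := (R[i]).
Local Notation Co := (R[i]^o).
Local Notation Re := (@complex.Re R).
Local Notation Im := (@complex.Im R).
Local Notation coord := Defs.coord.
Implicit Types (c d : chart R S) (h k : S -> S).

Lemma cder_sum n (f : 'I_n -> Co -> Co) (l : 'I_n -> C) z :
  (forall i, cder (f i) z (l i)) -> cder (fun w => \sum_i f i w) z (\sum_i l i).
Proof.
move=> H; apply/cderP.
have -> : (fun w => \sum_i f i w) = \sum_i f i by apply/funext => w; rewrite fct_sumE.
by apply: is_derive_sum => i; exact/cderP.
Qed.

Lemma trans_comp c d (e : chart R S) h k z : trans_dom c d h z ->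
  trans c e (k \o h) z = trans d e k (trans c d h z).
Proof. by move=> [cz dz]; rewrite /trans /= coordK. Qed.

Lemma cder_trans_comp c d (e : chart R S) h k z a b : holomorphic_map h ->
  trans_dom c d h z ->
  cder (trans c d h) z a -> cder (trans d e k) (trans c d h z) b ->
  cder (trans c e (k \o h)) z (b * a).
Proof.
move=> hh Vz da db; apply: cder_near (cder_comp da db).
have := open_nbhs_nbhs (conj (open_trans_dom c d h hh) Vz).
by apply: filterS => w Vw; rewrite (trans_comp _ _ Vw).
Qed.

Lemma holomorphic_comp h k : holomorphic_map h -> holomorphic_map k -> holomorphic_map (k \o h).
Proof.
move=> hh hk; split.
  by move=> x; apply: continuous_comp; [case: hh => + _; exact|case: hk => + _; exact].
move=> c e ac ae z [cz ez].
have [d ad dd] := atlas_cover (h (param c z)).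
have Vz : trans_dom c d h z by split.
have Wz : trans_dom d e k (trans c d h z).
  by split; [exact: trans_img|rewrite /= (transK Vz)].
have da := derivable_cder (holomorphic_trans ac ad hh Vz).
have db := derivable_cder (holomorphic_trans ad ae hk Wz).
exact: cder_derivable (cder_trans_comp hh Vz da db).
Qed.

Lemma holomorphic_iter h n : holomorphic_map h -> holomorphic_map (iter n h).
Proof.
move=> hh; elim: n => [|n IH]; first exact: holomorphic_id.
exact: (holomorphic_comp IH hh).
Qed.

Lemma trans_id c z : img c z -> trans c c id z = z.
Proof. by move=> cz; rewrite /trans /= paramK. Qed.

Lemma cder_trans_id c z : img c z -> cder (trans c c id) z 1.
Proof.
move=> cz; apply: (@cder_near R id) (cder_id _).
have := open_nbhs_nbhs (conj (@open_img _ _ c) cz).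
by apply: filterS => w cw; rewrite trans_id.
Qed.

Lemma fix_trans_dom c h x : dom c x -> h x = x -> trans_dom c c h (coord c x).
Proof. by move=> cx hx; split; rewrite /= ?coordK ?hx //; exact: coord_img. Qed.

Lemma fix_trans c h x : dom c x -> h x = x -> trans c c h (coord c x) = coord c x.
Proof. by move=> cx hx; rewrite /trans /= coordK ?hx. Qed.

Lemma cder_trans_iter c h x l n : atlas c -> holomorphic_map h -> dom c x -> h x = x ->
  cder (trans c c h) (coord c x) l -> cder (trans c c (iter n h)) (coord c x) (l ^+ n).
Proof.
move=> ac hh cx hx dl; elim: n => [|n IH].
  by rewrite expr0; apply: cder_trans_id; exact: coord_img.
have ix : iter n h x = x by elim: n {IH} => //= n ->.
rewrite exprS; apply: (@cder_trans_comp c c c (iter n h) h) IH _.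
- exact: holomorphic_iter.
- exact: fix_trans_dom.
- by rewrite fix_trans.
Qed.

Lemma coord_near c x (A : set Co) : dom c x -> nbhs (coord c x) A ->
  \forall y \near x, dom c y /\ A (coord c y).
Proof.
move=> cx nA; apply: filterI; first exact: open_nbhs_nbhs (conj (@open_dom _ _ c) cx).
exact: (Defs.coord_continuous cx nA).
Qed.

(** For a fixed point y the increment of h is that of the identity, so the remainder at y is (1 - l)
    (y - x); near x it is at most half of |1 - l| |y - x|. *)
Lemma fix_isolated_local c h x l : dom c x -> h x = x -> l != 1 ->
  cder (trans c c h) (coord c x) l -> \forall y \near x, h y = y -> y = x.
Proof.
move=> cx hx l1 dl.
have n0 : 0 < normc (1 - l) by rewrite normc_gt0 // subr_eq0 eq_sym.
have [d d0 Hd] := dl (normc (1 - l) / 2) (divr_gt0 n0 (ltr0Sn R 1)).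
have : nbhs (coord c x : Co) [set w | normc (w - coord c x) < d] by apply/nbhsC; exists d.
move=> /(coord_near cx); apply: filterS => y [cy /Hd]; rewrite (fix_trans cx hx) => Hy hy.
move: Hy; rewrite (fix_trans cy hy).
have -> : coord c y - coord c x - l * (coord c y - coord c x) = (1 - l) * (coord c y - coord c x).
  by ring.
rewrite normcM; have := normc_ge0 (coord c y - coord c x).
rewrite le_eqVlt => /orP[/eqP E _|p].
  have : coord c y = coord c x by apply/eqP; rewrite -subr_eq0 -normc_eq0 -E.
  by move=> /(congr1 (param c)); rewrite !coordK.
by rewrite ler_pM2r // => h1; exfalso; clear -h1 n0; lra.
Qed.

(* The mean of the m iterates of h is an h-invariant function with derivative 1 at the
   fixed point, hence locally injective. *)
Lemma periodic_id_local c h x m : atlas c -> holomorphic_map h -> dom c x -> h x = x ->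
  (0 < m)%N -> iter m h = id -> cder (trans c c h) (coord c x) 1 ->
  \forall y \near x, h y = y.
Proof.
move=> ac hh cx hx m0 hm d1; set z := coord c x in d1.
pose V := interior [set w : Co | forall j : 'I_m, trans_dom c c (iter j h) w].
have ix n : iter n h x = x by elim: n => //= n ->.
have nV : nbhs z [set w : Co | forall j : 'I_m, trans_dom c c (iter j h) w].
  have nj (j : 'I_m) : \forall w \near (z : Co), trans_dom c c (iter j h) w.
    apply: open_nbhs_nbhs; split; last exact: fix_trans_dom.
    by apply: open_trans_dom; exact: holomorphic_iter.
  exact: (filter_forall (nbhs_filter (z : Co)) nj).
have oV : open V by exact: open_interior.
have Vz : V z by exact: nV.
(* Subtracting m w from the sum of the iterates leaves a function with derivative 0 at z, hence with
   a small Lipschitz constant nearby. *)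
pose psi (w : Co) : Co := \sum_(j < m) trans c c (iter j h) w - m%:R * w.
have dpsi w l : (forall j : 'I_m, cder (trans c c (iter j h)) w (l j)) ->
    cder psi w (\sum_j l j - m%:R).
  move=> dj; have := cderB (cder_sum dj) (cderMl m%:R (cder_id w)).
  by rewrite mulr1.
have hpsi : holomorphic_on V psi.
  move=> w /interior_subset Vw; apply: cder_derivable; apply: dpsi => j.
  exact: derivable_cder (holomorphic_trans ac ac (holomorphic_iter j hh) (Vw j)).
have psi0 : cder psi z 0.
  have := @dpsi z (fun=> 1); rewrite sumr_const card_ord subrr; apply => j.
  by have := cder_trans_iter j ac hh cx hx d1; rewrite expr1n.
have E2 : (fun q => Re (- 'i%C * psi (toC q))) = (fun q => Im (psi (toC q))).
  by apply/funext => q; rewrite mulNr ReN ReM /= mul0r mul1r sub0r opprK.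
have psi0' : cder psi (toC (ofC z)) 0 by rewrite ofCK.
have psii : cder (fun z => - 'i%C * psi z) (toC (ofC z)) (- 'i%C * 0) by exact: cderMl.
have [_ D1] := diff_Re_hol psi0'.
have [_ D2] := diff_Re_hol psii; rewrite E2 in D2.
have Vz' : [set p | V (toC p)] (ofC z) by rewrite /= ofCK.
have mR : 0 < m%:R :> R by rewrite ltr0n.
(* Real and imaginary part are estimated separately, each by |Re| + |Im| <= 2 |w - w'|; four times m
   / 8 gives the constant m / 2 < m. *)
have m8 : 0 < m%:R / 8 :> R by rewrite divr_gt0.
have [r1 r10 L1] := @C1_lipschitz R _ _ (ofC z) (m%:R / 8) (open_toC oV) Vz'
  (@Ck_Re_hol R 1 V _ oV hpsi) ltac:(by rewrite D1 mul0r normr0) ltac:(by rewrite D1 mul0r normr0).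
have [r2 r20 L2] := @C1_lipschitz R _ _ (ofC z) (m%:R / 8) (open_toC oV) Vz'
  (@Ck_Im_hol R 1 V _ oV hpsi) ltac:(by rewrite D2 mulr0 mul0r normr0) ltac:(by rewrite D2 mulr0 mul0r normr0).
pose r := Num.min r1 r2; have r0 : 0 < r by rewrite lt_min r10.
have lip w w' : normc (w - z) < r -> normc (w' - z) < r ->
    normc (psi w - psi w') <= m%:R / 2 * normc (w - w').
  rewrite !lt_min => /andP[a1 a2] /andP[b1 b2].
  have R1 u s : normc (u - z) < s -> `|(ofC u).1 - (ofC z).1| < s.
    by move=> us; apply: le_lt_trans us; rewrite /= -ReB; exact: Re_le_normc.
  have I1 u s : normc (u - z) < s -> `|(ofC u).2 - (ofC z).2| < s.
    by move=> us; apply: le_lt_trans us; rewrite /= -ImB; exact: Im_le_normc.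
  have h1 := L1 (ofC w) (ofC w') (R1 _ _ a1) (I1 _ _ a1) (R1 _ _ b1) (I1 _ _ b1).
  have h2 := L2 (ofC w) (ofC w') (R1 _ _ a2) (I1 _ _ a2) (R1 _ _ b2) (I1 _ _ b2).
  apply: le_trans (normc_le_ReIm _) _; rewrite ReB ImB.
  rewrite !ofCK -!ReB -!ImB /= in h1 h2; rewrite -ReB -ImB.
  apply: le_trans (lerD h1 h2) _.
  have := Re_le_normc (w - w'); have := Im_le_normc (w - w'); rewrite ReB ImB => k1 k2.
  have -> : m%:R / 2 * normc (w - w') = m%:R / 8 * (normc (w - w') + normc (w - w')) +
     m%:R / 8 * (normc (w - w') + normc (w - w')) by field.
  by apply: lerD; rewrite ler_pM2l // lerD.
have ct : {for z, continuous (trans c c h)} := cder_continuous d1.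
have nT : nbhs z (trans_dom c c h).
  exact: open_nbhs_nbhs (conj (open_trans_dom c c h hh) (fix_trans_dom cx hx)).
have nr : nbhs z [set w : Co | normc (w - z) < r] by apply/nbhsC; exists r.
have nr' : nbhs z [set w : Co | normc (trans c c h w - z) < r].
  by apply: (ct [set w | normc (w - z) < r]); rewrite fix_trans.
have n3 : nbhs z (trans_dom c c h `&` ([set w : Co | normc (w - z) < r] `&`
    [set w : Co | normc (trans c c h w - z) < r])).
  by apply: filterI => //; exact: filterI.
apply: filterS (coord_near cx n3) => y [cy [Vy [ry ry']]].
set w := coord c y in Vy ry ry'.
have Tw : trans c c h w = w.
  (* As [iter m h] is the identity, composing with h permutes the m iterates cyclically. *)
  have phiE : \sum_(j < m) trans c c (iter j h) (trans c c h w) =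
      \sum_(j < m) trans c c (iter j h) w.
    have -> : \sum_(j < m) trans c c (iter j h) (trans c c h w) =
        \sum_(j < m) trans c c (iter j.+1 h) w.
      apply: eq_bigr => j _; rewrite -(trans_comp c (iter j h) Vy).
      by congr (trans c c _ w); apply/funext => s; rewrite /= -iterSr.
    case: m m0 hm {V nV oV Vz psi dpsi hpsi psi0 E2 psi0' psii D1 D2 Vz' mR m8 L1 L2 lip} => // m _ hm.
    rewrite big_ord_recr [RHS]big_ord_recl /= addrC; congr (_ + _).
    by rewrite hm.
  have := lip w (trans c c h w) ry ry'.
  have -> : psi w - psi (trans c c h w) = m%:R * (trans c c h w - w).
    by rewrite /psi phiE; ring.
  rewrite normcM normc_nat (normc_distC w).
  have := normc_ge0 (trans c c h w - w); rewrite le_eqVlt => /orP[/eqP E _|p].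
    by apply/eqP; rewrite -subr_eq0 -normc_eq0 -E.
  by rewrite ler_pM2r // => h1; exfalso; clear -h1 mR; lra.
by have := transK Vy; rewrite Tw /w !coordK.
Qed.

End FixedPoints.

(** * Finite groups: identity principle and finiteness of fixed points *)

Section Group.
Variables (R : realType) (S : riemannSurface R) (G : set (S -> S)).
Hypothesis GG : finite_automorphism_group G.
Local Notation coord := Defs.coord.
Implicit Types (c d : chart R S) (h k : S -> S).

Lemma G_holomorphic h : G h -> holomorphic_map h.
Proof. by case: GG => _ aG _ _ _ /aG []. Qed.

Lemma G_inj h : G h -> injective h.
Proof. by case: GG => _ aG _ _ _ /aG [_ [h' [_ hK _]]]; exact: can_inj hK. Qed.

Lemma G_iter h n : G h -> G (iter n h).
Proof.
case: GG => _ _ G1 GM _ Gh; elim: n => //= n IH; exact: (GM h (iter n h) Gh IH).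
Qed.

Lemma G_periodic h : G h -> exists2 m, (0 < m)%N & iter m h = id.
Proof.
move=> Gh; have fG : finite_set G by case: GG.
pose X := fset_set G.
have inX n : iter n h \in X by rewrite in_fset_set // inE; exact: G_iter.
pose f (i : 'I_(#|` X|).+1) : X := [` inX i]%fset.
have /injectiveP : ~ injective f.
  by move=> /leq_card; rewrite card_ord -cardfE ltnn.
move=> /injectivePn[i [j ij fij]].
have E : iter i h = iter j h by have := congr1 val fij.
have wl (a b : nat) : (a < b)%N -> iter a h = iter b h -> exists2 m, (0 < m)%N & iter m h = id.
  move=> ab Eab; exists (b - a)%N; first by rewrite subn_gt0.
  apply/funext => x; apply: (G_inj (G_iter a Gh)).
  by rewrite -iterD subnKC ?(ltnW ab) // Eab.
have : (i : nat) != j by [].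
by rewrite neq_ltn => /orP[] lt; [exact: wl lt E|exact: wl lt (esym E)].
Qed.

(** If h moves x, points near x are moved as well, by Hausdorff separation. If h fixes x, a
    multiplier other than 1 isolates x, and multiplier 1 together with finite order makes h the
    identity nearby. *)
Lemma fix_dichotomy h x : G h -> (\forall y \near x, h y = y) \/
  (\forall y \near x, h y = y -> y = x).
Proof.
move=> Gh; have hh := G_holomorphic Gh.
have [hx|hx] := eqVneq (h x) x; last first.
  right; have := @surface_hausdorff _ S; rewrite open_hausdorff => /(_ _ _ hx) [[A B] /= [hA xB] [oA oB AB]].
  have n1 : nbhs x B by apply: open_nbhs_nbhs; split=> //; rewrite inE in xB.
  have n2 : nbhs x (h @^-1` A).
    by case: hh => + _; apply; apply: open_nbhs_nbhs; split=> //; rewrite inE in hA.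
  apply: filterS (filterI n1 n2) => y [By Ay] hy.
  have : (A `&` B) y by split=> //; move: Ay; rewrite /= hy.
  by rewrite (eqP AB).
have [c ac cx] := atlas_cover x.
have [l dl] : exists l, cder (trans c c h) (coord c x) l.
  by eexists; exact: derivable_cder (holomorphic_trans ac ac hh (fix_trans_dom cx hx)).
have [l1|l1] := eqVneq l 1; last by right; exact: fix_isolated_local dl.
rewrite l1 in dl; have [m m0 hm] := G_periodic Gh.
by left; exact: periodic_id_local hm dl.
Qed.

(** The set of points near which h is the identity is open. It is also closed: at a limit point y
    outside it the fixed points would be isolated, so that a point of the set close to y would be y
    itself. Connectedness concludes. *)
Lemma near_id_eq h (x : S) : G h -> (\forall y \near x, h y = y) -> h = id.
Proof.
move=> Gh hx; pose A : set S := [set x | \forall y \near x, h y = y].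
have AE : A = [set: S].
  have := @surface_connected _ S; apply; first by exists x.
    exists A; last by rewrite setTI.
    by rewrite openE => y /near_join Ay; exact: Ay.
  exists A; last by rewrite setTI.
  rewrite -openC openE => y nAy.
  have [//|iso] := fix_dichotomy y Gh.
  apply: filterS iso => w iso Aw; apply: nAy.
  by rewrite -(iso (nbhs_singleton Aw)).
apply/funext => y; have : A y by rewrite AE.
exact: nbhs_singleton.
Qed.

Lemma fix_finite h : closed_surface S -> G h -> h <> id ->
  exists s : seq S, forall x, h x = x -> x \in s.
Proof.
move=> cS Gh hid.
suff : exists s : seq S, forall x, [set: S] x -> h x = x -> x \in s.
  by move=> [s Hs]; exists s => x; exact: Hs.
apply: (compact_ind cS (P := fun A => exists s : seq S, forall x, A x -> h x = x -> x \in s)).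
- by exists [::].
- move=> A B [s Hs] [t Ht]; exists (s ++ t) => x [Ax|Bx] hx; rewrite mem_cat.
    by rewrite Hs.
  by rewrite Ht ?orbT.
- by move=> A B AB [s Hs]; exists s => x /AB; exact: Hs.
move=> x _; have [/(near_id_eq Gh)//|iso] := fix_dichotomy x Gh.
exists [set y | h y = y -> y = x] => //; exists [:: x] => y yx /yx ->.
by rewrite inE.
Qed.

Lemma multiplier_id c h x : atlas c -> dom c x -> G h -> h x = x ->
  cder (trans c c h) (coord c x) 1 -> h = id.
Proof.
move=> ac cx Gh hx dl; have [m m0 hm] := G_periodic Gh.
exact: near_id_eq Gh (periodic_id_local ac (G_holomorphic Gh) cx hx m0 hm dl).
Qed.

Lemma multiplier_root c h x l : atlas c -> dom c x -> G h -> h x = x ->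
  cder (trans c c h) (coord c x) l -> exists2 m, (0 < m)%N & l ^+ m = 1.
Proof.
move=> ac cx Gh hx dl; have [m m0 hm] := G_periodic Gh; exists m => //.
have := cder_trans_iter m ac (G_holomorphic Gh) cx hx dl; rewrite hm => d1.
by apply: cder_unique d1 (cder_trans_id _); exact: coord_img.
Qed.

End Group.

(** * Local Lipschitz families *)

Section LocalLipschitz.
Variable R : realType.

(** Lipschitz in the d functions s and not in a metric of X: it is the number d that is compared
    with the number of rows. *)
Definition loclip (X : topologicalType) (x0 : X) d (s : X -> 'I_d -> R) (l : X -> R) :=
  exists (c : R) (U : set X), nbhs x0 U /\
    forall x y, U x -> U y -> `|l x - l y| <= c * \sum_k `|s x k - s y k|.

Definition scat (X Y : Type) d1 d2 (s1 : X -> 'I_d1 -> R) (s2 : Y -> 'I_d2 -> R)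
    (p : X * Y) (k : 'I_(d1 + d2)) : R :=
  match fintype.split k with inl i => s1 p.1 i | inr j => s2 p.2 j end.

Lemma scat_sum (X Y : Type) d1 d2 (s1 : X -> 'I_d1 -> R) (s2 : Y -> 'I_d2 -> R) p q :
  \sum_k `|scat s1 s2 p k - scat s1 s2 q k| =
  \sum_k `|s1 p.1 k - s1 q.1 k| + \sum_k `|s2 p.2 k - s2 q.2 k|.
Proof.
rewrite big_split_ord; congr (_ + _); apply: eq_bigr => k _; rewrite /scat.
  by rewrite -[lshift d2 k]/(unsplit (inl k)) unsplitK.
by rewrite -[rshift d1 k]/(unsplit (inr k)) unsplitK.
Qed.

Lemma scat_continuous (X Y : topologicalType) d1 d2 (s1 : X -> 'I_d1 -> R)
    (s2 : Y -> 'I_d2 -> R) x y :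
  (forall k, {for x, continuous (s1^~ k)}) -> (forall k, {for y, continuous (s2^~ k)}) ->
  forall k, {for (x, y), continuous (fun p => scat s1 s2 p k)}.
Proof.
move=> c1 c2 k; rewrite /scat; case: fintype.split => j.
  apply: (@continuous_comp _ _ _ fst (s1^~ j)); first exact: cvg_fst.
  exact: c1.
apply: (@continuous_comp _ _ _ snd (s2^~ j)); first exact: cvg_snd.
exact: c2.
Qed.

Variable X : topologicalType.

Lemma loclip_ge0 x0 d (s : X -> 'I_d -> R) l : loclip x0 s l ->
  exists (c : R) (U : set X), [/\ 0 <= c, nbhs x0 U &
    forall x y, U x -> U y -> `|l x - l y| <= c * \sum_k `|s x k - s y k|].
Proof.
move=> [c [U [nU H]]]; exists (Num.max c 0), U; split=> //; first by rewrite le_max lexx orbT.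
move=> x y Ux Uy; apply: le_trans (H x y Ux Uy) _; apply: ler_wpM2r; first exact: sumr_ge0.
by rewrite le_max lexx.
Qed.

Lemma loclipB x0 d (s : X -> 'I_d -> R) l1 l2 : loclip x0 s l1 -> loclip x0 s l2 ->
  loclip x0 s (fun x => l1 x - l2 x).
Proof.
move=> [c1 [U1 [nU1 H1]]] [c2 [U2 [nU2 H2]]].
exists (c1 + c2), (U1 `&` U2); split; first exact: filterI.
move=> x y [x1 x2] [y1 y2]; rewrite mulrDl.
have -> : l1 x - l2 x - (l1 y - l2 y) = (l1 x - l1 y) - (l2 x - l2 y) by ring.
by apply: le_trans (ler_normB _ _) _; apply: lerD; [exact: H1|exact: H2].
Qed.

Lemma loclipN x0 d (s : X -> 'I_d -> R) l : loclip x0 s l -> loclip x0 s (fun x => - l x).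
Proof.
move=> [c [U [nU H]]]; exists c, U; split=> // x y Ux Uy.
by rewrite -opprD normrN; exact: H.
Qed.

Lemma loclipD x0 d (s : X -> 'I_d -> R) l1 l2 : loclip x0 s l1 -> loclip x0 s l2 ->
  loclip x0 s (fun x => l1 x + l2 x).
Proof.
move=> h1 h2; have := loclipB h1 (loclipN h2).
by under [X in loclip _ _ X -> _]eq_fun do rewrite opprK.
Qed.

Lemma loclipM x0 d (s : X -> 'I_d -> R) l1 l2 :
  {for x0, continuous l1} -> {for x0, continuous l2} ->
  loclip x0 s l1 -> loclip x0 s l2 -> loclip x0 s (fun x => l1 x * l2 x).
Proof.
have bd (l : X -> R) : {for x0, continuous l} -> nbhs x0 [set x | `|l x| <= `|l x0| + 1].
  move=> cl; have := cl [set t : R | `|t| <= `|l x0| + 1]; apply; apply/nbhsR.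
  exists 1 => // y /ltW yl /=; rewrite -[y](subrK (l x0)) addrC.
  by apply: le_trans (ler_normD _ _) _; rewrite lerD2l.
move=> k1 k2 /loclip_ge0[c1 [U1 [p1 nU1 H1]]] /loclip_ge0[c2 [U2 [p2 nU2 H2]]].
exists ((`|l2 x0| + 1) * c1 + (`|l1 x0| + 1) * c2),
  ((U1 `&` [set x | `|l1 x| <= `|l1 x0| + 1]) `&` (U2 `&` [set x | `|l2 x| <= `|l2 x0| + 1])).
split; first by apply: filterI; apply: filterI => //; exact: bd.
move=> x y [[x1 b1] [x2 b2]] [[y1 b3] [y2 b4]].
have -> : l1 x * l2 x - l1 y * l2 y = l2 x * (l1 x - l1 y) + l1 y * (l2 x - l2 y) by ring.
apply: le_trans (ler_normD _ _) _; rewrite mulrDl !normrM -!mulrA.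
by apply: lerD; apply: ler_pM => //; [exact: H1|exact: H2].
Qed.

Lemma loclip_coord x0 d (s : X -> 'I_d -> R) k : loclip x0 s (s^~ k).
Proof.
exists 1, setT; split; first exact: filterT.
by move=> x y _ _; rewrite mul1r (bigD1 k) //= lerDl sumr_ge0.
Qed.

Lemma rare_loclip N x0 d n (L : X -> 'M[R]_(n, N)) (s : X -> 'I_d -> R) : (d < n)%N ->
  (forall k, {for x0, continuous (s^~ k)}) ->
  (forall i j, loclip x0 s (fun x => L x i j)) -> row_free (L x0) ->
  exists2 U, nbhs x0 U & rare [set a : 'cV_N | exists2 x, U x & L x *m a = 0].
Proof.
move=> dn cs Ll Lf.
have H (ij : 'I_n * 'I_N) := loclip_ge0 (Ll ij.1 ij.2).
have [c Hc] := choice H; have [U HU] := choice Hc.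
apply: (@rare_near R N X x0 d n L s (\sum_ij c ij) [set x | forall ij, U ij x]) => //.
  by apply: filter_forall => ij; case: (HU ij).
move=> x y i j Ux Uy; have [_ _ h] := HU (i, j).
apply: le_trans (h x y (Ux _) (Uy _)) _; apply: ler_wpM2r; first exact: sumr_ge0.
by rewrite (bigD1 (i, j)) //= lerDl sumr_ge0 // => k _; case: (HU k).
Qed.

(** The columns L a form a triangular system, so a left kernel vector vanishes from its last entry
    backwards. Since the entries of L a will be values or derivatives of functions, independence of
    rows becomes an interpolation problem. *)
Lemma row_free_triangular N n (L : 'M[R]_(n, N)) :
  (forall i : 'I_n, exists a : 'cV_N, (L *m a) i ord0 != 0 /\
     forall j : 'I_n, (j < i)%N -> (L *m a) j ord0 = 0) -> row_free L.
Proof.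
move=> H; apply: inj_row_free => v vL.
have key m (i : 'I_n) : (n - i < m)%N -> v ord0 i = 0.
  elim: m i => // m IH i im; have [a [ai aj]] := H i.
  have : (v *m (L *m a)) ord0 ord0 = 0 by rewrite mulmxA vL mul0mx mxE.
  rewrite mxE (bigD1 i) //= big1 => [|j ji].
    by rewrite addr0 => /eqP; rewrite mulf_eq0 (negbTE ai) orbF => /eqP.
  have [lt|ge] := ltnP j i; first by rewrite aj ?mulr0.
  have ij : (i < j)%N by rewrite ltn_neqAle ge andbT eq_sym.
  by rewrite IH ?mul0r //; apply: (leq_trans (ltn_sub2l (ltn_ord i) ij)).
by apply/rowP => i; rewrite mxE; exact: key (ltnSn _).
Qed.

End LocalLipschitz.

Section LocalLipschitzProd.
Variables (R : realType) (X Y : topologicalType).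

Lemma loclip_fst (x : X) (y : Y) d1 d2 (s1 : X -> 'I_d1 -> R) (s2 : Y -> 'I_d2 -> R) l :
  loclip x s1 l -> loclip (x, y) (scat s1 s2) (fun p => l p.1).
Proof.
move=> /loclip_ge0[c [U [c0 nU H]]]; exists c, (fst @^-1` U); split.
  by exists (U, setT); [split=> //; exact: filterT|move=> [a b] []].
move=> p q Up Uq; rewrite scat_sum; apply: le_trans (H _ _ Up Uq) _.
by apply: ler_wpM2l => //; rewrite lerDl sumr_ge0.
Qed.

Lemma loclip_snd (x : X) (y : Y) d1 d2 (s1 : X -> 'I_d1 -> R) (s2 : Y -> 'I_d2 -> R) l :
  loclip y s2 l -> loclip (x, y) (scat s1 s2) (fun p => l p.2).
Proof.
move=> /loclip_ge0[c [U [c0 nU H]]]; exists c, (snd @^-1` U); split.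
  by exists (setT, U); [split=> //; exact: filterT|move=> [a b] []].
move=> p q Up Uq; rewrite scat_sum; apply: le_trans (H _ _ Up Uq) _.
by apply: ler_wpM2l => //; rewrite lerDr sumr_ge0.
Qed.

End LocalLipschitzProd.

(** * Derivatives along tangent vectors *)

Section Tangent.
Variables (R : realType) (S : riemannSurface R).
Local Notation C := (R[i]).
Local Notation Re := (@complex.Re R).
Local Notation Im := (@complex.Im R).
Local Notation coord := Defs.coord.
Implicit Types (c d : chart R S) (h : S -> S) (f g : S -> R) (v w : R * R).

Definition chart_coords c (x : S) (k : 'I_2) : R :=
  if k == 0 :> nat then Re (coord c x) else Im (coord c x).

Lemma chart_coords_continuous c x : dom c x ->
  forall k, {for x, continuous ((chart_coords c)^~ k)}.
Proof.
move=> cx k; have cc := @Defs.coord_continuous _ _ c x cx; rewrite /chart_coords.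
case: (k == 0 :> nat).
  exact: (@continuous_comp _ _ _ (coord c) Re x cc (@continuous_Re R _)).
exact: (@continuous_comp _ _ _ (coord c) Im x cc (@continuous_Im R _)).
Qed.

Lemma real_img_coord c x : dom c x -> real_img c (ofC (coord c x)).
Proof.
by move=> cx; rewrite /real_img /= -[(_ +i* _)%C]/(toC (ofC _)) ofCK; exact: coord_img.
Qed.

Lemma loclip_chart c x (F : R * R -> R) : dom c x -> Ck_on 1 (real_img c) F ->
  loclip x (chart_coords c) (fun y => F (ofC (coord c y))).
Proof.
move=> cx cF; pose p0 := ofC (coord c x).
pose M := `|'D_(1, 0) F p0| + `|'D_(0, 1) F p0| + 1.
have [||r r0 Hr] := @C1_lipschitz R _ F p0 M (open_real_img c) (real_img_coord cx) cF.
- by rewrite /M -addrA ltrDl ltr_wpDl.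
- by rewrite /M -addrA addrCA ltrDl ltr_wpDl.
pose U := [set y | `|Re (coord c y) - Re (coord c x)| < r /\ `|Im (coord c y) - Im (coord c x)| < r].
exists M, U; split.
  have n1 : nbhs x [set y | `|Re (coord c y) - Re (coord c x)| < r].
    have := @chart_coords_continuous c x cx ord0 [set t : R | `|t - Re (coord c x)| < r].
    by apply; apply/nbhsR; exists r.
  have n2 : nbhs x [set y | `|Im (coord c y) - Im (coord c x)| < r].
    have := @chart_coords_continuous c x cx (Ordinal (isT : (1 < 2)%N)) [set t : R | `|t - Im (coord c x)| < r].
    by apply; apply/nbhsR; exists r.
  exact: filterI n1 n2.
move=> y z [y1 y2] [z1 z2]; rewrite !big_ord_recl big_ord0 addr0.
exact: Hr.
Qed.

Lemma loclip_Sm c x f : atlas c -> dom c x -> Sm f -> loclip x (chart_coords c) f.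
Proof.
move=> ac cx sf; have [k [U [nU H]]] := loclip_chart cx (sf c ac 1%N).
exists k, (U `&` dom c); split.
  by apply: filterI => //; exact: open_nbhs_nbhs (conj (@open_dom _ _ c) cx).
move=> y z [Uy cy] [Uz cz]; have := H y z Uy Uz.
by rewrite /loc !ofCK !coordK.
Qed.

(* The derivative of [f] at [x] along the tangent vector with coordinates [v] in [c]. *)
Definition T c (x : S) v f := 'D_v (loc f c) (ofC (coord c x)).

(** Here second derivatives of f enter: its first derivative has to be C^1. *)
Lemma loclip_T c x v f : atlas c -> dom c x -> Sm f ->
  loclip x (chart_coords c) (fun y => T c y v f).
Proof.
move=> ac cx sf; apply: (@loclip_chart c x ('D_v (loc f c)) cx).
by have [_ H] := sf c ac 2%N; exact: H.
Qed.

Lemma T_continuous c x v f : atlas c -> dom c x -> Sm f ->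
  {for x, continuous (fun y => T c y v f)}.
Proof.
move=> ac cx sf; have cc := @Defs.coord_continuous _ _ c x cx.
apply: (@continuous_comp _ _ _ (fun y => ofC (coord c y)) ('D_v (loc f c))).
  have h1 : {for x, continuous (fun y => Re (coord c y))}.
    exact: (@continuous_comp _ _ _ (coord c) Re x cc (@continuous_Re R _)).
  have h2 : {for x, continuous (fun y => Im (coord c y))}.
    exact: (@continuous_comp _ _ _ (coord c) Im x cc (@continuous_Im R _)).
  exact: cvg_pair h1 h2.
have [_ H] := sf c ac 1%N; exact: H (real_img_coord cx).
Qed.

Lemma T_diff c x f : atlas c -> dom c x -> Sm f -> differentiable (loc f c) (ofC (coord c x)).
Proof. by move=> ac cx sf; apply: Sm_diff => //; exact: real_img_coord. Qed.

Lemma TD c x v w r f : atlas c -> dom c x -> Sm f ->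
  T c x (v + r *: w) f = T c x v f + r * T c x w f.
Proof.
move=> ac cx sf; have df := T_diff ac cx sf.
by rewrite /T !(deriveE _ df) linearD linearZ.
Qed.

Lemma TZ c x r v f : atlas c -> dom c x -> Sm f -> T c x (r *: v) f = r * T c x v f.
Proof.
move=> ac cx sf; have df := T_diff ac cx sf.
by rewrite /T !(deriveE _ df) linearZ.
Qed.

Lemma TM c x v f g : atlas c -> dom c x -> Sm f -> Sm g ->
  T c x v (fun y => f y * g y) = f x * T c x v g + g x * T c x v f.
Proof.
move=> ac cx sf sg; have df := T_diff ac cx sf; have dg := T_diff ac cx sg.
rewrite /T (_ : loc (fun y => f y * g y) c = loc f c * loc g c) //.
by rewrite deriveM; [|exact: diff_derivable..]; rewrite /loc !ofCK coordK.
Qed.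

Lemma T_sum c x v n (f : 'I_n -> S -> R) (r : 'I_n -> R) : atlas c -> dom c x ->
  (forall i, Sm (f i)) ->
  T c x v (fun y => \sum_i f i y * r i) = \sum_i T c x v (f i) * r i.
Proof.
move=> ac cx sf; rewrite /T.
have -> : loc (fun y => \sum_i f i y * r i) c = \sum_i (loc (f i) c * cst (r i)).
  by apply/funext => q; rewrite fct_sumE.
have di i : derivable (loc (f i) c * cst (r i)) (ofC (coord c x)) v.
  apply: derivableM; last exact: derivable_cst.
  by apply: diff_derivable; exact: T_diff.
rewrite derive_sum //; apply: eq_bigr => i _.
rewrite deriveM ?derive_cst; [|by apply: diff_derivable; exact: T_diff|exact: derivable_cst].
by rewrite scaler0 add0r mulrC.
Qed.

Lemma T_comp c d h x l v f : Sm f -> atlas c -> atlas d -> holomorphic_map h ->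
  dom c x -> dom d (h x) -> cder (trans c d h) (coord c x) l ->
  T c x v (f \o h) = T d (h x) (ofC (l * toC v)) f.
Proof.
move=> sf ac ad hh cx dx dl; rewrite /T.
have Vp : trans_dom c d h (toC (ofC (coord c x))).
  by rewrite ofCK; split; rewrite /= ?coordK //; exact: coord_img.
have dl' : cder (trans c d h) (toC (ofC (coord c x))) l by rewrite ofCK.
by rewrite (derive_trans v sf ac ad hh Vp dl') ofCK /trans /= coordK.
Qed.

End Tangent.

(** * Polynomials in the coordinates *)

Section Family.
Variables (R : realType) (S : riemannSurface R) (I : finType) (i0 : I) (u : I -> S -> R) (D : nat).
Hypotheses (uS : forall i, Sm (u i)) (u1 : u i0 = (fun=> 1)).
Hypothesis usep : forall x y, x <> y -> exists i, u i x != u i y.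
Hypothesis uimm : forall x c v, atlas c -> dom c x -> v != 0 -> exists i, T c x v (u i) != 0.
Local Notation N := #|{ffun 'I_D -> I}|.
Implicit Types (c d : chart R S).

(* As some u i0 is the constant 1, the products of exactly D coordinates include all
   monomials of degree at most D. *)
Definition mono (k : 'I_N) (x : S) : R := \prod_(j < D) u (enum_val k j) x.

Definition fa (a : 'cV[R]_N) (x : S) : R := \sum_(k < N) mono k x * a k ord0.

Lemma Sm_mono k : Sm (mono k).
Proof. exact: (@Sm_prod R S 'I_D (index_enum 'I_D) (fun j => u (enum_val k j)) (fun j => uS _)). Qed.

Lemma Sm_fa a : Sm (fa a).
Proof.
apply: (@Sm_sum R S 'I_N (index_enum 'I_N) (fun k x => mono k x * a k ord0)) => k.
by apply: SmM; [exact: Sm_mono|exact: Sm_cst].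
Qed.

(** The coefficients arise from expanding the product of D linear forms. *)
Lemma fa_prod (b : 'I_D -> I -> R) :
  exists a, forall x, fa a x = \prod_(j < D) \sum_l b j l * u l x.
Proof.
exists (\col_(k < N) \prod_j b j (enum_val k j)) => x.
rewrite bigA_distr_bigA /= /fa.
rewrite (big_enum_val (fun f : {ffun 'I_D -> I} => \prod_i (b i (f i) * u (f i) x))).
by apply: eq_bigr => k _; rewrite mxE /mono big_split mulrC.
Qed.

(** Linear forms in the u l; they contain the constants because u i0 = 1, as [aff_sub] uses. *)
Definition aff (A : S -> R) := exists b : I -> R, forall x, A x = \sum_l b l * u l x.

Lemma aff_sub l r : aff (fun x => u l x - r).
Proof.
exists (fun m => (m == l)%:R - (m == i0)%:R * r) => x.
under eq_bigr do rewrite mulrBl.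
rewrite sumrB (bigD1 l) //= eqxx mul1r big1 ?addr0; last by move=> m /negbTE ->; rewrite mul0r.
rewrite (bigD1 i0) //= eqxx u1 mul1r mulr1 big1 ?addr0 //.
by move=> m /negbTE ->; rewrite !mul0r.
Qed.

Lemma fa_big (J : Type) (F : J -> S -> R) (ts : seq J) : (forall t, aff (F t)) ->
  (size ts <= D)%N -> exists a, forall x, fa a x = \prod_(t <- ts) F t x.
Proof.
move=> /choice[b Hb] sD.
(* Shorter products are padded to exactly D factors by the constant 1 = u i0. *)
pose H o x := if o is Some t then F t x else 1.
pose B (o : option J) l := if o is Some t then b t l else (l == i0)%:R.
have HB o x : H o x = \sum_l B o l * u l x.
  case: o => [t|] /=; first exact: Hb.
  rewrite (bigD1 i0) //= eqxx u1 mul1r big1 ?addr0 // => m /negbTE ->.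
  by rewrite mul0r.
have [a Ha] := fa_prod (fun j => B (nth None (map Some ts) j)).
exists a => x; rewrite Ha -[RHS](big_map Some predT (fun o => H o x)).
rewrite (big_nth None) big_mkord size_map (big_ord_widen D (fun j => H (nth None (map Some ts) j) x) sD).
rewrite [RHS]big_mkcond; apply: eq_bigr => j _; rewrite -HB; case: ltnP => // sj.
by rewrite nth_default ?size_map.
Qed.

(** The product over q in ps of u l - u l(q), where u l, chosen for q, separates p from q. *)
Lemma separate p (ps : seq S) : p \notin ps -> (size ps <= D)%N ->
  exists a, fa a p != 0 /\ forall q, q \in ps -> fa a q = 0.
Proof.
move=> pps sD.
have /choice[l Hl] : forall q, exists i, q <> p -> u i p != u i q.
  move=> q; have [->|/eqP qp] := eqVneq q p; first by exists i0.
  by have [i Hi] := usep (fun E => qp (esym E)); exists i.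
have [a Ha] := fa_big (F := fun q x => u (l q) x - u (l q) q) (fun q => aff_sub (l q) _) sD.
exists a; split=> [|q qps]; rewrite Ha.
  rewrite prodf_seq_neq0; apply/allP => q qps /=; rewrite subr_eq0; apply: Hl => qp.
  by move: pps; rewrite -qp qps.
by apply/eqP; rewrite prodf_seq_eq0; apply/hasP; exists q => //; rewrite /= subrr.
Qed.

(** The function is P^2 B, where P is the product used in [separate] and B = u m - u m(p) has
    nonzero derivative along v. The square kills derivatives at the points of ps, and at p only
    P(p)^2 dB survives since B(p) = 0. The degree is 2 |ps| + 1. *)
Lemma separate_jet p (ps : seq S) c v : p \notin ps -> ((size ps).*2 < D)%N ->
  atlas c -> dom c p -> v != 0 ->
  exists a, T c p v (fa a) != 0 /\
    forall q d w, q \in ps -> atlas d -> dom d q -> T d q w (fa a) = 0.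
Proof.
move=> pps sD ac cp v0.
have /choice[l Hl] : forall q, exists i, q <> p -> u i p != u i q.
  move=> q; have [->|/eqP qp] := eqVneq q p; first by exists i0.
  by have [i Hi] := usep (fun E => qp (esym E)); exists i.
have [m Hm] := uimm ac cp v0.
pose F (o : option S) (x : S) := if o is Some q then u (l q) x - u (l q) q else u m x - u m p.
have aF o : aff (F o) by case: o => [q|]; exact: aff_sub.
have sS i r : Sm (fun x => u i x - r) by apply: (SmD (uS i)); exact: Sm_cst.
pose ts := map Some ps ++ map Some ps ++ [:: None].
have sts : (size ts <= D)%N by rewrite !size_cat !size_map /= addn1 addnS addnn.
have [a Ha] := fa_big aF sts.
pose P (x : S) := \prod_(q <- ps) F (Some q) x.
pose B := F None.
have E : fa a = fun x => P x * (P x * B x).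
  by apply/funext => x; rewrite Ha !big_cat !big_map big_seq1.
have sP : Sm P by apply: (@Sm_prod _ _ _ ps (fun q => F (Some q))) => q; exact: sS.
have sB : Sm B by exact: sS.
have Pp : P p != 0.
  rewrite prodf_seq_neq0; apply/allP => q qps /=; rewrite subr_eq0; apply: Hl => qp.
  by move: pps; rewrite -qp qps.
exists a; split.
  rewrite E (TM v ac cp sP (SmM sP sB)) (TM v ac cp sP sB).
  have -> : B p = 0 by rewrite /B /= subrr.
  rewrite mul0r addr0 mulr0 mul0r addr0 !mulf_neq0 //.
  have <- : T c p v (u m) = T c p v B; last exact: Hm.
  rewrite /T (_ : loc B c = loc (u m) c - cst (u m p)); last by [].
  have h1 : derivable (loc (u m) c) (ofC (Defs.coord c p)) v.
    by apply: diff_derivable; exact: (T_diff ac cp (uS m)).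
  by rewrite (deriveB h1 (derivable_cst (u m p) _ v)) derive_cst subr0.
move=> q d w qps ad dq; rewrite E (TM w ad dq sP (SmM sP sB)).
have -> : P q = 0.
  by apply/eqP; rewrite prodf_seq_eq0; apply/hasP; exists q => //; rewrite /= subrr.
by rewrite !mul0r addr0.
Qed.

Lemma coord_fa i : (0 < D)%N -> exists a, fa a = u i.
Proof.
move=> D0; have ai : aff (u i) by have := aff_sub i 0; under [X in aff X -> _]eq_fun do rewrite subr0.
have [a Ha] := @fa_big unit (fun=> u i) [:: tt] (fun=> ai) D0.
by exists a; apply/funext => x; rewrite Ha big_seq1.
Qed.

Lemma T_fa c x v h a : atlas c -> dom c x -> holomorphic_map h ->
  T c x v (fa a \o h) = \sum_(k < N) T c x v (mono k \o h) * a k ord0.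
Proof.
move=> ac cx hh; rewrite -(@T_sum R S c x v N (fun k => mono k \o h) (fun k => a k ord0)) //.
by move=> k; apply: Sm_comp => //; exact: Sm_mono.
Qed.

End Family.

Section Multipliers.
Variables (R : realType) (S : riemannSurface R) (G : set (S -> S)).
Hypothesis GG : finite_automorphism_group G.
Local Notation coord := Defs.coord.
Implicit Types (c d : chart R S) (h : S -> S).

Lemma multiplier_neq0 c d h x l : G h -> atlas c -> atlas d -> dom c x -> dom d (h x) ->
  cder (trans c d h) (coord c x) l -> l != 0.
Proof.
move=> Gh ac ad cx dx dl; have [h' [Gh' hK _]] : exists h', [/\ G h', cancel h h' & cancel h' h].
  by case: GG => _ _ _ _; apply.
have hh := G_holomorphic GG Gh; have hh' := G_holomorphic GG Gh'.
have V : trans_dom c d h (coord c x) by split; rewrite /= ?coordK //; exact: coord_img.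
have V' : trans_dom d c h' (trans c d h (coord c x)).
  split; first exact: trans_img.
  by rewrite /= transK // coordK // hK.
have dl' := derivable_cder (holomorphic_trans ad ac hh' V').
have := cder_trans_comp hh V dl dl'.
have -> : h' \o h = id by apply/funext => y /=; exact: hK.
move=> /cder_unique/(_ (cder_trans_id (coord_img cx))) E.
by apply/eqP => l0; move: E; rewrite l0 mulr0 => /esym/eqP; rewrite oner_eq0.
Qed.

(** Turns derivatives of f o h at x into derivatives of f at h x along a nonzero vector, so that
    [separate_jet] applies at the points of an orbit. *)
Lemma T_group c h x v : G h -> atlas c -> dom c x -> v != 0 ->
  exists d w, [/\ atlas d, dom d (h x), w != 0 &
    forall f : S -> R, Sm f -> T c x v (f \o h) = T d (h x) w f].
Proof.
move=> Gh ac cx v0; have [d ad dx] := atlas_cover (h x).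
have hh := G_holomorphic GG Gh.
have V : trans_dom c d h (coord c x) by split; rewrite /= ?coordK //; exact: coord_img.
have dl := derivable_cder (holomorphic_trans ac ad hh V).
have l0 := multiplier_neq0 Gh ac ad cx dx dl.
exists d, (ofC ('D_1 (trans c d h) (coord c x) * toC v)).
split=> // [|f sf]; last exact: T_comp.
apply/eqP => E.
have : 'D_1 (trans c d h) (coord c x) * toC v = 0 by rewrite -[LHS]ofCK E.
move=> /eqP; rewrite mulf_eq0 (negbTE l0) /= => /eqP v00.
by move: v0; rewrite -(toCK v) v00 eqxx.
Qed.

End Multipliers.

(** * Exceptional parameters are rare *)

Section Strata.
Variables (R : realType) (S : riemannSurface R) (G : set (S -> S)).
Hypotheses (cS : closed_surface S) (GG : finite_automorphism_group G).
Variables (n : nat) (g : 'I_n -> S -> S).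
Hypotheses (n5 : (5 <= n)%N) (Gg : forall i, G (g i)) (ginj : injective g).
Hypothesis gsurj : forall h, G h -> exists i, g i = h.
Variables (I : finType) (i0 : I) (u : I -> S -> R).
Hypotheses (uS : forall i, Sm (u i)) (u1 : u i0 = (fun=> 1)).
Hypothesis usep : forall x y, x <> y -> exists i, u i x != u i y.
Hypothesis uimm : forall x c v, atlas c -> dom c x -> v != 0 -> exists i, T c x v (u i) != 0.
Local Notation D := n.*2.
Local Notation N := #|{ffun 'I_D -> I}|.
Local Notation fa := (@fa R S I u D).
Local Notation mono := (@mono R S I u D).
Local Notation coord := Defs.coord.
Local Notation Im := (@complex.Im R).
Local Notation Re := (@complex.Re R).
Implicit Types (c d : chart R S) (a : 'cV[R]_N).

(* The orbit map of [fa a] identifies [x] and [y]. *)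
Definition coll a (x y : S) := forall i, fa a (g i x) = fa a (g i y).

(* [x] is a critical point of the orbit map of [fa a]. *)
Definition crit a (x : S) := exists c v, [/\ atlas c, dom c x, v != 0 &
  forall i, T c x v (fa a \o g i) = 0].

Definition free (x : S) := forall i, g i <> id -> g i x <> x.

Lemma g_comp i j : exists m, g m = g i \o g j.
Proof. by apply: gsurj; case: GG => _ _ _ GM _; exact: GM. Qed.

Lemma g_inv j : exists m, cancel (g j) (g m) /\ cancel (g m) (g j).
Proof.
have [h [Gh h1 h2]] : exists h', [/\ G h', cancel (g j) h' & cancel h' (g j)].
  by case: GG => _ _ _ _; apply.
by have [m mE] := gsurj Gh; exists m; rewrite mE.
Qed.

Lemma g_id : exists m, g m = id.
Proof. by apply: gsurj; case: GG. Qed.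

Lemma free_inj x : free x -> injective (fun i => g i x).
Proof.
move=> fx i j /= E; have [m [m1 m2]] := g_inv j; have [k kE] := g_comp m i.
have kid : g k = id.
  apply: contrapT => nid; apply: (fx k nid).
  by rewrite kE /= E m1.
apply: ginj; apply/funext => y.
have E2 : g m (g i y) = y by have := congr1 (fun h => h y) kid; rewrite kE.
by rewrite -[LHS]m2 E2.
Qed.

Lemma orbit_trans x y i j : g i x = g j y -> exists m, x = g m y.
Proof.
move=> E; have [m [m1 m2]] := g_inv i; have [k kE] := g_comp m j.
by exists k; rewrite kE /= -E m1.
Qed.

Lemma holo_g i : holomorphic_map (g i).
Proof. exact: G_holomorphic GG _ (Gg i). Qed.

Definition LA (p : S * S) : 'M[R]_(n, N) :=
  \matrix_(i < n, k < N) (mono k (g i p.2) - mono k (g i p.1)).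

Lemma LA_mul p a i : (LA p *m a) i ord0 = fa a (g i p.2) - fa a (g i p.1).
Proof.
rewrite mxE /fa -sumrB; apply: eq_bigr => k _.
by rewrite mxE mulrBl.
Qed.

Lemma Sm_mono_g k i : Sm (mono k \o g i).
Proof. by apply: Sm_comp; [exact: Sm_mono|exact: holo_g]. Qed.

Lemma Sm_fa_g a i : Sm (fa a \o g i).
Proof. by apply: Sm_comp; [exact: Sm_fa|exact: holo_g]. Qed.

(* The n equations fa a (g i x) = fa a (g i y) are independent, while (x, y) varies in
   dimension 4 < n: this is where |G| >= 5 enters. *)
Lemma rare_generic_pair (x0 y0 : S) : free y0 -> (forall i, x0 <> g i y0) ->
  exists2 U, nbhs (x0, y0) U & rare [set a | exists2 p, U p & coll a p.1 p.2].
Proof.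
move=> fy xy; have [c ac cx] := atlas_cover x0; have [d ad dy] := atlas_cover y0.
have [|||U nU rU] := @rare_loclip R _ N (x0, y0) (2 + 2) n LA
    (scat (chart_coords c) (chart_coords d)) n5.
- by apply: scat_continuous; exact: chart_coords_continuous.
- move=> i k; under [X in loclip _ _ X]eq_fun do rewrite mxE.
  apply: loclipB.
    apply: (loclip_snd x0 (chart_coords c) (l := mono k \o g i)).
    by apply: loclip_Sm => //; exact: Sm_mono_g.
  apply: (loclip_fst y0 (chart_coords d) (l := mono k \o g i)).
  by apply: loclip_Sm => //; exact: Sm_mono_g.
- apply: row_free_triangular => i.
  (* All 2 n - 1 remaining entries of the two orbits: a function vanishing there but not at g i y0
     singles out row i, and D = 2 n factors are enough. *)
  pose ps := [seq g j y0 | j <- rem i (enum 'I_n)] ++ [seq g j x0 | j <- enum 'I_n].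
  have [||a [a1 a2]] := @separate R S I i0 u D u1 usep (g i y0) ps.
  + rewrite mem_cat negb_or; apply/andP; split; apply/mapP => -[j jr E].
      by move: jr; rewrite (free_inj fy E) mem_rem_uniqF ?enum_uniq.
    by have [m mE] := orbit_trans (esym E); exact: (xy m).
  + by rewrite size_cat 2!size_map size_rem ?mem_enum // !size_enum_ord -addnn leq_add2r leq_pred.
  exists a; split; first by rewrite LA_mul /= (a2 (g i x0)) ?subr0 // mem_cat map_f ?orbT // mem_enum.
  move=> j ji; rewrite LA_mul /= (a2 (g j x0)) ?(a2 (g j y0)) ?subr0 // mem_cat ?map_f ?orbT ?mem_enum //.
  by rewrite mem_rem_uniq ?enum_uniq // inE mem_enum andbT; apply: contraTneq ji => ->; rewrite ltnn.
exists U => //; apply: rareS rU => a [p Up ca]; exists p => //.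
by apply/colP => i; rewrite LA_mul mxE ca subrr.
Qed.

Lemma pick_avoid (s : seq 'I_n) : (size s < n)%N -> exists i, i \notin s.
Proof.
move=> sn; apply: contrapT => H.
have : (#|'I_n| <= size s)%N.
  apply: leq_trans (card_size s); apply: subset_leq_card; apply/fintype.subsetP => i _.
  by apply: contrapT => /negP ni; apply: H; exists i.
by rewrite card_ord leqNgt sn.
Qed.

(* For y = g k x the equations are no longer independent, but three of them are, and
   x varies in dimension 2. *)
Lemma rare_orbit_pair k (x0 : S) : g k <> id -> free x0 ->
  exists2 U, nbhs x0 U & rare [set a | exists2 x, U x & coll a x (g k x)].
Proof.
move=> kid fx.
have /choice[sg sgE] : forall i, exists m, g m = g i \o g k by move=> i; exact: g_comp.
have n0 : (0 < n)%N by exact: leq_trans n5.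
pose h0 := Ordinal n0.
(* Each new row must start at a point of the orbit that no earlier row contains; an earlier row
   contains the points of hs j and of sg (hs j). The last choice avoids four indices, so five
   elements suffice. *)
have [|h1 H1] := @pick_avoid [:: h0; sg h0]; first exact: leq_trans n5.
have [|h2 H2] := @pick_avoid [:: h0; sg h0; h1; sg h1]; first exact: leq_trans n5.
pose hs (i : 'I_3) := nth h0 [:: h0; h1; h2] i.
have hsP (i j : 'I_3) : (j < i)%N -> hs i != hs j /\ hs i != sg (hs j).
  move: H1 H2; rewrite !inE !negb_or => /andP[? ?] /and4P[? ? ? ?].
  by case: i j => [[|[|[|//]]] ?] [[|[|[|//]]] ?].
pose L x : 'M[R]_(3, N) := \matrix_(i < 3, l < N) (mono l (g (hs i) x) - mono l (g (hs i) (g k x))).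
have Lmul x a i : (L x *m a) i ord0 = fa a (g (hs i) x) - fa a (g (hs i) (g k x)).
  by rewrite mxE /fa -sumrB; apply: eq_bigr => l _; rewrite mxE mulrBl.
have gk i x : g i (g k x) = g (sg i) x by rewrite sgE.
have [c ac cx] := atlas_cover x0.
have [|||U nU rU] := @rare_loclip R _ N x0 2 3 L (chart_coords c) isT.
- exact: chart_coords_continuous.
- move=> i l; under [X in loclip _ _ X]eq_fun do rewrite mxE gk.
  by apply: loclipB; apply: (loclip_Sm ac cx); exact: Sm_mono_g.
- apply: row_free_triangular => i.
  (* The second point of row i and both points of every earlier row. *)
  pose ps := [:: g (sg (hs i)) x0] ++ [seq g (hs j) x0 | j <- [seq j : 'I_3 <- enum 'I_3 | (j < i)%N]] ++
    [seq g (sg (hs j)) x0 | j <- [seq j : 'I_3 <- enum 'I_3 | (j < i)%N]].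
  have sgi : hs i != sg (hs i).
    apply/eqP => E; apply: kid; apply/funext => y.
    have := congr1 (fun m => g m y) E; rewrite /= sgE /= => /(G_inj GG (Gg _)) //.
  have [||a [a1 a2]] := @separate R S I i0 u D u1 usep (g (hs i) x0) ps.
  + rewrite !mem_cat !negb_or; apply/and3P; split.
    * by rewrite ?andbT; apply/eqP => /(free_inj fx)/eqP; rewrite (negbTE sgi).
    * apply/mapP => -[j]; rewrite mem_filter => /andP[ji _] /(free_inj fx)/eqP.
      by have [/negbTE -> _] := hsP _ _ ji.
    * apply/mapP => -[j]; rewrite mem_filter => /andP[ji _] /(free_inj fx)/eqP.
      by have [_ /negbTE ->] := hsP _ _ ji.
  + have : (size [seq j : 'I_3 <- enum 'I_3 | (j < i)%N] <= 3)%N.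
      by rewrite size_filter (leq_trans (count_size _ _)) // size_enum_ord.
    rewrite size_cat size_cat 2!size_map /=; set m := size _ => m3.
    apply: (@leq_trans 10); last by rewrite -[10%N]/(5.*2) leq_double.
    by rewrite add1n ltnS; apply: leq_trans (leq_add m3 m3) _.
  exists a; split.
    by rewrite Lmul gk (a2 (g (sg (hs i)) x0)) ?subr0 // mem_cat inE eqxx.
  move=> j ji; have jf : j \in [seq j : 'I_3 <- enum 'I_3 | (j < i)%N] by rewrite mem_filter ji mem_enum.
  rewrite Lmul gk (a2 (g (hs j) x0)) ?(a2 (g (sg (hs j)) x0)) ?subr0 // !mem_cat.
    by rewrite (map_f (fun j => g (sg (hs j)) x0) jf) !orbT.
  by rewrite (map_f (fun j => g (hs j) x0) jf) !orbT.
exists U => //; apply: rareS rU => a [x Ux ca]; exists x => //.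
by apply/colP => i; rewrite Lmul mxE ca subrr.
Qed.

(** The case of [rare_local] with no parameters, over a one-point family. *)
Lemma rare_kernel m (L : 'M[R]_(m, N)) : (0 < m)%N -> row_free L ->
  rare [set a | L *m a = 0].
Proof.
move=> m0 /row_freeP[W LW].
apply: rareS (@rare_local R N unit setT 0 m (fun=> L) (fun _ _ => 0) W 0 1 m0 ltr01 (lexx 0) _ _ _).
- by move=> a La; exists tt.
- by move=> x i _; rewrite normr0.
- by move=> x y i j _ _; rewrite subrr normr0 mul0r.
- by move=> x i j _; rewrite LW subrr mxE normr0 invr_ge0 mulr_ge0.
Qed.

Lemma D_gt0 : (0 < D)%N.
Proof. by rewrite double_gt0; exact: leq_trans n5. Qed.

(** For one fixed pair a single equation is enough, the one for the identity of the group; its row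
    is nonzero because some u i separates x from y. *)
Lemma rare_pair (x y : S) : x <> y -> rare [set a | coll a x y].
Proof.
move=> xy; have [m mid] := g_id.
have [i ui] := usep xy.
pose L : 'M[R]_(1, N) := \row_k (mono k x - mono k y).
have Lmul a : (L *m a) ord0 ord0 = fa a x - fa a y.
  by rewrite mxE /fa -sumrB; apply: eq_bigr => l _; rewrite mxE mulrBl.
apply: (rareS _ (@rare_kernel 1 L isT _)); last first.
  apply: row_free_triangular => j; rewrite ord1.
  have [a aE] := coord_fa u1 i D_gt0; exists a; split; last by move=> k; rewrite ltn0.
  by rewrite Lmul aE subr_eq0.
move=> a ca /=; apply/colP => j; rewrite ord1 Lmul mxE.
by have := ca m; rewrite mid => ->; rewrite subrr.
Qed.

(* Up to scaling every direction is one of these with |t| <= 1, so the directions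
   are covered by two segments. *)
Definition vec (e : bool) (t : R) : R * R := if e then (1, t) else (t, 1).

Lemma vecE e t : vec e t = vec e 0 + t *: (if e then (0, 1) else (1, 0)).
Proof.
by case: e; rewrite /vec; congr (_, _); rewrite /= ?[t *: (1 : R)]mulr1 ?scaler0 ?addr0 ?add0r.
Qed.

Lemma vec_neq0 e t : vec e t != 0.
Proof.
by case: e; apply/eqP => /pair_equal_spec[h1 h2]; [move: h1|move: h2] => /eqP; rewrite oner_eq0.
Qed.

Lemma vec_decomp (v : R * R) : v != 0 -> exists r e t, [/\ r != 0, `|t| <= 1 & v = r *: vec e t].
Proof.
case: v => p q v0; have [qp|pq] := leP `|q| `|p|.
  have p0 : p != 0.
    apply: contra v0 => /eqP p0; rewrite p0 normr0 normr_le0 in qp.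
    by rewrite p0 (eqP qp).
  exists p, true, (q / p); split=> //.
    by rewrite normrM normfV ler_pdivrMr ?normr_gt0 // mul1r.
  by rewrite /vec; congr (_, _); rewrite /= /GRing.scale /= ?mulr1 // mulrC divfK.
have q0 : q != 0 by rewrite -normr_gt0 (le_lt_trans (normr_ge0 p) pq).
exists q, false, (p / q); split=> //.
  by rewrite normrM normfV ler_pdivrMr ?normr_gt0 // mul1r ltW.
by rewrite /vec; congr (_, _); rewrite /= /GRing.scale /= ?mulr1 // mulrC divfK.
Qed.

(** The derivative of the chart change carries the critical direction into the chart c, where it is
    rescaled to some [vec e t]. *)
Lemma crit_chart a x c : crit a x -> atlas c -> dom c x ->
  exists e t, `|t| <= 1 /\ forall i, T c x (vec e t) (fa a \o g i) = 0.
Proof.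
move=> [d [v [ad dx v0 H]]] ac cx.
have hid := holomorphic_id S.
have V : trans_dom d c id (coord d x) by split; rewrite /= ?coordK //; exact: coord_img.
have dl := derivable_cder (holomorphic_trans ad ac hid V).
have Gid : G id by case: GG.
have l0 := multiplier_neq0 GG Gid ad ac dx (cx : dom c (id x)) dl.
set w := ofC ('D_1 (trans d c id) (coord d x) * toC v).
have w0 : w != 0.
  apply/eqP => E; have : 'D_1 (trans d c id) (coord d x) * toC v = 0 by rewrite -[LHS]ofCK -/w E.
  move=> /eqP; rewrite mulf_eq0 (negbTE l0) /= => /eqP v00.
  by move: v0; rewrite -(toCK v) v00 eqxx.
have Hw i : T c x w (fa a \o g i) = 0.
  by rewrite -(@T_comp R S d c id x _ v _ (Sm_fa_g a i) ad ac hid dx cx dl) H.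
have [r [e [t [r0 t1 wE]]]] := vec_decomp w0.
exists e, t; split=> // i; have := Hw i; rewrite wE (TZ _ _ ac cx (Sm_fa_g a i)) => /eqP.
by rewrite mulf_eq0 (negbTE r0) => /eqP.
Qed.

(** The derivative along [vec e t], written as an affine function of t so that its Lipschitz
    dependence on the pair (x, t) follows from that of sums and products. *)
Definition Tt c (e : bool) (p : S * R) (f : S -> R) : R :=
  T c p.1 (vec e 0) f + p.2 * T c p.1 (if e then (0, 1) else (1, 0)) f.

Lemma TtE c e x t f : atlas c -> dom c x -> Sm f -> Tt c e (x, t) f = T c x (vec e t) f.
Proof. by move=> ac cx sf; rewrite (vecE e t) TD. Qed.

Lemma loclip_Tt c e x t f : atlas c -> dom c x -> Sm f ->
  loclip (x, t) (scat (chart_coords c) (fun t (_ : 'I_1) => t)) (fun p => Tt c e p f).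
Proof.
move=> ac cx sf; apply: loclipD.
  exact: (loclip_fst t _ (loclip_T (vec e 0) ac cx sf)).
apply: loclipM.
- exact: cvg_snd.
- apply: (@continuous_comp _ _ _ fst (fun y => T c y _ f)); first exact: cvg_fst.
  exact: T_continuous.
- exact: (loclip_snd x (chart_coords c) (loclip_coord t (fun t (_ : 'I_1) => t) ord0)).
- exact: (loclip_fst t _ (loclip_T _ ac cx sf)).
Qed.

Definition LD c e (p : S * R) : 'M[R]_(n, N) := \matrix_(i < n, k < N) Tt c e p (mono k \o g i).

Lemma LD_mul c e x t a i : atlas c -> dom c x ->
  (LD c e (x, t) *m a) i ord0 = T c x (vec e t) (fa a \o g i).
Proof.
move=> ac cx; rewrite (@T_fa R S I u D uS c x (vec e t) (g i) a ac cx (holo_g i)) mxE.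
by apply: eq_bigr => k _; rewrite mxE TtE //; exact: Sm_mono_g.
Qed.

(** The points g i x0 are distinct, so the n derivatives can be prescribed one at a time by
    [separate_jet], with n - 1 points to avoid and 2 (n - 1) < D. *)
Lemma rare_crit_free x0 : free x0 ->
  exists2 U, nbhs x0 U & rare [set a | exists2 x, U x & crit a x].
Proof.
move=> fx; have [c ac cx] := atlas_cover x0.
have loc e (t0 : R) : exists2 U, nbhs (x0, t0) U &
    rare [set a : 'cV_N | exists2 p, U p & LD c e p *m a = 0].
  have [|||U nU rU] := @rare_loclip R (S * R)%type N (x0, t0) (2 + 1) n (LD c e)
    (scat (chart_coords c) (fun (t : R) (_ : 'I_1) => t)) (leq_trans (isT : 3 < 5)%N n5).
  - apply: scat_continuous; first exact: chart_coords_continuous.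
    by move=> k A.
  - move=> i k; under [X in loclip _ _ X]eq_fun do rewrite mxE.
    by apply: loclip_Tt => //; exact: Sm_mono_g.
  - apply: row_free_triangular => i.
    have [d [w [ad dx w0 TE]]] := T_group GG (Gg i) ac cx (vec_neq0 e t0).
    pose ps := [seq g j x0 | j <- rem i (enum 'I_n)].
    have [||a [a1 a2]] := @separate_jet R S I i0 u D uS u1 usep uimm (g i x0) ps d w _ _ ad dx w0.
    + apply/mapP => -[j jr E].
      by move: jr; rewrite (free_inj fx E) mem_rem_uniqF ?enum_uniq.
    + rewrite size_map size_rem ?mem_enum // size_enum_ord ltn_double.
      by rewrite ltn_predL; exact: leq_trans n5.
    exists a; split; first by rewrite LD_mul // TE //; exact: Sm_fa.
    move=> j ji; rewrite LD_mul //.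
    have [d' [w' [ad' dx' _ TE']]] := T_group GG (Gg j) ac cx (vec_neq0 e t0).
    rewrite TE'; last exact: Sm_fa.
    apply: a2 => //; apply: map_f; rewrite mem_rem_uniq ?enum_uniq // inE mem_enum andbT.
    by apply: contraTneq ji => ->; rewrite ltnn.
  by exists U.
(* Tube argument: compactness of [-1, 1] gives one neighbourhood of x0 that serves for all
   directions of the segment. *)
have tube e : exists U : set S, nbhs x0 U /\
    rare [set a : 'cV_N | exists x t, [/\ U x, `[-1, 1]%classic t & LD c e (x, t) *m a = 0]].
  apply: (@compact_ind R `[-1, 1]%classic (fun B => exists U : set S, nbhs x0 U /\
    rare [set a : 'cV_N | exists x t, [/\ U x, B t & LD c e (x, t) *m a = 0]])).
  - exact: segment_compact.
  - exists setT; split; first exact: filterT.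
    by apply: rareS (@rare0 R N) => a [x [t []]].
  - move=> A B [U [nU rU]] [V [nV rV]]; exists (U `&` V); split; first exact: filterI.
    apply: rareS (rareU rU rV) => a [x [t [[Ux Vx] [At|Bt] E]]]; [left|right]; by exists x, t.
  - move=> A B AB [U [nU rU]]; exists U; split=> //; apply: rareS rU => a [x [t [Ux /AB Bt E]]].
    by exists x, t.
  move=> t0 _; have [W [[U V] /= [nU nV] UV] rW] := loc e t0.
  exists V => //; exists U; split=> //; apply: rareS rW => a [x [t [Ux Vt E]]].
  by exists (x, t) => //; exact: UV.
have [U1 [nU1 rU1]] := tube true; have [U2 [nU2 rU2]] := tube false.
exists ((U1 `&` U2) `&` dom c).
  apply: filterI; first exact: filterI.
  exact: open_nbhs_nbhs (conj (@open_dom _ _ c) cx).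
apply: rareS (rareU rU1 rU2) => a [x [[U1x U2x] dx] /crit_chart/(_ ac dx)[e [t [t1 H]]]].
have E : LD c e (x, t) *m a = 0 by apply/colP => i; rewrite LD_mul // H mxE.
have tI : `[-1, 1]%classic t by rewrite /= in_itv /= -ler_norml.
by case: e E {H} => E; [left|right]; exists x, t.
Qed.

Lemma real_root (l : R[i]) m : (0 < m)%N -> l ^+ m = 1 -> Im l = 0 -> l = 1 \/ l = -1.
Proof.
case: l => r s m0 lm /= s0; rewrite s0 in lm *.
have : (r ^+ m)%:C%C = 1 :> R[i] by rewrite rmorphXn.
move=> /(congr1 Re) /= rm.
have : `|r| ^+ m = 1 by rewrite -normrX rm normr1.
move=> /eqP; rewrite pexpr_eq1 // => /eqP nr.
have [r0|r0] := leP 0 r.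
  by left; rewrite (_ : r = 1) // -nr ger0_norm.
by right; apply/eqP; rewrite eq_complex /= oppr0 eqxx andbT -nr ltr0_norm ?opprK.
Qed.

(* If all multipliers at x were real they would be 1 or -1; as the multiplier determines
   the element of the stabilizer, |G| <= 2 would follow. *)
Lemma exists_rotation x c : atlas c -> dom c x -> (forall i, g i x = x) ->
  exists i l, cder (trans c c (g i)) (coord c x) l /\ Im l != 0.
Proof.
move=> ac cx fx; apply: contrapT => H.
have mult i : exists l, cder (trans c c (g i)) (coord c x) l.
  by eexists; exact: derivable_cder (holomorphic_trans ac ac (holo_g i) (fix_trans_dom cx (fx i))).
have real i l : cder (trans c c (g i)) (coord c x) l -> l = 1 \/ l = -1.
  move=> dl; have [m m0 lm] := multiplier_root GG ac cx (Gg i) (fx i) dl.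
  by apply: (real_root m0 lm); apply: contrapT => /eqP nl; apply: H; exists i, l.
have neg i : g i <> id -> cder (trans c c (g i)) (coord c x) (-1).
  move=> nid; have [l dl] := mult i; have [E|E] := real i l dl; rewrite E in dl => //.
  by case: nid; exact: (multiplier_id GG ac cx (Gg i) (fx i) dl).
have [m0 m0E] := g_id.
have [|i1 H1] := @pick_avoid [:: m0]; first exact: leq_trans n5.
have [|i2 H2] := @pick_avoid [:: m0; i1]; first exact: leq_trans n5.
move: H1 H2; rewrite !inE negb_or => /eqP H1 /andP[/eqP H2 /eqP H3].
have nid1 : g i1 <> id by rewrite -m0E => /ginj.
have nid2 : g i2 <> id by rewrite -m0E => /ginj.
have [k [k1 k2]] := g_inv i1.
have nidk : g k <> id.
  move=> kE; apply: nid1; apply/funext => y; have := k2 y.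
  by rewrite kE.
(* The inverse g k of g i1 composed with g i2 has multiplier (-1)(-1) = 1, hence is the identity,
   and i1 = i2. *)
have dd := cder_trans_comp (holo_g i2) (fix_trans_dom cx (fx i2)) (neg i2 nid2).
have := dd c (g k) (-1); rewrite fix_trans // => /(_ (neg k nidk)); rewrite mulrNN mulr1 => d1.
have [m mE] := g_comp k i2.
have cid : g k \o g i2 = id.
  rewrite -mE; apply: (multiplier_id GG ac cx (Gg m) (fx m)); by rewrite mE.
apply: H3; apply: ginj; apply/funext => y.
by have := congr1 (fun h => g i1 (h y)) cid; rewrite /= k2.
Qed.

(* The point is fixed and the direction varies in dimension 1, so two independent
   conditions suffice, from two orbit points or from a non-real multiplier. *)
Lemma rare_crit x : rare [set a | crit a x].
Proof.
have [c ac cx] := atlas_cover x.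
have [m0 m0E] := g_id.
have [m2 Hm2] : exists m2, g m2 x <> x \/ (g m2 x = x /\ exists l,
    cder (trans c c (g m2)) (coord c x) l /\ Im l != 0).
  have [[i gi]|all] := pselect (exists i, g i x <> x); first by exists i; left.
  have fx i : g i x = x by apply: contrapT => h; apply: all; exists i.
  by have [i Hi] := exists_rotation ac cx fx; exists i; right.
pose hs (r : 'I_2) := if r == 0 :> nat then m0 else m2.
pose L e (t : R) : 'M[R]_(2, N) := \matrix_(r < 2, k < N) Tt c e (x, t) (mono k \o g (hs r)).
have Lmul e t a r : (L e t *m a) r ord0 = T c x (vec e t) (fa a \o g (hs r)).
  rewrite (@T_fa R S I u D uS c x (vec e t) (g (hs r)) a ac cx (holo_g _)) mxE.
  by apply: eq_bigr => k _; rewrite mxE TtE //; exact: Sm_mono_g.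
have Lfree e t : row_free (L e t).
  have v0 := vec_neq0 e t; set v := vec e t in v0.
  case: Hm2 => [nx|[fx [l [dl il]]]].
    apply: row_free_triangular => r; case: r => [[|[|//]]] lt.
      have [i Hi] := uimm ac cx v0; have [a aE] := coord_fa u1 i D_gt0.
      by exists a; split=> // ; rewrite Lmul /hs /= m0E aE.
    have [d [w [ad dx w0 TE]]] := T_group GG (Gg m2) ac cx v0.
    have [||a [a1 a2]] := @separate_jet R S I i0 u D uS u1 usep uimm (g m2 x) [:: x] d w _ _ ad dx w0.
    + by rewrite inE; apply/eqP.
    + by rewrite /= ltn_double; exact: leq_trans n5.
    exists a; split; first by rewrite Lmul /hs /= TE //; exact: Sm_fa.
    move=> j; rewrite ltnS leqn0 => /eqP j0; rewrite Lmul /hs j0 /= m0E.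
    by apply: a2 => //; rewrite inE.
  (* A left kernel vector (r0, r1) makes every coordinate function have derivative 0 along r0 v + r1
     l v, so this vector is 0. Then r0 + r1 l = 0, and as l is not real, r1 = 0 and r0 = 0. *)
  apply: inj_row_free => r rL.
  have key a : r ord0 ord0 * T c x v (fa a) + r ord0 (lift ord0 ord0) * T c x (ofC (l * toC v)) (fa a) = 0.
    have : (r *m (L e t *m a)) ord0 ord0 = 0 by rewrite mulmxA rL mul0mx mxE.
    rewrite mxE !big_ord_recl big_ord0 addr0 !Lmul /hs /= m0E.
    have sfa := @Sm_fa R S I u D uS a.
    rewrite (@T_comp R S c c (g m2) x l _ _ sfa ac ac (holo_g m2) cx _ dl) ?fx //.
  set r0 := r ord0 ord0 in key; set r1 := r ord0 _ in key.
  have z0 : r0 *: v + r1 *: ofC (l * toC v) = 0.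
    apply: contrapT => /eqP nz; case: (uimm ac cx nz) => i; have [a aE] := coord_fa u1 i D_gt0.
    rewrite -aE; have sfa := @Sm_fa R S I u D uS a.
    by rewrite (TD _ _ _ ac cx sfa) (TZ _ _ ac cx sfa) key eqxx.
  have z1 : ((r0%:C)%C + (r1%:C)%C * l) * toC v = 0.
    have := congr1 (@toC R) z0; case: (l) => la lb; case: (v) => va vb /= [] h1 h2.
    apply/eqP; rewrite eq_complex /=; apply/andP; split; apply/eqP; [rewrite -[RHS]h1|rewrite -[RHS]h2];
      rewrite /GRing.scale /=; ring.
  have tv0 : toC v != 0 by apply: contra v0 => /eqP tv; rewrite -(toCK v) tv.
  move: z1 => /eqP; rewrite mulf_eq0 (negbTE tv0) orbF => /eqP z2.
  have i2 : r1 * Im l = 0 by have := congr1 Im z2; rewrite ImD ImM /= mul0r addr0 add0r.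
  have r10 : r1 = 0 by move/eqP: i2; rewrite mulf_eq0 (negbTE il) orbF => /eqP.
  have r00 : r0 = 0 by have := congr1 Re z2; rewrite ReD ReM /= r10 !mul0r subr0 addr0.
  apply/rowP => j; rewrite mxE; case: (unliftP ord0 j) => [j' ->|->] //.
  by rewrite (ord1 j').
have rE e : rare [set a : 'cV_N | exists2 t, `[-1, 1]%classic t & L e t *m a = 0].
  apply: (@rare_compact R N R `[-1, 1]%classic (fun t => [set a | L e t *m a = 0])).
    exact: segment_compact.
  move=> t0 _; apply: (@rare_loclip R R N t0 1 2 (L e) (fun t (_ : 'I_1) => t)) => //.
    by move=> k A.
  move=> r k; under [X in loclip _ _ X]eq_fun do rewrite mxE /Tt /=.
  have cst b : loclip t0 (fun t (_ : 'I_1) => t) (fun=> b : R).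
    by exists 0, setT; split; [exact: filterT|move=> *; rewrite subrr normr0 mul0r].
  apply: loclipD; first exact: cst.
  apply: loclipM; [by move=> A|exact: cst_continuous| |exact: cst].
  exact: (loclip_coord t0 (fun t (_ : 'I_1) => t) ord0).
apply: rareS (rareU (rE true) (rE false)) => a /crit_chart/(_ ac cx)[e [t [t1 H]]].
have E : L e t *m a = 0 by apply/colP => r; rewrite Lmul H mxE.
have tI : `[-1, 1]%classic t by rewrite /= in_itv /= -ler_norml.
by case: e E {H} => E; [left|right]; exists t.
Qed.

End Strata.

Section Exhaustion.
Variables (R : realType).

(** The open set gam > 0 need not be compact, but the closed pieces gam >= 1 / (j + 1) are, and
    together they exhaust it. *)
Lemma rare_exhaustion N (X : topologicalType) (gam : X -> R) (bad : X -> set 'cV[R]_N) j :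
  compact [set: X] -> continuous gam ->
  (forall x, 0 < gam x -> exists2 U, nbhs x U & rare [set a | exists2 y, U y & bad y a]) ->
  rare [set a | exists2 x, j.+1%:R^-1 <= gam x & bad x a].
Proof.
move=> cX cg loc; apply: (@rare_compact R N X [set x | j.+1%:R^-1 <= gam x] bad).
  apply: (subclosed_compact _ cX) => //.
  exact: (@closed_comp _ _ gam [set r | j.+1%:R^-1 <= r] (fun x _ => cg x) (@closed_ge R j.+1%:R^-1)).
by move=> x /= jx; apply: loc; exact: lt_le_trans jx.
Qed.

Lemma exists_natSinv_le (r : R) : 0 < r -> exists j : nat, j.+1%:R^-1 <= r.
Proof.
move=> r0; exists (Num.bound r^-1); rewrite invf_ple ?posrE //.
apply: ltW; apply: lt_le_trans (archi_boundP _) _; first by rewrite invr_ge0 ltW.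
by rewrite ler_nat.
Qed.

End Exhaustion.

(** * The generic parameter by Baire's theorem *)

Section Generic.
Variables (R : realType) (S : riemannSurface R) (G : set (S -> S)).
Hypotheses (cS : closed_surface S) (GG : finite_automorphism_group G).
Variables (n : nat) (g : 'I_n -> S -> S).
Hypotheses (n5 : (5 <= n)%N) (Gg : forall i, G (g i)) (ginj : injective g).
Hypothesis gsurj : forall h, G h -> exists i, g i = h.
Variables (I : finType) (i0 : I) (u : I -> S -> R).
Hypotheses (uS : forall i, Sm (u i)) (u1 : u i0 = (fun=> 1)).
Hypothesis usep : forall x y, x <> y -> exists i, u i x != u i y.
Hypothesis uimm : forall x c v, atlas c -> dom c x -> v != 0 -> exists i, T c x v (u i) != 0.
Local Notation N := #|{ffun 'I_(n.*2) -> I}|.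
Local Notation free := (@free R S n g).
Local Notation coll := (@coll R S n g I u).
Local Notation crit := (@crit R S n g I u).
Implicit Types a : 'cV[R]_N.

(** A continuous function that vanishes exactly on the diagonal. Products of it express, as
    positivity of a continuous function, that a point is free or that a pair lies in different
    orbits. *)
Definition sep (x y : S) : R := \sum_b (u b x - u b y) ^+ 2.

Lemma sep_ge0 x y : 0 <= sep x y.
Proof. by apply: sumr_ge0 => b _; exact: sqr_ge0. Qed.

Lemma sep_eq0 x y : (sep x y = 0) <-> x = y.
Proof.
split=> [E|->]; last by rewrite /sep big1 // => b _; rewrite subrr expr0n.
apply: contrapT => /usep [b ub].
have := psumr_eq0P (fun b _ => sqr_ge0 (u b x - u b y)) E => /(_ b isT) /eqP.
by rewrite sqrf_eq0 subr_eq0 (negbTE ub).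
Qed.

Lemma sep_continuous (X : topologicalType) (p q : X -> S) : continuous p -> continuous q ->
  continuous (fun x => sep (p x) (q x)).
Proof.
move=> cp cq x; apply: (@cvg_big _ _ _ _ _ _ _ _ _ (fun b x => (u b (p x) - u b (q x)) ^+ 2) (fun b => (u b (p x) - u b (q x)) ^+ 2)) => [|b _].
  exact: add_continuous.
have h (p' : X -> S) : continuous p' -> (fun y => u b (p' y)) @ x --> u b (p' x).
  move=> cp'; apply: (@continuous_comp _ _ _ p' (u b)); first exact: cp'.
  exact: (Sm_continuous (uS b)).
have hd : (fun y => u b (p y) - u b (q y)) @ x --> u b (p x) - u b (q x) by apply: cvgB; exact: h.
by rewrite expr2; under eq_fun do rewrite expr2; exact: cvgM.
Qed.

Variable m0 : 'I_n.
Hypothesis m0E : g m0 = id.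

Definition freeness (y : S) : R := \prod_(i | i != m0) sep y (g i y).

Definition genericity (p : S * S) : R := \prod_i sep p.1 (g i p.2) * freeness p.2.

Lemma g_continuous i : continuous (g i).
Proof. by case: (holo_g GG Gg i). Qed.

Lemma freeness_continuous : continuous freeness.
Proof.
move=> x; apply: (@cvg_big _ _ _ _ _ _ _ _ _ (fun i y => sep y (g i y)) (fun i => sep x (g i x))).
- exact: mul_continuous.
- by move=> i _; apply: sep_continuous; [move=> y; exact: cvg_id|exact: g_continuous].
Qed.

Lemma genericity_continuous : continuous genericity.
Proof.
move=> p; apply: cvgM.
  apply: (@cvg_big _ _ _ _ _ _ _ _ _ (fun i p => sep p.1 (g i p.2)) (fun i => sep p.1 (g i p.2))).
  - exact: mul_continuous.
  - move=> i _; apply: (sep_continuous (p := fst) (q := g i \o snd)).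
      by move=> y; exact: cvg_fst.
    by move=> y; apply: continuous_comp; [exact: cvg_snd|exact: g_continuous].
by apply: continuous_comp; [exact: cvg_snd|exact: freeness_continuous].
Qed.

Lemma freeness_gt0 y : (0 < freeness y) <-> free y.
Proof.
split.
  move=> f0 i gi E; have im : i != m0 by apply: contra_notN gi => /eqP ->.
  by move: f0; rewrite /freeness (bigD1 i) //= (sep_eq0 y (g i y)).2 ?mul0r ?ltxx.
move=> fy; apply: prodr_gt0 => i im; rewrite lt_neqAle sep_ge0 andbT eq_sym.
apply/eqP => /sep_eq0 E; apply: (fy i) => // gi.
by move/eqP: im; apply; apply: ginj; rewrite gi.
Qed.

Lemma genericity_gt0 p : (0 < genericity p) <-> free p.2 /\ forall i, p.1 <> g i p.2.
Proof.
have pg : 0 <= \prod_i sep p.1 (g i p.2) by apply: prodr_ge0 => i _; exact: sep_ge0.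
split.
  move=> h; have [f0|f0] := ltP 0 (freeness p.2); last first.
    by move: h; rewrite /genericity ltNge mulr_ge0_le0.
  split; first exact/freeness_gt0.
  move=> i E; move: h; rewrite /genericity (bigD1 i) //= (sep_eq0 p.1 (g i p.2)).2 //.
  by rewrite !mul0r ltxx.
move=> [fy xy]; apply: mulr_gt0; last exact/freeness_gt0.
apply: prodr_gt0 => i _; rewrite lt_neqAle sep_ge0 andbT eq_sym.
by apply/eqP => /sep_eq0; exact: xy.
Qed.

Lemma nonfree_finite : exists Z : seq S, forall x, ~ free x -> x \in Z.
Proof.
have H i : exists s : seq S, g i <> id -> forall x, g i x = x -> x \in s.
  have [gi|gi] := pselect (g i = id); first by exists [::].
  by have [s Hs] := fix_finite GG cS (Gg i) gi; exists s.
have [s Hs] := choice H; exists (flatten [seq s i | i <- enum 'I_n]) => x nf.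
have [i gi] : exists i, g i <> id /\ g i x = x.
  apply: contrapT => nx; apply: nf => i gi E; apply: nx; by exists i.
apply/flattenP; exists (s i); first by apply: map_f; rewrite mem_enum.
by case: gi => ? ?; exact: Hs.
Qed.

Lemma generic_parameter : exists a,
  (forall x y, coll a x y -> x = y) /\ forall x, ~ crit a x.
Proof.
have [Z HZ] := nonfree_finite.
have cSS : compact [set: S * S] by rewrite -setXTT; exact: compact_setX.
(* The cases are: a pair in different orbits with free second point; a pair in one free orbit; a
   free critical point; a pair of distinct points with nontrivial stabilizers; a critical point with
   nontrivial stabilizer. Only the first three need an exhaustion, the others being finite. *)
pose E1 j := [set a | exists2 p, j.+1%:R^-1 <= genericity p & coll a p.1 p.2].
pose E2 j := [set a | exists2 k, k \in enum 'I_n &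
  exists2 y, j.+1%:R^-1 <= freeness y & g k <> id /\ coll a y (g k y)].
pose E3 j := [set a | exists2 y, j.+1%:R^-1 <= freeness y & crit a y].
pose E4 := [set a | exists2 p, p \in [seq (x, y) | x <- Z, y <- Z] & p.1 <> p.2 /\ coll a p.1 p.2].
pose E5 := [set a | exists2 x, x \in Z & crit a x].
have r1 j : rare (E1 j).
  apply: (@rare_exhaustion R N _ genericity (fun p a => coll a p.1 p.2)) => //.
    exact: genericity_continuous.
  move=> [x y] /genericity_gt0 [fy xy].
  exact: (rare_generic_pair GG n5 Gg ginj gsurj uS u1 usep).
have r2 j : rare (E2 j).
  apply: rare_bigcup_fin => k.
  have [gk|gk] := pselect (g k = id); first by apply: rareS (@rare0 R N) => a [y _ []].
  apply: (@rare_exhaustion R N _ freeness (fun y a => g k <> id /\ coll a y (g k y))) => //.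
    exact: freeness_continuous.
  move=> y /freeness_gt0 fy.
  have [U nU rU] := rare_orbit_pair GG n5 Gg ginj gsurj uS u1 usep gk fy.
  by exists U => //; apply: rareS rU => a [z Uz []]; exists z.
have r3 j : rare (E3 j).
  apply: (@rare_exhaustion R N _ freeness (fun y a => crit a y)) => //.
    exact: freeness_continuous.
  move=> y /freeness_gt0 fy.
  exact: (rare_crit_free GG n5 Gg ginj gsurj uS u1 usep uimm).
have r4 : rare E4.
  apply: rare_bigcup_fin => -[x y] /=.
  have [->|xy] := pselect (x = y); first by apply: rareS (@rare0 R N) => a [].
  by have := rare_pair GG n5 gsurj u1 usep xy; apply: rareS => a [].
have r5 : rare E5.
  by apply: rare_bigcup_fin => x; exact: (rare_crit GG n5 Gg ginj gsurj uS u1 usep uimm).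
have [a Ha] := rare_baire (fun j => rareU (rareU (r1 j) (r2 j)) (rareU (r3 j) (rareU r4 r5))).
exists a.
have key x y : free y -> coll a x y -> x = y.
  move=> fy cxy; have [[i xE]|nx] := pselect (exists i, x = g i y).
    have [gi|gi] := pselect (g i = id); first by rewrite xE gi.
    have [j jy] := exists_natSinv_le ((freeness_gt0 y).2 fy).
    case: (Ha j); left; right; exists i; first by rewrite mem_enum.
    by exists y => //; split=> // k; rewrite -xE cxy.
  have gp : 0 < genericity (x, y).
    by apply/genericity_gt0; split=> // i xE; apply: nx; exists i.
  have [j jp] := exists_natSinv_le gp.
  by case: (Ha j); left; left; exists (x, y).
split=> [x y cxy|x cx].
  have [fy|nfy] := pselect (free y); first exact: key.
  (* When x is the free point, the symmetry of [coll] lets the two points change roles. *)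
  have [fx|nfx] := pselect (free x); first by apply/esym/key => // i; rewrite cxy.
  apply: contrapT => xy; case: (Ha 0%N); right; right; left.
  by exists (x, y) => //; apply/allpairsP; exists (x, y); split=> //=; exact: HZ.
have [fx|nfx] := pselect (free x).
  have [j jx] := exists_natSinv_le ((freeness_gt0 x).2 fx).
  by case: (Ha j); right; left; exists x.
by case: (Ha 0%N); right; right; right; exists x => //; exact: HZ.
Qed.

End Generic.

(** * The orbit map *)

Section RegularRepresentation.
Variables (R : realType) (S : riemannSurface R) (G : set (S -> S)).
Hypotheses (cS : closed_surface S) (GG : finite_automorphism_group G).
Variables (n : nat) (g : 'I_n -> S -> S).
Hypotheses (Gg : forall i, G (g i)) (ginj : injective g).
Hypothesis gsurj : forall h, G h -> exists i, g i = h.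
Variable phi : S -> R.
Hypothesis Sphi : Sm phi.

Definition orbit_map (x : S) : 'cV[R]_n := \col_i phi (g i x).

Lemma orbit_map_sum x : orbit_map x = \sum_i phi (g i x) *: delta_mx i ord0.
Proof.
apply/colP => i; rewrite summxE (bigD1 i) //= big1 => [|j ji]; rewrite !mxE.
  by rewrite !eqxx mulr1 addr0.
by rewrite eq_sym (negbTE ji) mulr0.
Qed.

Lemma Sm_orbit i : Sm (phi \o g i).
Proof. exact: Sm_comp Sphi (holo_g GG Gg i). Qed.

Lemma orbit_map_continuous : continuous orbit_map.
Proof.
move=> x; rewrite (_ : orbit_map = fun x => \sum_i phi (g i x) *: delta_mx i ord0); last first.
  by apply/funext => y; exact: orbit_map_sum.
apply: (@cvg_big _ _ _ _ _ _ _ _ _ (fun i x => phi (g i x) *: delta_mx i ord0)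
  (fun i => phi (g i x) *: delta_mx i ord0)) => [|i _]; first exact: add_continuous.
by apply: cvgZr_tmp; exact: (Sm_continuous (Sm_orbit i)).
Qed.

Lemma smooth_orbit_map c : atlas c -> smooth_on (real_img c) (chart_expr orbit_map c).
Proof.
move=> ac k; have -> : chart_expr orbit_map c =
    fun p => \sum_i loc (phi \o g i) c p *: (delta_mx i ord0 : 'cV[R]_n).
  by apply/funext => p; rewrite /chart_expr orbit_map_sum.
have oi := @open_real_img R S c.
apply: Ck_sum => // i; apply: CkZr => //; exact: (Sm_orbit i ac k).
Qed.

Lemma immersive_orbit_map c : atlas c ->
  (forall x c v, atlas c -> dom c x -> v != 0 -> exists i, T c x v (phi \o g i) != 0) ->
  forall p, real_img c p -> injective ('d (chart_expr orbit_map c) p).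
Proof.
move=> ac imm p ip.
have [dp _] := smooth_orbit_map ac 1%N; have {}dp := dp p ip.
suff ker v : 'd (chart_expr orbit_map c) p v = 0 -> v = 0.
  by move=> v w E; apply/eqP; rewrite -subr_eq0; apply/eqP/ker; rewrite linearB E subrr.
move=> dv; apply: contrapT => /eqP v0.
have pE : ofC (Defs.coord c (param c (toC p))) = p by rewrite paramK ?toCK.
have cx : dom c (param c (toC p)) by exact: param_dom.
case: (imm _ c v ac cx v0) => i; rewrite /T pE => /eqP; apply.
have := deriveE v dp; rewrite dv derive_mx; last exact: diff_derivable.
move=> /matrixP/(_ i ord0); rewrite !mxE => <-.
by congr ('D_v _ p); apply/funext => q; rewrite /chart_expr mxE.
Qed.

Lemma orbit_map_embedding :
  (forall x y, (forall i, phi (g i x) = phi (g i y)) -> x = y) ->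
  (forall x c v, atlas c -> dom c x -> v != 0 -> exists i, T c x v (phi \o g i) != 0) ->
  smooth_embedding orbit_map.
Proof.
move=> sep imm.
have ei : injective orbit_map.
  by move=> x y E; apply: sep => i; have := congr1 (fun A : 'cV_n => A i ord0) E; rewrite !mxE.
split=> //.
- exact: smooth_orbit_map.
- by move=> c ac; exact: immersive_orbit_map.
- exact: orbit_map_continuous.
(* The complement of U is compact, so its image is compact and therefore closed. *)
move=> U oU; exists (~` (orbit_map @` ~` U)).
  rewrite openC; apply: compact_closed; first exact: norm_hausdorff.
  apply: continuous_compact; first exact/continuous_subspaceT/orbit_map_continuous.
  by apply: (subclosed_compact _ cS) => //; rewrite closedC.
apply/seteqP; split=> x /= h; first by apply: contrapT => nU; apply: h; exists x.
by move=> [y nU /ei yx]; apply: nU; rewrite yx.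
Qed.

Lemma orbit_map_equivariant : equivariant G orbit_map.
Proof.
have /choice[sg sgE] : forall h, exists s : 'I_n -> 'I_n, G h -> forall i, g (s i) = g i \o h.
  move=> h; have [Gh|nGh] := pselect (G h); last by exists id.
  have /choice[s sE] : forall i, exists j, g j = g i \o h.
    by move=> i; apply: gsurj; case: GG => _ _ _ GM _; exact: GM.
  by exists s.
(* The permutation matrix of right translation by h: entry i of the orbit map at h x is entry
   [sg h i] at x. Right translation reverses products, and so does the selection of rows, hence rho
   is a homomorphism. *)
pose rho h : 'M[R]_n := \matrix_(i, j) (j == sg h i)%:R.
have rho_mul h m (M : 'M[R]_(n, m)) i j : (rho h *m M) i j = M (sg h i) j.
  rewrite mxE (bigD1 (sg h i)) //= big1 => [|k ki]; rewrite mxE.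
    by rewrite eqxx mul1r addr0.
  by rewrite (negbTE ki) mul0r.
have sg_inj h : G h -> injective (sg h).
  move=> Gh i j E; apply: ginj; apply/funext => y.
  have [h' [_ _ hK]] : exists h', [/\ G h', cancel h h' & cancel h' h].
    by case: GG => _ _ _ _; exact.
  by have := congr1 (fun m => g m (h' y)) E; rewrite !sgE //= hK.
exists rho; split.
- move=> h Gh; apply: mulmx1C; apply/matrixP => i j.
  by rewrite rho_mul !mxE (inj_eq (sg_inj h Gh)).
- move=> h k Gh Gk; apply/matrixP => i j; rewrite rho_mul !mxE.
  have Ghk : G (h \o k) by case: GG => _ _ _ GM _; exact: GM.
  suff -> : sg (h \o k) i = sg k (sg h i) by [].
  by apply: ginj; rewrite !sgE.
(* The row of the identity element determines h, as g (sg h m) = h when g m = id. *)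
- move=> h k Gh Gk E; have [m mE] := g_id GG gsurj.
  have : sg h m = sg k m.
    apply/eqP; have := congr1 (fun A : 'M[R]_n => A m (sg h m)) E; rewrite !mxE eqxx.
    by case: eqP => // _ /eqP; rewrite oner_eq0.
  by move=> /(congr1 g); rewrite !sgE // mE.
- move=> h x Gh; apply/colP => i; rewrite rho_mul !mxE.
  by rewrite (sgE h Gh i).
Qed.

End RegularRepresentation.

Theorem theorem1p4 (R : realType) (g : nat) (S : riemannSurface R)
    (G : set (S -> S)) :
  closed_surface S -> has_genus S g -> finite_automorphism_group G ->
  (5 <= #|` fset_set G|)%N ->
  exists2 d : nat, min_embedding_dim G d & (d <= #|` fset_set G|)%N.
Proof.
move=> cS _ GG G5; set n := #|` fset_set G| in G5 *.
have fG : finite_set G by case: GG.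
pose el (i : 'I_n) : S -> S := nth (id : S -> S) (fset_set G) i.
have Gel i : G (el i).
  have := @mem_nth _ (id : S -> S) (fset_set G) i (ltn_ord i).
  by rewrite in_fset_set // inE.
have elinj : injective el.
  by move=> i j /eqP; rewrite nth_uniq ?fset_uniq // => /eqP/val_inj.
have elsurj h : G h -> exists i, el i = h.
  move=> Gh; have : h \in fset_set G by rewrite in_fset_set // inE.
  move=> /(nthP (id : S -> S))[k kn <-]; by exists (Ordinal kn).
have [I [i0 [u [uS u1 usep uimm]]]] := finite_coordinates cS.
have [m0 m0E] := g_id GG elsurj.
have [a [a1 a2]] := generic_parameter cS GG G5 Gel elinj elsurj uS u1 usep uimm m0E.
(* As a boolean predicate, embeddability admits a least dimension by [ex_minnP], and n = |G| bounds
   it. *)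
have emb : `[< equivariantly_embeds G n >].
  apply/asboolP; exists (orbit_map el (fa u a)); split.
    apply: (orbit_map_embedding cS GG Gel (Sm_fa uS a)); first exact: a1.
    move=> x c v ac cx v0; apply: contrapT => H; apply: (a2 x); exists c, v; split=> // i.
    by apply: contrapT => /eqP Hi; apply: H; exists i.
  exact: (orbit_map_equivariant GG Gel elinj elsurj).
have ex : exists d, `[< equivariantly_embeds G d >] by exists n.
case: (ex_minnP ex) => d /asboolP Ed dmin; exists d; last exact: dmin.
by split=> // m Em; apply: dmin; apply/asboolP.
Qed.
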